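(* Let $r\ge0$ and let $\omega_0,\omega_1,\dots,\omega_r,z\in\mathbf{C}$ satisfy $0<\arg\omega_0\le\pi$, $\arg\omega_0-\pi\le\arg z\le\arg\omega_0$, $\arg\omega_0-\pi<\arg\omega_j<\arg\omega_0$ for $1\le j\le r$, and $z\notin\mathbf{Z}\omega_0$. Write $\boldsymbol{\omega}=(\omega_1,\dots,\omega_r)$. (1) The bilateral zeta function $\xi_{r+1}(s,z\mid\omega_0;\boldsymbol{\omega})$ is an entire function of $s\in\mathbf{C}$. (2) For all integers $m\ge1$, $\xi_{r+1}(1-m,z\mid\omega_0;\boldsymbol{\omega})=0$.
   Context: Conventions: for $w\in\mathbf{C}\setminus\{0\}$, $\arg w\in(-\pi,\pi]$ and $w^{-s}=\exp(-s(\log|w|+i\arg w))$; all $\omega_j$ are nonzero. Under the conditions on $z,\omega_0,\boldsymbol{\omega}$ in the claim, the bilateral zeta function is defined for $\operatorname{Re}(s)>r+1$ by $$\xi_{r+1}(s,z\mid\omega_0;\boldsymbol{\omega})=\zeta_{r+1}(s,z+\omega_0\mid\omega_0,\boldsymbol{\omega})+\zeta_{r+1}(s,z\mid-\omega_0,\boldsymbol{\omega})=\sum_{n\in\mathbf{Z}}\sum_{m_1,\dots,m_r\ge0}(z+n\omega_0+m_1\omega_1+\cdots+m_r\omega_r)^{-s},$$ where $\zeta_{r+1}(s,z\mid\omega_0,\boldsymbol{\omega})=\sum_{m_0,\dots,m_r\ge0}(z+m_0\omega_0+\cdots+m_r\omega_r)^{-s}$ is the Barnes zeta function; for other $s$ it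 is defined by meromorphic continuation in $s$. *)

(* Defs.v *)
(* Stdlib reals with Coquelicot's complex numbers. *)
From Stdlib Require Import Reals List ZArith.
From Coquelicot Require Import Coquelicot.

Open Scope R_scope.

Definition Cexp (w : C) : C := (exp (Re w) * cos (Im w), exp (Re w) * sin (Im w)).

(* Principal argument, in (-PI, PI], for w <> 0 (junk value at 0). *)
Definition Carg (w : C) : R :=
  if Rle_dec 0 (Im w) then acos (Re w / Cmod w) else - acos (Re w / Cmod w).

(* [Cpow_neg w s] is w^(-s) for the principal branch, w <> 0. *)
Definition Cpow_neg (w s : C) : C :=
  Cexp (Copp (Cmult s (ln (Cmod w), Carg w))).

Definition Csum {I : Type} (a : I -> C) (l : list I) : C :=
  fold_right (fun i t => Cplus (a i) t) (RtoC 0) l.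

(* Unordered (unconditional, equivalently absolute) summation over the indices
   in P: the finite partial sums converge along the finite subsets of P. *)
Definition has_sum {I : Type} (P : I -> Prop) (a : I -> C) (S : C) : Prop :=
  forall eps : R, 0 < eps ->
  exists l0 : list I, NoDup l0 /\ List.Forall P l0 /\
    forall l : list I, NoDup l -> List.Forall P l -> incl l0 l ->
      Cmod (Cminus (Csum a l) S) < eps.

Definition lin_comb (m : list nat) (w : list C) : C :=
  Csum (fun p => Cmult (RtoC (INR (fst p))) (snd p)) (combine m w).

(* [is_barnes_zeta s z w S]: the series of the Barnes zeta function
   zeta_{length w}(s, z | w), over all multi-indices of length [length w],
   converges (absolutely) and its sum is S. *)
Definition is_barnes_zeta (s z : C) (w : list C) (S : C) : Prop :=
  has_sum (fun m : list nat => length m = length w)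
          (fun m => Cpow_neg (Cplus z (lin_comb m w)) s) S.

(* The bilateral zeta function on Re s > r + 1, where r = length omega. *)
Definition is_bilateral_series (s z omega0 : C) (omega : list C) (S : C) : Prop :=
  exists S1 S2 : C,
    is_barnes_zeta s (Cplus z omega0) (omega0 :: omega) S1 /\
    is_barnes_zeta s z (Copp omega0 :: omega) S2 /\
    S = Cplus S1 S2.

Definition analytic_at (g : C -> C) (s0 : C) : Prop :=
  exists (a : nat -> C) (rho : R), 0 < rho /\
    forall s : C, Cmod (Cminus s s0) < rho ->
      @is_pseries C_AbsRing C_NormedModule a (Cminus s s0) (g s).

Definition meromorphic_at (F : C -> C) (s0 : C) : Prop :=
  exists (k : nat) (g : C -> C) (rho : R), 0 < rho /\ analytic_at g s0 /\
    forall s : C, 0 < Cmod (Cminus s s0) < rho ->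
      F s = Cdiv (g s) (Cpow (Cminus s s0) k).

(* A meromorphic function on C is represented by a total function whose values
   at its poles are irrelevant; the second clause says that removable
   singularities have been removed, i.e. that F has its correct value at every
   point that is not a pole. *)
Definition meromorphic (F : C -> C) : Prop :=
  (forall s0 : C, meromorphic_at F s0) /\
  (forall s0 L : C, filterlim F (locally' s0) (locally L) -> F s0 = L).

(* F is the bilateral zeta function xi_{r+1}( . , z | omega0; omega): the
   meromorphic continuation to C of the sum of the series. *)
Definition is_bilateral_zeta (z omega0 : C) (omega : list C) (F : C -> C) : Prop :=
  meromorphic F /\
  forall s : C, Re s > INR (length omega) + 1 ->
    is_bilateral_series s z omega0 omega (F s).

Definition entire (F : C -> C) : Prop :=
  forall s : C, @ex_derive C_AbsRing C_NormedModule F s.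

(* Main.v *)
(* Write h for omega0. The quotient D(w, s) = ((w + h)^(1-s) - w^(1-s)) / (h (1 - s))
   is entire in s, has the expansion sum_l q_l(s) w^(-s-l) for |w| large, with q_l
   polynomial and q_0 = 1, and its sum over the points
   w = z + n h + m_1 omega_1 + ... (n in Z) telescopes to 0. Let T_L(w, s) be the
   remainder after the terms l < L; its sum over the lattice converges for
   Re s > r + 1 - L. Then
     xi(s) = - sum_w T_L(w, s) - sum_(1 <= l < L) q_l(s) xi(s + l)
   continues xi one unit to the left at a time, without poles. At s = 1 - m with
   1 <= m <= L, the binomial theorem gives T_L = 0, and q_l vanishes for l >= m, so
   xi(1 - m) = 0 by induction on m. *)
Require Import Defs.
From Stdlib Require Import Reals List ZArith Lra Lia ClassicalEpsilon Wf_nat FinFun.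
From Coquelicot Require Import Coquelicot.

Open Scope R_scope.

(** * Unconditional sums *)

(** Contour integrals are avoided: analyticity at s0 is carried as a Taylor expansion whose
    remainder after N terms is at most M (|t| / rho)^N. The constants M add up over a family, so a
    lattice sum is analytic as soon as they are summable, and everything reduces to estimates at one
    point w, uniform in w. A disc of radius rho costs a factor |w|^rho, harmless because rho may be
    small compared with the distance to the abscissa of convergence. The expansion of D needs a
    logarithm continuous along the segment from w to w + h. The hypotheses put all lattice points in
    the closed half-plane of arguments [arg h - pi, arg h], and 0 < arg h <= pi keeps this interval
    inside the range of the principal argument. Each of the two one-sided Barnes series may have
    poles; only their sum telescopes to 0, so both are continued together. A bilateral zeta function
    is a priori only meromorphic. Entireness is therefore proved for the constructed continuation
    and transferred by an identity theorem between a meromorphic and an analytic function. *)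

Definition Rsum {I : Type} (b : I -> R) (l : list I) : R :=
  fold_right (fun i t => b i + t) 0 l.

(** Summability of a nonnegative majorant, kept as an explicit bound because this bound becomes the
    analyticity constant of a sum over the family. *)
Definition bounded_sums {I : Type} (P : I -> Prop) (b : I -> R) (B : R) : Prop :=
  forall l : list I, NoDup l -> List.Forall P l -> Rsum b l <= B.

Lemma Rsum_cons {I : Type} (b : I -> R) i l : Rsum b (i :: l) = b i + Rsum b l.
Proof. reflexivity. Qed.

Lemma Csum_cons {I : Type} (a : I -> C) i l :
  Csum a (i :: l) = (a i + Csum a l)%C.
Proof. reflexivity. Qed.

Lemma Csum_app {I : Type} (a : I -> C) l1 l2 :
  Csum a (l1 ++ l2) = (Csum a l1 + Csum a l2)%C.
Proof.
  induction l1 as [|i l1 IH].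
  - change (Csum a l2 = 0 + Csum a l2)%C. ring.
  - change (a i + Csum a (l1 ++ l2) = a i + Csum a l1 + Csum a l2)%C.
    rewrite IH. ring.
Qed.

Lemma Csum_ext {I : Type} (a b : I -> C) l :
  (forall i, In i l -> a i = b i) -> Csum a l = Csum b l.
Proof.
  induction l as [|i l IH]; intros H; [reflexivity|].
  rewrite 2!Csum_cons, (H i) by now left.
  rewrite IH; [reflexivity|]. intros j Hj; apply H; now right.
Qed.

Lemma Csum_plus {I : Type} (a b : I -> C) l :
  Csum (fun i => a i + b i)%C l = (Csum a l + Csum b l)%C.
Proof.
  induction l as [|i l IH]; [cbn; ring|].
  rewrite 3!Csum_cons, IH. ring.
Qed.

Lemma Csum_scal {I : Type} c (a : I -> C) l :
  Csum (fun i => c * a i)%C l = (c * Csum a l)%C.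
Proof.
  induction l as [|i l IH]; [cbn; ring|].
  rewrite 2!Csum_cons, IH. ring.
Qed.

Lemma Csum_RtoC {I : Type} (b : I -> R) l :
  Csum (fun i => RtoC (b i)) l = RtoC (Rsum b l).
Proof.
  induction l as [|i l IH]; [reflexivity|].
  rewrite Csum_cons, IH. cbn. now rewrite <- RtoC_plus.
Qed.

Lemma Rsum_le {I : Type} (P : I -> Prop) (a b : I -> R) l :
  List.Forall P l -> (forall i, P i -> a i <= b i) -> Rsum a l <= Rsum b l.
Proof.
  intros Hl H. induction Hl as [|i l Hi Hl IH]; [apply Rle_refl|].
  apply Rplus_le_compat; auto.
Qed.

Lemma Cmod_Csum_le {I : Type} (P : I -> Prop) (a : I -> C) b l :
  List.Forall P l -> (forall i, P i -> Cmod (a i) <= b i) ->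
  Cmod (Csum a l) <= Rsum b l.
Proof.
  intros Hl H. induction Hl as [|i l Hi Hl IH].
  - cbn. rewrite Cmod_0. apply Rle_refl.
  - rewrite Csum_cons. eapply Rle_trans; [apply Cmod_triangle|].
    apply Rplus_le_compat; auto.
Qed.

Lemma Rsum_scal {I : Type} c (b : I -> R) l :
  Rsum (fun i => c * b i) l = c * Rsum b l.
Proof. induction l as [|i l IH]; [unfold Rsum; simpl; ring|]. rewrite !Rsum_cons, IH. ring. Qed.

Lemma Rsum_app {I : Type} (b : I -> R) l1 l2 :
  Rsum b (l1 ++ l2) = Rsum b l1 + Rsum b l2.
Proof.
  induction l1 as [|i l IH]; [symmetry; apply Rplus_0_l|].
  rewrite <- app_comm_cons, !Rsum_cons, IH. ring.
Qed.

Lemma Rsum_incl {I : Type} (P : I -> Prop) (b : I -> R) l l' :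
  (forall i, P i -> 0 <= b i) -> NoDup l -> List.Forall P l' -> incl l l' ->
  Rsum b l <= Rsum b l'.
Proof.
  intros Hb Hl. revert l'. induction Hl as [|i l Hi Hl IH]; intros l' HP H.
  - cbn. induction HP as [|j l' Hj _ IH]; cbn; [lra|].
    assert (0 <= b j) by auto.
    assert (0 <= Rsum b l') by (apply IH; intros x []). unfold Rsum in *; lra.
  - destruct (in_split i l') as [l1 [l2 ->]]; [apply H; now left|].
    assert (HP' : List.Forall P (l1 ++ l2)).
    { apply Forall_app in HP. destruct HP as [HP1 HP2].
      inversion HP2; subst. now apply Forall_app. }
    assert (Hin : incl l (l1 ++ l2)).
    { intros x Hx. assert (Hx' := H x (or_intror Hx)).
      apply in_app_or in Hx'. apply in_or_app.
      destruct Hx' as [Hx'|[Hx'|Hx']]; auto. subst; tauto. }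
    specialize (IH _ HP' Hin). rewrite Rsum_app in IH |- *. cbn.
    unfold Rsum in *; lra.
Qed.

(** Unions of index sets have to be made duplicate-free again, since [has_sum] only speaks of lists
    without repetition. *)
Lemma nodup_exists {I : Type} (P : I -> Prop) (l : list I) :
  List.Forall P l -> exists l', NoDup l' /\ List.Forall P l' /\ incl l l'.
Proof.
  induction 1 as [|i l Hi Hl [l' [H1 [H2 H3]]]].
  - exists nil. repeat split; auto using NoDup_nil. intros x [].
  - destruct (excluded_middle_informative (In i l')) as [Hin|Hin].
    + exists l'. repeat split; auto. intros x [<-|Hx]; auto.
    + exists (i :: l'). repeat split; auto using NoDup_cons.
      intros x [<-|Hx]; [now left|right; auto].
Qed.

Lemma has_sum_ext {I : Type} (P : I -> Prop) (a b : I -> C) S :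
  (forall i, P i -> a i = b i) -> has_sum P a S -> has_sum P b S.
Proof.
  intros H Ha eps Heps. destruct (Ha eps Heps) as [l0 [H1 [H2 H3]]].
  exists l0. repeat split; auto. intros l Hl HP Hi.
  rewrite <- (Csum_ext a b); auto. intros i Hi'. apply H.
  rewrite Forall_forall in HP. auto.
Qed.

Lemma has_sum_plus {I : Type} (P : I -> Prop) (a b : I -> C) S T :
  has_sum P a S -> has_sum P b T -> has_sum P (fun i => a i + b i)%C (S + T)%C.
Proof.
  intros Ha Hb eps Heps.
  destruct (Ha (eps / 2)) as [la [Ha1 [Ha2 Ha3]]]; [lra|].
  destruct (Hb (eps / 2)) as [lb [Hb1 [Hb2 Hb3]]]; [lra|].
  destruct (nodup_exists P (la ++ lb)) as [l0 [H1 [H2 H3]]].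
  { now apply Forall_app. }
  exists l0. repeat split; auto. intros l Hl HP Hi.
  rewrite Csum_plus.
  replace (Csum a l + Csum b l - (S + T))%C
    with ((Csum a l - S) + (Csum b l - T))%C by ring.
  assert (Cmod (Csum a l - S) < eps / 2).
  { apply Ha3; auto. intros x Hx. apply Hi, H3, in_or_app; auto. }
  assert (Cmod (Csum b l - T) < eps / 2).
  { apply Hb3; auto. intros x Hx. apply Hi, H3, in_or_app; auto. }
  eapply Rle_lt_trans; [apply Cmod_triangle|]. lra.
Qed.

Lemma has_sum_scal {I : Type} (P : I -> Prop) c (a : I -> C) S :
  has_sum P a S -> has_sum P (fun i => c * a i)%C (c * S)%C.
Proof.
  intros Ha eps Heps.
  assert (Hc := Cmod_ge_0 c).
  destruct (Ha (eps / (Cmod c + 1))) as [l0 [H1 [H2 H3]]].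
  { apply Rdiv_lt_0_compat; lra. }
  exists l0. repeat split; auto. intros l Hl HP Hi.
  rewrite Csum_scal. replace (c * Csum a l - c * S)%C with (c * (Csum a l - S))%C by ring.
  rewrite Cmod_mult. specialize (H3 l Hl HP Hi).
  assert (Hm := Cmod_ge_0 (Csum a l - S)).
  apply Rle_lt_trans with ((Cmod c) * (eps / (Cmod c + 1))).
  - apply Rmult_le_compat_l; lra.
  - apply Rlt_le_trans with ((Cmod c + 1) * (eps / (Cmod c + 1))).
    + apply Rmult_lt_compat_r; [apply Rdiv_lt_0_compat; lra|lra].
    + right. field. lra.
Qed.

Lemma has_sum_0 {I : Type} (P : I -> Prop) : has_sum P (fun _ => RtoC 0) (RtoC 0).
Proof.
  intros eps Heps. exists nil. repeat split; auto using NoDup_nil.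
  intros l _ _ _. replace (Csum (fun _ : I => RtoC 0) l) with (RtoC 0).
  - replace (RtoC 0 - RtoC 0)%C with (RtoC 0) by ring. now rewrite Cmod_0.
  - induction l as [|i l IH]; [reflexivity|]. rewrite Csum_cons, <- IH. ring.
Qed.

Lemma has_sum_Cmod_le {I : Type} (P : I -> Prop) (a : I -> C) b B S :
  has_sum P a S -> (forall i, P i -> Cmod (a i) <= b i) ->
  bounded_sums P b B -> Cmod S <= B.
Proof.
  intros Ha Hab HB. apply le_epsilon. intros eps Heps.
  destruct (Ha eps Heps) as [l0 [H1 [H2 H3]]].
  specialize (H3 l0 H1 H2 (incl_refl _)). specialize (HB l0 H1 H2).
  assert (Cmod (Csum a l0) <= Rsum b l0) by (eapply Cmod_Csum_le; eauto).
  replace S with (Csum a l0 + - (Csum a l0 - S))%C by ring.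
  eapply Rle_trans; [apply Cmod_triangle|]. rewrite Cmod_opp. lra.
Qed.

Lemma has_sum_unique {I : Type} (P : I -> Prop) (a : I -> C) S T :
  has_sum P a S -> has_sum P a T -> S = T.
Proof.
  intros HS HT. apply (has_sum_scal _ (-(1))%C) in HT.
  assert (H := has_sum_plus _ _ _ _ _ HS HT).
  (* The difference is a sum of the zero family, hence bounded by 0. *)
  assert (H0 : Cmod (S + -(1) * T) <= 0).
  { eapply (has_sum_Cmod_le _ _ (fun _ => 0) 0 _ H).
    - intros i _. right. replace (a i + - (1) * a i)%C with (RtoC 0) by ring. apply Cmod_0.
    - intros l _ _. right. induction l as [|i l IH]; cbn; [auto|]. unfold Rsum in IH; lra. }
  assert (H1 : (S + -(1) * T = 0)%C).
  { apply Cmod_eq_0. assert (Hm := Cmod_ge_0 (S + - (1) * T)). lra. }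
  replace S with (S + - (1) * T + T)%C by ring. rewrite H1. ring.
Qed.

(** The sum is the supremum of the finite partial sums; by positivity, enlarging an index set that
    comes within [eps] of it keeps it there. *)
Lemma has_sum_nonneg {I : Type} (P : I -> Prop) (b : I -> R) B :
  (forall i, P i -> 0 <= b i) -> bounded_sums P b B ->
  exists S : R, has_sum P (fun i => RtoC (b i)) (RtoC S).
Proof.
  intros Hb HB.
  destruct (completeness (fun x => exists l, NoDup l /\ List.Forall P l /\ x = Rsum b l))
    as [S [HS1 HS2]].
  - exists B. intros x [l [H1 [H2 ->]]]. now apply HB.
  - exists 0, nil. repeat split; auto using NoDup_nil.
  - exists S. intros eps Heps.
    assert (Hex : exists l0, NoDup l0 /\ List.Forall P l0 /\ S - eps < Rsum b l0).
    { apply NNPP. intros Hn. assert (S <= S - eps); [|lra].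
      apply HS2. intros x [l [H1 [H2 ->]]].
      apply Rnot_lt_le. intros Hlt. apply Hn. now exists l. }
    destruct Hex as [l0 [H1 [H2 H3]]]. exists l0. repeat split; auto.
    intros l Hl HP Hi. rewrite Csum_RtoC, <- RtoC_minus, Cmod_R.
    assert (Rsum b l0 <= Rsum b l) by (eapply Rsum_incl; eauto).
    assert (Rsum b l <= S) by (apply HS1; now exists l).
    apply Rabs_def1; lra.
Qed.

Lemma has_sum_exists {I : Type} (P : I -> Prop) (a : I -> C) b B :
  (forall i, P i -> Cmod (a i) <= b i) -> bounded_sums P b B ->
  exists S, has_sum P a S.
Proof.
  intros Hab HB.
  assert (Hb : forall i, P i -> 0 <= b i).
  { intros i Hi. eapply Rle_trans; [apply Cmod_ge_0|now apply Hab]. }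
  destruct (has_sum_nonneg P b B Hb HB) as [Sb HSb].
  (* For real [c] dominated by [b], the family [c + b] is nonnegative and dominated by [2 b];
     subtracting the sum of [b] recovers [c]. *)
  assert (Hreal : forall c : I -> R, (forall i, P i -> Rabs (c i) <= b i) ->
            exists S, has_sum P (fun i => RtoC (c i)) S).
  { intros c Hc. destruct (has_sum_nonneg P (fun i => c i + b i) (2 * B)) as [S HS].
    - intros i Hi. assert (H := Hc i Hi). apply Rabs_le_between in H. lra.
    - intros l Hl HP. assert (H := HB l Hl HP).
      apply Rle_trans with (Rsum (fun i => 2 * b i) l).
      + apply (Rsum_le P); auto. intros i Hi. assert (H' := Hc i Hi).
        apply Rabs_le_between in H'. lra.
      + rewrite Rsum_scal. lra.
    - exists (S + (-(1)) * Sb)%C.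
      eapply has_sum_ext; [|apply has_sum_plus; [exact HS|apply (has_sum_scal _ (-(1))%C), HSb]].
      intros i _. cbn beta. rewrite RtoC_plus. ring. }
  destruct (Hreal (fun i => Re (a i))) as [S1 H1].
  { intros i Hi. eapply Rle_trans; [apply re_le_Cmod|auto]. }
  destruct (Hreal (fun i => Im (a i))) as [S2 H2].
  { intros i Hi. eapply Rle_trans; [|apply (Hab i Hi)].
    eapply Rle_trans; [|apply Rmax_Cmod]. apply Rmax_r. }
  exists (S1 + Ci * S2)%C.
  eapply has_sum_ext; [|apply has_sum_plus; [exact H1|apply (has_sum_scal _ Ci), H2]].
  intros i _. cbn beta. destruct (a i) as [x y]. unfold Ci, RtoC, Cmult, Cplus. cbn.
  f_equal; ring.
Qed.

(** * Ordered partial sums of complex sequences *)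

Fixpoint psum (a : nat -> C) (N : nat) : C :=
  match N with
  | O => RtoC 0
  | S n => (psum a n + a n)%C
  end.

Lemma psum_Csum a N : psum a N = Csum a (seq 0 N).
Proof.
  induction N as [|N IH]; [reflexivity|].
  rewrite seq_S, Csum_app, <- IH. cbn. ring.
Qed.

Lemma psum_ext a b N : (forall n, (n < N)%nat -> a n = b n) -> psum a N = psum b N.
Proof.
  induction N as [|N IH]; intros H; cbn; [reflexivity|].
  rewrite IH, (H N); auto.
Qed.

Lemma psum_plus a b N : psum (fun n => a n + b n)%C N = (psum a N + psum b N)%C.
Proof. induction N as [|N IH]; cbn; [|rewrite IH]; ring. Qed.

Lemma psum_scal c a N : psum (fun n => c * a n)%C N = (c * psum a N)%C.
Proof. induction N as [|N IH]; cbn; [|rewrite IH]; ring. Qed.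

Lemma psum_shift a N : psum a (S N) = (a 0%nat + psum (fun n => a (S n)) N)%C.
Proof.
  induction N as [|N IH]; [cbn; ring|].
  change (psum a (S N) + a (S N) =
    a 0%nat + (psum (fun n => a (S n)) N + a (S N)))%C. rewrite IH. ring.
Qed.

Lemma psum_0 (a : nat -> C) N : (forall n, (n < N)%nat -> a n = 0)%C -> psum a N = RtoC 0.
Proof.
  induction N as [|N IH]; intros H; cbn; [reflexivity|].
  rewrite IH, (H N); auto. ring.
Qed.

Lemma has_sum_psum {I : Type} (P : I -> Prop) (a : I -> nat -> C) (S : nat -> C) N :
  (forall n, (n < N)%nat -> has_sum P (fun i => a i n) (S n)) ->
  has_sum P (fun i => psum (a i) N) (psum S N).
Proof.
  induction N as [|N IH]; intros H; cbn.
  - apply has_sum_0.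
  - apply has_sum_plus; auto.
Qed.

Lemma Forall_True {I : Type} (l : list I) : List.Forall (fun _ => True) l.
Proof. induction l; auto. Qed.

(* A finite set of naturals lies in an initial segment. *)
Lemma bounded_sums_nat (b : nat -> R) B :
  (forall n, 0 <= b n) -> (forall N, Rsum b (seq 0 N) <= B) ->
  bounded_sums (fun _ => True) b B.
Proof.
  intros Hb HB l Hl _.
  eapply Rle_trans; [|apply (HB (S (list_max l)))].
  apply (Rsum_incl (fun _ => True)); auto using Forall_True.
  intros x Hx. apply in_seq.
  assert (H := proj1 (list_max_le l (list_max l)) (le_n _)).
  rewrite Forall_forall in H. specialize (H x Hx). lia.
Qed.

(** * Taylor expansions with geometric remainder *)

(** Analyticity in quantitative form. [M] bounds [f] on the closed disc (case [N = 0]) and all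
    scaled remainders at once; it behaves like a norm, so it can be added over infinite families.
    Including the circle [Cmod t = rho] makes the coefficient estimate [taylor_coefs_bound]
    available. *)
Definition taylor_coefs (s0 : C) (rho : R) (f : C -> C) (M : R) (a : nat -> C) : Prop :=
  forall t, Cmod t <= rho -> forall N,
    Cmod (f (s0 + t) - psum (fun j => a j * t ^ j) N)%C <= M * (Cmod t / rho) ^ N.

Definition taylor_bounded (s0 : C) (rho : R) (f : C -> C) (M : R) : Prop :=
  exists a, taylor_coefs s0 rho f M a.

Lemma ratio_bounds rho t : 0 < rho -> Cmod t <= rho -> 0 <= Cmod t / rho <= 1.
Proof.
  intros Hr Ht. assert (H := Cmod_ge_0 t). split.
  - apply Rdiv_le_0_compat; lra.
  - apply (Rmult_le_reg_r rho); [lra|]. unfold Rdiv.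
    rewrite Rmult_assoc, Rinv_l; lra.
Qed.

Lemma taylor_bounded_value s0 rho f M t :
  taylor_bounded s0 rho f M -> Cmod t <= rho -> Cmod (f (s0 + t)%C) <= M.
Proof.
  intros [a Ha] Ht. specialize (Ha t Ht 0%nat). cbn in Ha.
  rewrite Rmult_1_r in Ha.
  replace (f (s0 + t) - 0)%C with (f (s0 + t)%C) in Ha by ring. exact Ha.
Qed.

Lemma taylor_bounded_nonneg s0 rho f M :
  0 < rho -> taylor_bounded s0 rho f M -> 0 <= M.
Proof.
  intros Hr H. apply (taylor_bounded_value _ _ _ _ 0%C) in H.
  - eapply Rle_trans; [apply Cmod_ge_0|exact H].
  - rewrite Cmod_0. lra.
Qed.

Lemma taylor_bounded_ext s0 rho f g M :
  (forall t, Cmod t <= rho -> f (s0 + t)%C = g (s0 + t)%C) ->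
  taylor_bounded s0 rho f M -> taylor_bounded s0 rho g M.
Proof.
  intros H [a Ha]. exists a. intros t Ht N. rewrite <- H; auto.
Qed.

Lemma taylor_bounded_le s0 rho f M M' :
  0 < rho -> M <= M' -> taylor_bounded s0 rho f M -> taylor_bounded s0 rho f M'.
Proof.
  intros Hr HM [a Ha]. exists a. intros t Ht N.
  eapply Rle_trans; [now apply Ha|]. apply Rmult_le_compat_r; [|lra].
  apply pow_le. now apply ratio_bounds.
Qed.

Lemma taylor_bounded_radius s0 rho rho' f M :
  0 < rho' <= rho -> taylor_bounded s0 rho f M -> taylor_bounded s0 rho' f M.
Proof.
  intros Hr H. assert (HM : 0 <= M) by (eapply taylor_bounded_nonneg; [|exact H]; lra).
  destruct H as [a Ha]. exists a. intros t Ht N.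
  eapply Rle_trans; [apply Ha; lra|]. apply Rmult_le_compat_l; [auto|].
  apply pow_incr. split.
  - apply ratio_bounds; lra.
  - apply Rmult_le_compat_l; [apply Cmod_ge_0|]. apply Rinv_le_contravar; lra.
Qed.

Lemma taylor_bounded_shift s0 c rho f M :
  taylor_bounded (s0 + c)%C rho f M -> taylor_bounded s0 rho (fun s => f (s + c)%C) M.
Proof.
  intros [a Ha]. exists a. intros t Ht N.
  replace (s0 + t + c)%C with (s0 + c + t)%C by ring. auto.
Qed.

Lemma taylor_bounded_const s0 rho c :
  0 < rho -> taylor_bounded s0 rho (fun _ => c) (Cmod c).
Proof.
  intros Hr. exists (fun j => match j with O => c | _ => RtoC 0 end).
  intros t Ht [|N].
  - cbn. rewrite Rmult_1_r. right. f_equal. ring.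
  - rewrite psum_shift. rewrite psum_0 by (intros; cbn; ring).
    cbn [Cpow]. replace (c - (c * 1 + 0))%C with (RtoC 0) by ring.
    rewrite Cmod_0. apply Rmult_le_pos; [apply Cmod_ge_0|].
    apply pow_le. now apply ratio_bounds.
Qed.

Lemma taylor_bounded_plus s0 rho f g M M' :
  taylor_bounded s0 rho f M -> taylor_bounded s0 rho g M' ->
  taylor_bounded s0 rho (fun s => f s + g s)%C (M + M').
Proof.
  intros [a Ha] [b Hb]. exists (fun j => a j + b j)%C. intros t Ht N.
  rewrite (psum_ext _ (fun j => a j * t ^ j + b j * t ^ j)%C) by (intros; ring).
  rewrite psum_plus, Rmult_plus_distr_r.
  replace (f (s0 + t) + g (s0 + t)
     - (psum (fun j => a j * t ^ j) N + psum (fun j => b j * t ^ j) N))%C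
    with ((f (s0 + t) - psum (fun j => a j * t ^ j) N)
          + (g (s0 + t) - psum (fun j => b j * t ^ j) N))%C by ring.
  eapply Rle_trans; [apply Cmod_triangle|]. apply Rplus_le_compat; auto.
Qed.

Lemma taylor_bounded_scal s0 rho c f M :
  taylor_bounded s0 rho f M -> taylor_bounded s0 rho (fun s => c * f s)%C (Cmod c * M).
Proof.
  intros [a Ha]. exists (fun j => c * a j)%C. intros t Ht N.
  rewrite (psum_ext _ (fun j => c * (a j * t ^ j))%C) by (intros; ring).
  rewrite psum_scal.
  replace (c * f (s0 + t) - c * psum (fun j => a j * t ^ j) N)%C
    with (c * (f (s0 + t) - psum (fun j => a j * t ^ j) N))%C by ring.
  rewrite Cmod_mult, Rmult_assoc. apply Rmult_le_compat_l; [apply Cmod_ge_0|auto].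
Qed.

(** The factor [Cmod (s0 + c) + rho] is the maximum of |s + c| on the disc. *)
Lemma taylor_bounded_linear s0 rho c f M :
  0 < rho -> taylor_bounded s0 rho f M ->
  taylor_bounded s0 rho (fun s => (s + c) * f s)%C ((Cmod (s0 + c) + rho) * M).
Proof.
  intros Hr H. assert (HM := taylor_bounded_nonneg _ _ _ _ Hr H). destruct H as [a Ha].
  exists (fun j => match j with O => (s0 + c) * a O
                          | S i => (s0 + c) * a (S i) + a i end)%C.
  intros t Ht [|N].
  - specialize (Ha t Ht 0%nat). cbn in Ha |- *.
    replace ((s0 + t + c) * f (s0 + t) - 0)%C
      with ((s0 + c + t) * (f (s0 + t) - 0))%C by ring.
    rewrite Cmod_mult, Rmult_assoc. apply Rmult_le_compat; auto using Cmod_ge_0.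
    eapply Rle_trans; [apply Cmod_triangle|]. lra.
  - rewrite psum_shift.
    rewrite (psum_ext _ (fun j => (s0 + c) * (a (S j) * t ^ S j) + t * (a j * t ^ j))%C)
      by (intros; cbn; ring).
    rewrite psum_plus, 2!psum_scal.
    assert (H1 := Ha t Ht (S N)). assert (H2 := Ha t Ht N).
    rewrite psum_shift in H1.
    set (A := psum (fun n => a (S n) * t ^ S n)%C N) in *.
    set (A' := psum (fun j => a j * t ^ j)%C N) in *.
    (* Writing s + c as (s0 + c) + t splits the remainder into the one after [S N] terms, scaled by
       s0 + c, and the one after [N] terms, scaled by t; the factor t restores the missing order. *)
    replace ((s0 + t + c) * f (s0 + t)
             - ((s0 + c) * a 0%nat * t ^ 0 + ((s0 + c) * A + t * A')))%C
      with ((s0 + c) * (f (s0 + t) - (a 0%nat * t ^ 0 + A)) + t * (f (s0 + t) - A'))%C by ring.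
    eapply Rle_trans; [apply Cmod_triangle|]. rewrite 2!Cmod_mult.
    replace ((Cmod (s0 + c) + rho) * M * (Cmod t / rho) ^ S N)
      with (Cmod (s0 + c) * (M * (Cmod t / rho) ^ S N) + Cmod t * (M * (Cmod t / rho) ^ N))
      by (cbn; field; lra).
    apply Rplus_le_compat; apply Rmult_le_compat_l; auto using Cmod_ge_0.
Qed.


Lemma taylor_bounded_psum s0 rho (f : nat -> C -> C) (M : nat -> R) N :
  0 < rho -> (forall n, (n < N)%nat -> taylor_bounded s0 rho (f n) (M n)) ->
  taylor_bounded s0 rho (fun s => psum (fun n => f n s) N) (Rsum M (seq 0 N)).
Proof.
  intros Hr. induction N as [|N IH]; intros H.
  - replace (Rsum M (seq 0 0)) with (Cmod 0) by apply Cmod_0.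
    now apply (taylor_bounded_const s0 rho (RtoC 0)).
  - rewrite seq_S, Rsum_app, Rsum_cons. cbn [Nat.add].
    replace (M N + Rsum M nil) with (M N) by (symmetry; apply Rplus_0_r).
    apply taylor_bounded_plus; auto.
Qed.

(** A Cauchy estimate without integration: at t = rho the remainders after N and N + 1 terms are
    both at most M and differ by a_N rho^N, whence the factor 2. *)
Lemma taylor_coefs_bound s0 rho f M a N :
  0 < rho -> taylor_coefs s0 rho f M a -> Cmod (a N) <= 2 * M / rho ^ N.
Proof.
  intros Hr Ha.
  assert (Hc : Cmod (RtoC rho) = rho) by (rewrite Cmod_R; apply Rabs_pos_eq; lra).
  assert (H1 := Ha rho ltac:(lra) N). assert (H2 := Ha rho ltac:(lra) (S N)).
  rewrite Hc in H1, H2. replace (rho / rho) with 1 in H1, H2 by (field; lra).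
  rewrite pow1 in H1, H2. cbn [psum] in H2.
  set (A := psum (fun j => a j * RtoC rho ^ j)%C N) in *.
  apply (Rmult_le_reg_r (rho ^ N)); [now apply pow_lt|].
  replace (2 * M / rho ^ N * rho ^ N) with (M * 1 + M * 1)
    by (field; apply pow_nonzero; lra).
  replace (Cmod (a N) * rho ^ N) with (Cmod (a N * RtoC rho ^ N)%C)
    by (rewrite Cmod_mult, Cmod_pow, Hc; reflexivity).
  replace (a N * RtoC rho ^ N)%C
    with ((f (s0 + rho) - A) + - (f (s0 + rho) - (A + a N * RtoC rho ^ N)))%C by ring.
  eapply Rle_trans; [apply Cmod_triangle|]. rewrite Cmod_opp. lra.
Qed.

Lemma bounded_sums_scal {I : Type} (P : I -> Prop) c b B :
  0 <= c -> bounded_sums P b B -> bounded_sums P (fun i => c * b i) (c * B).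
Proof.
  intros Hc H l Hl HP. rewrite Rsum_scal. apply Rmult_le_compat_l; auto.
Qed.

(* Termwise summation preserves Taylor expansions: both the coefficients and the
   remainders are obtained by summing over the family, so no exchange of two
   infinite sums is needed. *)
Lemma taylor_bounded_has_sum {I : Type} (P : I -> Prop) s0 rho (f : I -> C -> C) F M B :
  0 < rho -> (forall i, P i -> taylor_bounded s0 rho (f i) (M i)) ->
  bounded_sums P M B ->
  (forall t, Cmod t <= rho -> has_sum P (fun i => f i (s0 + t)%C) (F (s0 + t)%C)) ->
  taylor_bounded s0 rho F B.
Proof.
  intros Hr Hf HB HF.
  set (a := fun i => epsilon (inhabits (fun _ => RtoC 0)) (taylor_coefs s0 rho (f i) (M i))).
  assert (Ha : forall i, P i -> taylor_coefs s0 rho (f i) (M i) (a i)).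
  { intros i Hi. unfold a. apply epsilon_spec. now apply Hf. }
  set (A := fun j => epsilon (inhabits (RtoC 0)) (has_sum P (fun i => a i j))).
  assert (HA : forall j, has_sum P (fun i => a i j) (A j)).
  { intros j. unfold A. apply epsilon_spec.
    apply has_sum_exists with (fun i => 2 / rho ^ j * M i) (2 / rho ^ j * B).
    - intros i Hi. eapply Rle_trans; [eapply taylor_coefs_bound; eauto|].
      right. field. apply pow_nonzero. lra.
    - apply bounded_sums_scal; auto. apply Rdiv_le_0_compat; [lra|now apply pow_lt]. }
  exists A. intros t Ht N.
  assert (Hq := proj1 (ratio_bounds rho t Hr Ht)).
  rewrite Rmult_comm.
  apply (has_sum_Cmod_le P
    (fun i => f i (s0 + t) + (-(1)) * psum (fun j => a i j * t ^ j) N)%C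
    (fun i => (Cmod t / rho) ^ N * M i)).
  - replace (F (s0 + t) - psum (fun j => A j * t ^ j) N)%C
      with (F (s0 + t) + (-(1)) * psum (fun j => A j * t ^ j) N)%C by ring.
    apply has_sum_plus; [now apply HF|]. apply has_sum_scal.
    apply (has_sum_psum P (fun i j => a i j * t ^ j)%C (fun j => A j * t ^ j)%C).
    intros n _. apply (has_sum_ext _ (fun i => t ^ n * a i n)%C).
    + intros; ring.
    + replace (A n * t ^ n)%C with (t ^ n * A n)%C by ring. apply has_sum_scal, HA.
  - intros i Hi. rewrite Rmult_comm.
    replace (f i (s0 + t) + - (1) * psum (fun j => a i j * t ^ j) N)%C
      with (f i (s0 + t) - psum (fun j => a i j * t ^ j) N)%C by ring.
    now apply Ha.
  - apply bounded_sums_scal; auto. now apply pow_le.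
Qed.

Lemma taylor_bounded_pow s0 rho c f M j :
  0 < rho -> taylor_bounded s0 rho f M ->
  taylor_bounded s0 rho (fun s => (s + c) ^ j * f s)%C ((Cmod (s0 + c) + rho) ^ j * M).
Proof.
  intros Hr Hf. induction j as [|j IH].
  - rewrite Rmult_1_l. eapply taylor_bounded_ext; [|exact Hf]. intros; cbn; ring.
  - cbn [pow]. rewrite Rmult_assoc.
    eapply taylor_bounded_ext; [|apply taylor_bounded_linear with (c := c); [auto|exact IH]].
    intros; cbn; ring.
Qed.

Lemma geometric_small q M eps :
  0 <= q < 1 -> 0 <= M -> 0 < eps -> exists N0, forall N, (N0 <= N)%nat -> M * q ^ N < eps.
Proof.
  intros Hq HM Heps.
  destruct (pow_lt_1_zero q ltac:(rewrite Rabs_pos_eq; lra) (eps / (M + 1)))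
    as [N0 HN0]; [apply Rdiv_lt_0_compat; lra|].
  exists N0. intros N HN. specialize (HN0 N HN).
  rewrite Rabs_pos_eq in HN0 by (apply pow_le; lra).
  apply Rle_lt_trans with ((M + 1) * q ^ N).
  - apply Rmult_le_compat_r; [apply pow_le; lra|lra].
  - apply (Rmult_lt_reg_r (/ (M + 1))); [apply Rinv_0_lt_compat; lra|].
    replace ((M + 1) * q ^ N * / (M + 1)) with (q ^ N) by (field; lra). exact HN0.
Qed.

Lemma sum_n_psum (a : nat -> C) N : sum_n (G := C_AbelianMonoid) a N = psum a (S N).
Proof.
  induction N as [|N IH].
  - rewrite sum_O. cbn. ring.
  - rewrite sum_Sn, IH. reflexivity.
Qed.

Lemma pow_n_Cpow (x : C) n : pow_n (K := C_Ring) x n = Cpow x n.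
Proof. induction n as [|n IH]; cbn; [reflexivity|]. now rewrite IH. Qed.

Lemma is_pseries_psum (a : nat -> C) (x l : C) :
  @is_pseries C_AbsRing C_NormedModule a x l <->
  (forall eps, 0 < eps -> exists N0, forall N, (N0 <= N)%nat ->
     Cmod (psum (fun j => a j * x ^ j) N - l)%C < eps).
Proof.
  assert (Hterm : forall n, sum_n (G := C_NormedModule)
      (fun k => scal (pow_n (K := C_AbsRing) x k) (a k)) n
      = psum (fun j => a j * x ^ j)%C (S n)).
  { intros n. rewrite <- sum_n_psum. apply sum_n_ext. intros k.
    rewrite <- pow_n_Cpow. apply Cmult_comm. }
  unfold is_pseries, is_series. split.
  - intros H eps Heps.
    assert (HL : locally (T := C_UniformSpace) l (fun y => Cmod (y - l) < eps)).
    { apply locally_C. exists (mkposreal eps Heps). intros y Hy. exact Hy. }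
    destruct (H _ HL) as [N0 HN0]. exists (S N0). intros [|N] HN; [lia|].
    specialize (HN0 N ltac:(lia)). cbv beta in HN0. rewrite Hterm in HN0. exact HN0.
  - intros H Q HQ. apply locally_C in HQ. destruct HQ as [eps HQ].
    destruct (H eps (cond_pos eps)) as [N0 HN0].
    exists N0. intros n Hn. rewrite Hterm. apply HQ. apply HN0. lia.
Qed.

Lemma analytic_at_of_taylor s0 rho f M :
  0 < rho -> taylor_bounded s0 rho f M -> analytic_at f s0.
Proof.
  intros Hr Hf. assert (HM := taylor_bounded_nonneg _ _ _ _ Hr Hf).
  destruct Hf as [a Ha]. exists a, rho. split; [auto|].
  intros s Hs. apply is_pseries_psum. intros eps Heps.
  destruct (geometric_small (Cmod (s - s0) / rho) M eps) as [N0 HN0]; auto.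
  { split; [apply ratio_bounds; lra|]. apply (Rmult_lt_reg_r rho); [lra|].
    unfold Rdiv. rewrite Rmult_assoc, Rinv_l; lra. }
  exists N0. intros N HN. specialize (Ha (s - s0)%C ltac:(lra) N).
  replace (s0 + (s - s0))%C with s in Ha by ring.
  rewrite <- Cmod_opp.
  replace (- (psum (fun j => a j * (s - s0) ^ j) N - f s))%C
    with (f s - psum (fun j => a j * (s - s0) ^ j) N)%C by ring.
  eapply Rle_lt_trans; [exact Ha|auto].
Qed.

Lemma eventually_bounded (u : nat -> R) N0 B :
  (forall j, (N0 <= j)%nat -> u j <= B) -> exists A, forall j, u j <= A.
Proof.
  intros Hb.
  assert (Hfin : exists A, forall j, (j < N0)%nat -> u j <= A).
  { clear Hb. induction N0 as [|N IH]; [exists 0; intros; lia|].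
    destruct IH as [A HA]. exists (Rmax A (u N)). intros j Hj.
    destruct (Nat.eq_dec j N) as [->|Hne]; [apply Rmax_r|].
    eapply Rle_trans; [apply HA; lia|apply Rmax_l]. }
  destruct Hfin as [A HA]. exists (Rmax A B). intros j.
  destruct (Nat.lt_ge_cases j N0) as [Hj|Hj].
  - eapply Rle_trans; [now apply HA|apply Rmax_l].
  - eapply Rle_trans; [now apply Hb|apply Rmax_r].
Qed.

(** Convergence at r/2 bounds |a_j| (r/2)^j by some A. On the disc of radius r/4, with q = |t| /
    (r/4), the terms are then at most A q^j 2^(-j), and the tail from N on sums to at most 2 A
    q^N. *)
Lemma taylor_of_analytic_at f s0 :
  analytic_at f s0 -> exists rho M, 0 < rho /\ taylor_bounded s0 rho f M.
Proof.
  intros [a [r [Hr Ha]]].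
  assert (Hh : Cmod (RtoC (r / 2)) = r / 2) by (rewrite Cmod_R; apply Rabs_pos_eq; lra).
  assert (HA : exists A, forall j, Cmod (a j) * (r / 2) ^ j <= A).
  { specialize (Ha (s0 + RtoC (r / 2))%C).
    replace (s0 + RtoC (r / 2) - s0)%C with (RtoC (r / 2)) in Ha by ring.
    specialize (Ha ltac:(lra)).
    rewrite is_pseries_psum in Ha. destruct (Ha 1 Rlt_0_1) as [N0 HN0].
    assert (Hb : forall j, (N0 <= j)%nat -> Cmod (a j) * (r / 2) ^ j <= 2).
    { intros j Hj. assert (H1 := HN0 j Hj). assert (H2 := HN0 (S j) ltac:(lia)).
      cbn [psum] in H2.
      set (A := psum (fun j => a j * RtoC (r / 2) ^ j)%C j) in *.
      set (l := f _) in *.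
      replace (Cmod (a j) * (r / 2) ^ j) with (Cmod (a j * RtoC (r / 2) ^ j)%C)
        by (rewrite Cmod_mult, Cmod_pow, Hh; reflexivity).
      replace (a j * RtoC (r / 2) ^ j)%C
        with ((A + a j * RtoC (r / 2) ^ j - l) + - (A - l))%C by ring.
      eapply Rle_trans; [apply Cmod_triangle|]. rewrite Cmod_opp. lra. }
    now apply (eventually_bounded (fun j => Cmod (a j) * (r / 2) ^ j) N0 2). }
  destruct HA as [A HA].
  assert (HA0 : 0 <= A).
  { eapply Rle_trans; [|apply (HA 0%nat)]. cbn. rewrite Rmult_1_r. apply Cmod_ge_0. }
  exists (r / 4), (2 * A). split; [lra|]. exists a. intros t Ht N.
  assert (Hser := Ha (s0 + t)%C). replace (s0 + t - s0)%C with t in Hser by ring.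
  specialize (Hser ltac:(lra)). rewrite is_pseries_psum in Hser.
  assert (Hq := ratio_bounds (r / 4) t ltac:(lra) Ht). set (q := Cmod t / (r / 4)) in *.
  assert (Hterm : forall j, Cmod (a j * t ^ j)%C <= A * q ^ j * (/ 2) ^ j).
  { intros j. rewrite Cmod_mult, Cmod_pow.
    replace (Cmod t) with (q * / 2 * (r / 2)) by (unfold q; field; lra).
    rewrite 2!Rpow_mult_distr.
    replace (Cmod (a j) * (q ^ j * (/ 2) ^ j * (r / 2) ^ j))
      with (Cmod (a j) * (r / 2) ^ j * (q ^ j * (/ 2) ^ j)) by ring.
    rewrite (Rmult_assoc A). apply Rmult_le_compat_r; auto.
    apply Rmult_le_pos; apply pow_le; lra. }
  assert (Htail : forall k, Cmod (psum (fun j => a j * t ^ j) (N + k)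
      - psum (fun j => a j * t ^ j) N)%C <= A * q ^ N * (2 - 2 * (/ 2) ^ k)).
  { induction k as [|k IH].
    - rewrite Nat.add_0_r. cbn.
      replace (psum (fun j => a j * t ^ j) N - psum (fun j => a j * t ^ j) N)%C
        with (RtoC 0) by ring. rewrite Cmod_0. lra.
    - rewrite Nat.add_succ_r. cbn [psum].
      replace (psum (fun j => a j * t ^ j) (N + k) + a (N + k)%nat * t ^ (N + k)
               - psum (fun j => a j * t ^ j) N)%C
        with ((psum (fun j => a j * t ^ j) (N + k) - psum (fun j => a j * t ^ j) N)
              + a (N + k)%nat * t ^ (N + k))%C by ring.
      eapply Rle_trans; [apply Cmod_triangle|].
      apply Rle_trans with (A * q ^ N * (2 - 2 * (/ 2) ^ k) + A * q ^ N * (/ 2) ^ k).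
      + apply Rplus_le_compat; [exact IH|]. eapply Rle_trans; [apply Hterm|].
        apply Rmult_le_compat; try apply Rmult_le_pos; try apply pow_le; try lra.
        * apply Rmult_le_compat_l; [auto|]. rewrite pow_add.
          rewrite <- (Rmult_1_r (q ^ N)) at 2. apply Rmult_le_compat_l; [apply pow_le; lra|].
          rewrite <- (pow1 k). apply pow_incr. lra.
        * rewrite pow_add. rewrite <- (Rmult_1_l ((/ 2) ^ k)) at 2.
          apply Rmult_le_compat_r; [apply pow_le; lra|].
          rewrite <- (pow1 N). apply pow_incr. lra.
      + right. cbn. field. }
  apply le_epsilon. intros eps Heps.
  destruct (Hser eps Heps) as [N0 HN0]. specialize (HN0 (N + N0)%nat ltac:(lia)).
  specialize (Htail N0).
  set (X := psum (fun j => a j * t ^ j)%C (N + N0)) in *.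
  set (Y := psum (fun j => a j * t ^ j)%C N) in *.
  replace (f (s0 + t) - Y)%C with (- (X - f (s0 + t)) + (X - Y))%C by ring.
  eapply Rle_trans; [apply Cmod_triangle|]. rewrite Cmod_opp.
  assert (0 <= A * q ^ N * (2 * (/ 2) ^ N0)).
  { repeat apply Rmult_le_pos; try apply pow_le; lra. }
  lra.
Qed.

(** * Isolated zeros and uniqueness of meromorphic continuation *)

Lemma taylor_coefs_0 s0 rho f M a :
  0 < rho -> taylor_coefs s0 rho f M a -> f s0 = a 0%nat.
Proof.
  intros Hr Ha. assert (H := Ha (RtoC 0) ltac:(rewrite Cmod_0; lra) 1%nat).
  cbn in H. rewrite Cmod_0 in H.
  replace (M * (0 / rho * 1)) with 0 in H by (field; lra).
  replace (s0 + 0)%C with s0 in H by ring.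
  replace (f s0 - (0 + a 0%nat * 1))%C with (f s0 - a 0%nat)%C in H by ring.
  assert (H0 : (f s0 - a 0%nat)%C = RtoC 0).
  { apply Cmod_eq_0. assert (Hm := Cmod_ge_0 (f s0 - a 0%nat)). lra. }
  replace (f s0) with (f s0 - a 0%nat + a 0%nat)%C by ring. rewrite H0. ring.
Qed.

Lemma taylor_bounded_lipschitz s0 rho f M t :
  0 < rho -> taylor_bounded s0 rho f M -> Cmod t <= rho ->
  Cmod (f (s0 + t) - f s0)%C <= M / rho * Cmod t.
Proof.
  intros Hr [a Ha] Ht. rewrite (taylor_coefs_0 _ _ _ _ _ Hr Ha).
  specialize (Ha t Ht 1%nat). cbn in Ha.
  replace (f (s0 + t) - (0 + a 0%nat * 1))%C with (f (s0 + t) - a 0%nat)%C in Ha by ring.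
  eapply Rle_trans; [exact Ha|]. right. field. lra.
Qed.

(** The remainder after two terms is quadratic in t, so the derivative is the coefficient [a 1]. *)
Lemma ex_derive_of_taylor s0 rho f M :
  0 < rho -> taylor_bounded s0 rho f M -> @ex_derive C_AbsRing C_NormedModule f s0.
Proof.
  intros Hr Hf. assert (HM := taylor_bounded_nonneg _ _ _ _ Hr Hf).
  destruct Hf as [a Ha].
  assert (H0 := taylor_coefs_0 _ _ _ _ _ Hr Ha).
  exists (a 1%nat). split.
  - apply @is_linear_scal_l.
  - intros x Hx. apply (@is_filter_lim_locally_unique C_AbsRing (AbsRing_NormedModule C_AbsRing)) in Hx. subst x.
    intros eps.
    assert (Hd : 0 < Rmin rho (eps * rho ^ 2 / (M + 1))).
    { apply Rmin_glb_lt; [lra|]. apply Rdiv_lt_0_compat; [|lra].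
      apply Rmult_lt_0_compat; [apply cond_pos|apply pow_lt; lra]. }
    exists (mkposreal _ Hd).
    change (forall s : C, Cmod (s - s0) < Rmin rho (eps * rho ^ 2 / (M + 1)) ->
      Cmod (f s - f s0 - (s - s0) * a 1%nat)%C <= eps * Cmod (s - s0)).
    intros s Hs.
    set (t := (s - s0)%C) in *.
    assert (Ht1 : Cmod t < rho) by (eapply Rlt_le_trans; [exact Hs|apply Rmin_l]).
    assert (Ht2 : Cmod t < eps * rho ^ 2 / (M + 1))
      by (eapply Rlt_le_trans; [exact Hs|apply Rmin_r]).
    specialize (Ha t ltac:(lra) 2%nat). cbn in Ha.
    replace (s0 + t)%C with s in Ha by (unfold t; ring). rewrite H0.
    replace (f s - (0 + a 0%nat * 1 + a 1%nat * (t * 1)))%C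
      with (f s - a 0%nat - t * a 1%nat)%C in Ha by ring.
    eapply Rle_trans; [exact Ha|].
    replace (M * (Cmod t / rho * (Cmod t / rho * 1)))
      with (M / rho ^ 2 * Cmod t * Cmod t) by (field; lra).
    apply Rmult_le_compat_r; [apply Cmod_ge_0|].
    apply Rle_trans with ((M + 1) / rho ^ 2 * (eps * rho ^ 2 / (M + 1))).
    + apply Rmult_le_compat; try apply Cmod_ge_0; try lra.
      * apply Rdiv_le_0_compat; [lra|apply pow_lt; lra].
      * apply Rmult_le_compat_r; [|lra]. left. apply Rinv_0_lt_compat, pow_lt. lra.
    + right. field. lra.
Qed.

(** If a_k is the first nonzero coefficient, a zero at distance |t| forces |a_k t^k| <= M (|t| /
    rho)^(k+1), which fails for small t > 0 in modulus. If all coefficients vanish, the remainder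
    bounds tend to 0 inside the disc. *)
Lemma taylor_zeros_isolated s0 rho f M :
  0 < rho -> taylor_bounded s0 rho f M ->
  (exists r, 0 < r /\ forall s, 0 < Cmod (s - s0) < r -> f s = RtoC 0) \/
  (exists r, 0 < r /\ forall s, 0 < Cmod (s - s0) < r -> f s <> RtoC 0).
Proof.
  intros Hr Hf. assert (HM := taylor_bounded_nonneg _ _ _ _ Hr Hf).
  destruct Hf as [a Ha].
  destruct (classic (exists k, a k <> RtoC 0)) as [Hex|Hall].
  - right. destruct (dec_inh_nat_subset_has_unique_least_element _
      (fun n => classic (a n <> RtoC 0)) Hex) as [k [[Hk Hmin] _]].
    assert (Hak : 0 < Cmod (a k)) by now apply Cmod_gt_0.
    assert (Hpk : 0 < rho ^ S k) by now apply pow_lt.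
    exists (Rmin rho (Cmod (a k) * rho ^ S k / (M + 1))). split.
    { apply Rmin_glb_lt; [lra|]. apply Rdiv_lt_0_compat; [|lra].
      now apply Rmult_lt_0_compat. }
    intros s [Hs0 Hs] Hfs. set (t := (s - s0)%C) in *.
    assert (Ht1 : Cmod t < rho) by (eapply Rlt_le_trans; [exact Hs|apply Rmin_l]).
    assert (Ht2 : Cmod t < Cmod (a k) * rho ^ S k / (M + 1))
      by (eapply Rlt_le_trans; [exact Hs|apply Rmin_r]).
    specialize (Ha t ltac:(lra) (S k)). cbn [psum] in Ha.
    rewrite psum_0 in Ha.
    2:{ intros n Hn. destruct (Ceq_dec (a n) 0) as [->|Hne]; [ring|].
        specialize (Hmin n Hne). lia. }
    replace (s0 + t)%C with s in Ha by (unfold t; ring). rewrite Hfs in Ha.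
    replace (0 - (0 + a k * t ^ k))%C with (- (a k * t ^ k))%C in Ha by ring.
    rewrite Cmod_opp, Cmod_mult, Cmod_pow in Ha.
    unfold Rdiv in Ha. rewrite Rpow_mult_distr, <- tech_pow_Rmult in Ha.
    assert (Htk : 0 < Cmod t ^ k) by now apply pow_lt.
    assert (H1 : Cmod (a k) <= M * (Cmod t * (/ rho) ^ S k)).
    { apply (Rmult_le_reg_r (Cmod t ^ k)); [auto|].
      eapply Rle_trans; [exact Ha|]. right. ring. }
    rewrite pow_inv in H1.
    assert (H2 : Cmod (a k) * rho ^ S k <= (M + 1) * Cmod t).
    { apply Rle_trans with (M * (Cmod t * / rho ^ S k) * rho ^ S k).
      - apply Rmult_le_compat_r; lra.
      - replace (M * (Cmod t * / rho ^ S k) * rho ^ S k) with (M * Cmod t)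
          by (field; lra). lra. }
    assert (H3 : (M + 1) * Cmod t < Cmod (a k) * rho ^ S k); [|lra].
    apply (Rmult_lt_reg_r (/ (M + 1))); [apply Rinv_0_lt_compat; lra|].
    replace ((M + 1) * Cmod t * / (M + 1)) with (Cmod t) by (field; lra). exact Ht2.
  - left. exists rho. split; [auto|]. intros s [_ Hs]. apply Cmod_eq_0.
    apply Rle_antisym; [|apply Cmod_ge_0]. apply le_epsilon. intros eps Heps.
    destruct (geometric_small (Cmod (s - s0) / rho) M eps) as [N HN]; auto.
    { split; [apply ratio_bounds; lra|]. apply (Rmult_lt_reg_r rho); [lra|].
      unfold Rdiv. rewrite Rmult_assoc, Rinv_l; lra. }
    specialize (HN N (le_n _)). specialize (Ha (s - s0)%C ltac:(lra) N).
    rewrite psum_0 in Ha.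
    2:{ intros n _. destruct (Ceq_dec (a n) 0) as [->|Hne]; [ring|].
        destruct Hall. now exists n. }
    replace (s0 + (s - s0))%C with s in Ha by ring.
    replace (f s - 0)%C with (f s) in Ha by ring. lra.
Qed.

Definition locally_analytic (f : C -> C) (s0 : C) : Prop :=
  exists rho M, 0 < rho /\ taylor_bounded s0 rho f M.

Lemma locally_analytic_near f s0 eps :
  locally_analytic f s0 -> 0 < eps ->
  exists r, 0 < r /\ forall s, Cmod (s - s0) < r -> Cmod (f s - f s0)%C < eps.
Proof.
  intros [rho [M [Hr Hf]]] Heps.
  assert (HM := taylor_bounded_nonneg _ _ _ _ Hr Hf).
  exists (Rmin rho (eps * rho / (M + 1))). split.
  { apply Rmin_glb_lt; [lra|]. apply Rdiv_lt_0_compat; nra. }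
  intros s Hs.
  assert (Ht1 : Cmod (s - s0) < rho) by (eapply Rlt_le_trans; [exact Hs|apply Rmin_l]).
  assert (Ht2 : Cmod (s - s0) < eps * rho / (M + 1))
    by (eapply Rlt_le_trans; [exact Hs|apply Rmin_r]).
  assert (H := taylor_bounded_lipschitz s0 rho f M (s - s0)%C Hr Hf ltac:(lra)).
  replace (s0 + (s - s0))%C with s in H by ring.
  eapply Rle_lt_trans; [exact H|].
  apply Rle_lt_trans with ((M + 1) / rho * Cmod (s - s0)).
  - apply Rmult_le_compat_r; [apply Cmod_ge_0|].
    apply Rmult_le_compat_r; [|lra]. left. now apply Rinv_0_lt_compat.
  - apply Rlt_le_trans with ((M + 1) / rho * (eps * rho / (M + 1))).
    + apply Rmult_lt_compat_l; [apply Rdiv_lt_0_compat; lra|auto].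
    + right. field. lra.
Qed.

Lemma C_near_point (s0 : C) r : 0 < r -> Cmod (s0 + RtoC r - s0) = r.
Proof.
  intros Hr. replace (s0 + RtoC r - s0)%C with (RtoC r) by ring.
  rewrite Cmod_R. apply Rabs_pos_eq. lra.
Qed.

Lemma meromorphic_of_analytic f : (forall s0, locally_analytic f s0) -> meromorphic f.
Proof.
  intros Hf. split.
  - intros s0. exists 0%nat, f, 1. split; [lra|]. split.
    + destruct (Hf s0) as [rho [M [Hr H]]]. eapply analytic_at_of_taylor; eauto.
    + intros s _. unfold Cpow, Cdiv. rewrite <- (Cmult_1_r (f s)) at 1.
      f_equal. field.
  - intros s0 L HL.
    assert (H : Cmod (f s0 - L) <= 0).
    { apply le_epsilon. intros eps Heps.
      destruct (locally_analytic_near f s0 (eps / 2) (Hf s0)) as [r [Hr H1]]; [lra|].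
      assert (HL' : locally (T := C_UniformSpace) L (fun y => Cmod (y - L) < eps / 2)).
      { apply locally_C. exists (mkposreal (eps / 2) ltac:(lra)). intros y Hy. exact Hy. }
      assert (H2 := HL _ HL'). apply locally_C in H2. destruct H2 as [d H2].
      assert (Hd := cond_pos d). set (e := Rmin (r / 2) (d / 2)).
      assert (He : 0 < e) by (apply Rmin_glb_lt; lra).
      assert (He1 : e <= r / 2) by apply Rmin_l. assert (He2 : e <= d / 2) by apply Rmin_r.
      assert (Hp := C_near_point s0 e He). set (s := (s0 + RtoC e)%C) in *.
      assert (Hb1 := H1 s ltac:(lra)).
      assert (Hb2 : Cmod (f s - L) < eps / 2).
      { apply (H2 s).
        - change (Cmod (s - s0) < d). lra.
        - intros ->. replace (s0 - s0)%C with (RtoC 0) in Hp by ring.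
          rewrite Cmod_0 in Hp. lra. }
      replace (f s0 - L)%C with (- (f s - f s0) + (f s - L))%C by ring.
      eapply Rle_trans; [apply Cmod_triangle|]. rewrite Cmod_opp. lra. }
    assert (H0 : (f s0 - L)%C = RtoC 0).
    { apply Cmod_eq_0. assert (Hm := Cmod_ge_0 (f s0 - L)). lra. }
    replace (f s0) with (f s0 - L + L)%C by ring. rewrite H0. ring.
Qed.

(** Clearing the pole: near s0 but off it, F = E means that g - (s - s0)^k E vanishes, and this
    function is analytic at s0. *)
Lemma meromorphic_eq_or_neq F E s0 :
  meromorphic_at F s0 -> locally_analytic E s0 ->
  (exists r, 0 < r /\ forall s, 0 < Cmod (s - s0) < r -> F s = E s) \/
  (exists r, 0 < r /\ forall s, 0 < Cmod (s - s0) < r -> F s <> E s).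
Proof.
  intros [k [g [r0 [Hr0 [Hg HF]]]]] [r1 [M1 [Hr1 HE]]].
  destruct (taylor_of_analytic_at g s0 Hg) as [r2 [M2 [Hr2 Hg2]]].
  set (r := Rmin r1 r2).
  assert (Hr : 0 < r) by (apply Rmin_glb_lt; lra).
  apply (taylor_bounded_radius _ _ r) in HE; [|split; [auto|apply Rmin_l]].
  apply (taylor_bounded_radius _ _ r) in Hg2; [|split; [auto|apply Rmin_r]].
  assert (Hd := taylor_bounded_plus _ _ _ _ _ _ Hg2
    (taylor_bounded_scal _ _ (-(1))%C _ _ (taylor_bounded_pow _ _ (- s0)%C _ _ k Hr HE))).
  assert (Hiff : forall s, 0 < Cmod (s - s0) < r0 ->
     (F s = E s <-> (g s + - (1) * ((s + - s0) ^ k * E s))%C = RtoC 0)).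
  { intros s Hs. rewrite (HF s Hs).
    assert (Hnz : ((s - s0) ^ k)%C <> RtoC 0) by (apply Cpow_nz, Cmod_gt_0; tauto).
    change (s + - s0)%C with (s - s0)%C.
    split; intros H.
    - rewrite <- H. field. exact Hnz.
    - replace (g s) with (g s + - (1) * ((s - s0) ^ k * E s) + (s - s0) ^ k * E s)%C by ring.
      rewrite H. field. exact Hnz. }
  destruct (taylor_zeros_isolated _ _ _ _ Hr Hd) as [[r3 [Hr3 H]]|[r3 [Hr3 H]]];
    [left|right]; exists (Rmin r0 r3);
    (split; [apply Rmin_glb_lt; lra|]); intros s Hs;
    assert (Hm1 := Rmin_l r0 r3); assert (Hm2 := Rmin_r r0 r3).
  - apply Hiff; [lra|]. apply H. lra.
  - intros Heq. apply (H s); [lra|]. apply Hiff; [lra|auto].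
Qed.

Lemma Cmod_horizontal x x' y : Cmod ((x, y) - (x', y)) = Rabs (x - x').
Proof.
  replace ((x, y) - (x', y))%C with (RtoC (x - x')); [apply Cmod_R|].
  unfold RtoC, Cminus, Cplus, Copp. cbn. f_equal; ring.
Qed.

Lemma punctured_nbhd_nearby (Q : C -> Prop) x x' y r :
  (forall s, 0 < Cmod (s - (x, y)) < r -> Q s) -> 0 < Rabs (x' - x) < r ->
  exists r', 0 < r' /\ forall s, Cmod (s - (x', y)) < r' -> Q s.
Proof.
  intros HQ Hx.
  exists (Rmin (Rabs (x' - x)) (r - Rabs (x' - x))). split; [apply Rmin_glb_lt; lra|].
  intros s Hs. apply HQ.
  assert (H1 := Rmin_l (Rabs (x' - x)) (r - Rabs (x' - x))).
  assert (H2 := Rmin_r (Rabs (x' - x)) (r - Rabs (x' - x))).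
  assert (H3 := Cmod_horizontal x' x y). split.
  - replace ((x', y) - (x, y))%C with (- (s - (x', y)) + (s - (x, y)))%C in H3 by ring.
    assert (H4 := Cmod_triangle (- (s - (x', y))) (s - (x, y))).
    rewrite H3, Cmod_opp in H4. lra.
  - replace (s - (x, y))%C with ((s - (x', y)) + ((x', y) - (x, y)))%C by ring.
    eapply Rle_lt_trans; [apply Cmod_triangle|]. rewrite H3. lra.
Qed.

(* Agreement propagates leftwards along each horizontal line: at the supremum of
   the abscissae of the points near which F and E differ, isolation of zeros
   would be violated. *)
Lemma meromorphic_unique F E x0 :
  meromorphic F -> (forall s, locally_analytic E s) ->
  (forall s, Re s > x0 -> F s = E s) -> forall s, F s = E s.
Proof.
  intros [HF HF'] HE Heq.
  set (near := fun s0 => exists r, 0 < r /\ forall s, 0 < Cmod (s - s0) < r -> F s = E s).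
  assert (Hfar : forall x y, x > x0 -> near (x, y)).
  { intros x y Hx. exists (x - x0). split; [lra|]. intros s [_ Hs]. apply Heq.
    assert (H := re_le_Cmod (s - (x, y))). destruct s as [u v]. cbn in *.
    apply Rabs_le_between in H. lra. }
  assert (Hnear : forall s, near s).
  { intros [x1 y]. apply NNPP. intros Hn.
    destruct (completeness (fun x => ~ near (x, y))) as [X [HX1 HX2]].
    - exists x0. intros x Hx. apply Rnot_lt_le. intros Hlt. now apply Hx, Hfar.
    - now exists x1.
    - destruct (meromorphic_eq_or_neq F E (X, y) (HF _) (HE _)) as [[r [Hr H]]|[r [Hr H]]].
      + assert (X <= X - r); [|lra]. apply HX2. intros x Hx. apply Rnot_lt_le. intros Hlt.
        assert (HxX := HX1 x Hx). apply Hx.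
        destruct (Req_dec x X) as [->|Hne]; [now exists r|].
        destruct (punctured_nbhd_nearby _ X x y r H) as [r' [Hr' H']].
        { rewrite Rabs_left; lra. }
        exists r'. split; [auto|]. intros s Hs. now apply H'.
      + assert (Hnr : near (X + r / 2, y)).
        { apply NNPP. intros Hc. specialize (HX1 _ Hc). lra. }
        destruct Hnr as [r1 [Hr1 H1]].
        destruct (punctured_nbhd_nearby _ X (X + r / 2) y r H) as [r' [Hr' H']].
        { replace (X + r / 2 - X) with (r / 2) by ring. rewrite Rabs_pos_eq; lra. }
        set (e := Rmin (r1 / 2) (r' / 2)).
        assert (He : 0 < e) by (apply Rmin_glb_lt; lra).
        assert (He1 : e <= r1 / 2) by apply Rmin_l.
        assert (He2 : e <= r' / 2) by apply Rmin_r.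
        assert (Hp := C_near_point (X + r / 2, y) e He).
        apply (H' (Cplus (X + r / 2, y) (RtoC e))); [lra|]. apply H1. lra. }
  (* Agreement on a punctured disc also settles the centre: F tends to [E s1] there, and the clause
     on removable singularities forces [F s1] to be that limit. *)
  intros s1. apply HF'. intros Q HQ. apply locally_C in HQ. destruct HQ as [eps HQ].
  destruct (locally_analytic_near E s1 eps (HE s1) (cond_pos eps)) as [r [Hr H]].
  destruct (Hnear s1) as [r1 [Hr1 H1]].
  apply locally_C.
  assert (Hd : 0 < Rmin r r1) by (apply Rmin_glb_lt; lra).
  exists (mkposreal _ Hd).
  change (forall s : C, Cmod (s - s1) < Rmin r r1 -> s <> s1 -> Q (F s)).
  intros s Hs Hne.
  assert (Hm1 := Rmin_l r r1). assert (Hm2 := Rmin_r r r1).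
  assert (Hpos : 0 < Cmod (s - s1)).
  { apply Cmod_gt_0. intros H0. apply Hne.
    replace s with (s - s1 + s1)%C by ring. rewrite H0. ring. }
  rewrite H1 by lra. apply HQ. apply (H s). lra.
Qed.

(** * Power series of a real variable and the exponential *)

Lemma Cmod_small_eq (x y : C) : (forall eps, 0 < eps -> Cmod (x - y) <= eps) -> x = y.
Proof.
  intros H. assert (H0 : (x - y)%C = RtoC 0).
  { apply Cmod_eq_0, Rle_antisym; [|apply Cmod_ge_0].
    apply le_epsilon. intros eps Heps. specialize (H eps Heps). lra. }
  replace x with (x - y + y)%C by ring. rewrite H0. ring.
Qed.

Definition converges (u : nat -> C) (l : C) : Prop :=
  forall eps, 0 < eps -> exists N0, forall N, (N0 <= N)%nat -> Cmod (u N - l)%C < eps.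

Lemma converges_unique u l l' : converges u l -> converges u l' -> l = l'.
Proof.
  intros H H'. apply Cmod_small_eq. intros eps Heps.
  destruct (H (eps / 2)) as [N HN]; [lra|]. destruct (H' (eps / 2)) as [N' HN']; [lra|].
  specialize (HN (N + N')%nat ltac:(lia)). specialize (HN' (N + N')%nat ltac:(lia)).
  replace (l - l')%C with (- (u (N + N')%nat - l) + (u (N + N')%nat - l'))%C by ring.
  eapply Rle_trans; [apply Cmod_triangle|]. rewrite Cmod_opp. lra.
Qed.

Lemma converges_ext u v l : (forall n, u n = v n) -> converges u l -> converges v l.
Proof.
  intros H Hu eps Heps. destruct (Hu eps Heps) as [N HN]. exists N.
  intros n Hn. rewrite <- H. auto.
Qed.

Lemma converges_plus u v l m :
  converges u l -> converges v m -> converges (fun n => u n + v n)%C (l + m)%C.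
Proof.
  intros Hu Hv eps Heps.
  destruct (Hu (eps / 2)) as [N HN]; [lra|]. destruct (Hv (eps / 2)) as [N' HN']; [lra|].
  exists (N + N')%nat. intros n Hn.
  specialize (HN n ltac:(lia)). specialize (HN' n ltac:(lia)).
  replace (u n + v n - (l + m))%C with ((u n - l) + (v n - m))%C by ring.
  eapply Rle_lt_trans; [apply Cmod_triangle|]. lra.
Qed.

Lemma converges_scal c u l : converges u l -> converges (fun n => c * u n)%C (c * l)%C.
Proof.
  intros Hu eps Heps. assert (Hc := Cmod_ge_0 c).
  destruct (Hu (eps / (Cmod c + 1))) as [N HN]; [apply Rdiv_lt_0_compat; lra|].
  exists N. intros n Hn. specialize (HN n Hn).
  replace (c * u n - c * l)%C with (c * (u n - l))%C by ring. rewrite Cmod_mult.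
  apply Rle_lt_trans with (Cmod c * (eps / (Cmod c + 1))).
  - apply Rmult_le_compat_l; lra.
  - apply Rlt_le_trans with ((Cmod c + 1) * (eps / (Cmod c + 1))).
    + apply Rmult_lt_compat_r; [apply Rdiv_lt_0_compat; lra|lra].
    + right. field. lra.
Qed.

Lemma converges_shift u l : converges u l -> converges (fun n => u (S n)) l.
Proof.
  intros Hu eps Heps. destruct (Hu eps Heps) as [N HN]. exists N.
  intros n Hn. apply HN. lia.
Qed.

Definition is_Cderive (f : R -> C) (t : R) (l : C) : Prop :=
  is_derive (fun x => fst (f x)) t (fst l) /\ is_derive (fun x => snd (f x)) t (snd l).

Lemma is_Cderive_mult f g t l m :
  is_Cderive f t l -> is_Cderive g t m ->
  is_Cderive (fun x => f x * g x)%C t (l * g t + f t * m)%C.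
Proof.
  intros [Hf1 Hf2] [Hg1 Hg2]. destruct l as [l1 l2], m as [m1 m2]. split; cbn in *.
  - replace (l1 * fst (g t) - l2 * snd (g t) + (fst (f t) * m1 - snd (f t) * m2))
      with ((l1 * fst (g t) + fst (f t) * m1) - (l2 * snd (g t) + snd (f t) * m2)) by ring.
    apply (is_derive_minus (fun x => fst (f x) * fst (g x)) (fun x => snd (f x) * snd (g x)));
      apply (is_derive_mult (K := R_AbsRing)); auto; intros; apply Rmult_comm.
  - replace (l1 * snd (g t) + l2 * fst (g t) + (fst (f t) * m2 + snd (f t) * m1))
      with ((l1 * snd (g t) + fst (f t) * m2) + (l2 * fst (g t) + snd (f t) * m1)) by ring.
    apply (is_derive_plus (fun x => fst (f x) * snd (g x)) (fun x => snd (f x) * fst (g x)));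
      apply (is_derive_mult (K := R_AbsRing)); auto; intros; apply Rmult_comm.
Qed.

(** Real and imaginary parts of [Cexp (c * f)] written out, in the form to which [is_Cderive_Cexp]
    unfolds, so that the computation is one about real functions. *)
Lemma is_derive_exp_cos_sin (f1 f2 : R -> R) t l1 l2 c1 c2 :
  is_derive f1 t l1 -> is_derive f2 t l2 ->
  let E := exp (c1 * f1 t - c2 * f2 t) in
  let a := c1 * f2 t + c2 * f1 t in
  let p := c1 * l1 - c2 * l2 in
  let q := c1 * l2 + c2 * l1 in
  is_derive (fun x => exp (c1 * f1 x - c2 * f2 x) * cos (c1 * f2 x + c2 * f1 x)) t
    (p * (E * cos a) - q * (E * sin a)) /\
  is_derive (fun x => exp (c1 * f1 x - c2 * f2 x) * sin (c1 * f2 x + c2 * f1 x)) t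
    (p * (E * sin a) + q * (E * cos a)).
Proof.
  intros H1 H2 E a p q.
  assert (E1 : ex_derive f1 t) by (eexists; eassumption).
  assert (E2 : ex_derive f2 t) by (eexists; eassumption).
  apply is_derive_unique in H1. apply is_derive_unique in H2.
  split; auto_derive; auto;
    change (Derive (fun x => f1 x)) with (Derive f1);
    change (Derive (fun x => f2 x)) with (Derive f2);
    rewrite H1, H2; unfold E, a, p, q, Rminus; ring.
Qed.

Lemma is_Cderive_Cexp f t l c :
  is_Cderive f t l ->
  is_Cderive (fun x => Cexp (c * f x)%C) t (c * l * Cexp (c * f t))%C.
Proof.
  intros [Hf1 Hf2].
  apply (is_derive_exp_cos_sin _ _ _ _ _ (fst c) (snd c) Hf1 Hf2).
Qed.

Lemma is_Cderive_0_const (f : R -> C) :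
  (forall t, 0 <= t <= 1 -> is_Cderive f t (RtoC 0)) -> f 0 = f 1.
Proof.
  intros H. rewrite (surjective_pairing (f 0)), (surjective_pairing (f 1)). f_equal.
  - apply (eq_is_derive (fun x => fst (f x))); [|lra]. intros t Ht. apply (H t Ht).
  - apply (eq_is_derive (fun x => snd (f x))); [|lra]. intros t Ht. apply (H t Ht).
Qed.

Definition Cseries (b : nat -> C) (x : R) : C :=
  (PSeries (fun n => fst (b n)) x, PSeries (fun n => snd (b n)) x).

Section Cseries.
Variables (b : nat -> C) (A r : R).
Hypotheses (Hr : 0 < r < 1) (Hb : forall n, Cmod (b n) <= A * r ^ n).

(** The radius of convergence is at least 1/r > 1. Thus the end point t = 1, where the series are
    finally evaluated, is interior and needs no limit argument. *)
Lemma CV_radius_of_bound (p : nat -> R) x :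
  (forall n, Rabs (p n) <= A * r ^ n) -> Rabs x <= 1 -> Rbar_lt (Rabs x) (CV_radius p).
Proof.
  intros Hp Hx. apply Rbar_lt_le_trans with (/ r).
  - cbn. eapply Rle_lt_trans; [exact Hx|]. rewrite <- Rinv_1.
    apply Rinv_lt_contravar; lra.
  - apply (CV_radius_bounded p). exists A. intros n.
    rewrite Rabs_mult, <- RPow_abs, (Rabs_pos_eq (/ r)) by (left; apply Rinv_0_lt_compat; lra).
    rewrite pow_inv. apply (Rmult_le_reg_r (r ^ n)); [apply pow_lt; lra|].
    rewrite Rmult_assoc, Rinv_l, Rmult_1_r by (apply pow_nonzero; lra). apply Hp.
Qed.

Lemma fst_bound n : Rabs (fst (b n)) <= A * r ^ n.
Proof. eapply Rle_trans; [|apply Hb]. apply re_le_Cmod. Qed.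

Lemma snd_bound n : Rabs (snd (b n)) <= A * r ^ n.
Proof.
  eapply Rle_trans; [|apply Hb]. eapply Rle_trans; [|apply Rmax_Cmod]. apply Rmax_r.
Qed.

End Cseries.

Lemma PSeries_limit p x :
  Rbar_lt (Rabs x) (CV_radius p) ->
  forall eps, 0 < eps -> exists N0, forall N, (N0 <= N)%nat ->
    Rabs (sum_n (fun k => p k * x ^ k) N - PSeries p x) < eps.
Proof.
  intros H eps Heps. apply CV_radius_inside in H.
  apply PSeries_correct in H. apply is_pseries_R in H.
  change (is_lim_seq (sum_n (fun n => p n * x ^ n)) (Finite (PSeries p x))) in H.
  apply is_lim_seq_spec in H. destruct (H (mkposreal eps Heps)) as [N HN].
  exists N. exact HN.
Qed.

Lemma Cseries_limit b x :
  Rbar_lt (Rabs x) (CV_radius (fun n => fst (b n))) ->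
  Rbar_lt (Rabs x) (CV_radius (fun n => snd (b n))) ->
  converges (psum (fun j => b j * RtoC x ^ j)%C) (Cseries b x).
Proof.
  intros H1 H2 eps Heps.
  destruct (PSeries_limit _ _ H1 (eps / 2)) as [N1 HN1]; [lra|].
  destruct (PSeries_limit _ _ H2 (eps / 2)) as [N2 HN2]; [lra|].
  exists (S (N1 + N2)). intros [|N] HN; [lia|].
  specialize (HN1 N ltac:(lia)). specialize (HN2 N ltac:(lia)).
  assert (Hs : forall M, psum (fun j => b j * RtoC x ^ j)%C (S M)
     = (sum_n (fun k => fst (b k) * x ^ k) M, sum_n (fun k => snd (b k) * x ^ k) M)).
  { induction M as [|M IH].
    - rewrite 2!sum_O. destruct (b 0%nat) as [u v] eqn:E. cbn. rewrite E.
      unfold Cplus, Cmult, RtoC; cbn. f_equal; ring.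
    - rewrite 2!sum_Sn. change (psum (fun j => b j * RtoC x ^ j)%C (S (S M)))
        with (psum (fun j => b j * RtoC x ^ j) (S M) + b (S M) * RtoC x ^ S M)%C.
      rewrite IH, <- RtoC_pow. destruct (b (S M)) as [u v].
      apply injective_projections; cbn -[sum_n pow]; unfold plus; cbn -[sum_n pow]; ring. }
  rewrite Hs. unfold Cseries.
  set (p1 := sum_n _ N) in *. set (p2 := sum_n (fun k => snd (b k) * x ^ k) N) in *.
  set (q1 := PSeries _ x) in *. set (q2 := PSeries (fun n => snd (b n)) x) in *.
  replace ((p1, p2) - (q1, q2))%C with (RtoC (p1 - q1) + Ci * RtoC (p2 - q2))%C.
  - eapply Rle_lt_trans; [apply Cmod_triangle|].
    rewrite Cmod_mult, Cmod_Ci, 2!Cmod_R. lra.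
  - apply injective_projections; cbn; ring.
Qed.

Definition Cps_derive (b : nat -> C) (n : nat) : C := (RtoC (INR (S n)) * b (S n))%C.

Lemma Cps_derive_fst b n : fst (Cps_derive b n) = PS_derive (fun k => fst (b k)) n.
Proof. unfold Cps_derive, PS_derive. cbn [fst Cmult RtoC]. rewrite Rmult_0_l. apply Rminus_0_r. Qed.

Lemma Cps_derive_snd b n : snd (Cps_derive b n) = PS_derive (fun k => snd (b k)) n.
Proof. unfold Cps_derive, PS_derive. cbn [snd fst Cmult RtoC]. rewrite Rmult_0_l. apply Rplus_0_r. Qed.

Lemma is_Cderive_Cseries b A r x :
  0 < r < 1 -> (forall n, Cmod (b n) <= A * r ^ n) -> Rabs x <= 1 ->
  is_Cderive (Cseries b) x (Cseries (Cps_derive b) x) /\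
  converges (psum (fun j => b j * RtoC x ^ j)%C) (Cseries b x) /\
  converges (psum (fun j => Cps_derive b j * RtoC x ^ j)%C) (Cseries (Cps_derive b) x).
Proof.
  intros Hr Hb Hx.
  assert (H1 : Rbar_lt (Rabs x) (CV_radius (fun n => fst (b n))))
    by (eapply CV_radius_of_bound; eauto using fst_bound).
  assert (H2 : Rbar_lt (Rabs x) (CV_radius (fun n => snd (b n))))
    by (eapply CV_radius_of_bound; eauto using snd_bound).
  split; [|split].
  - split; cbn [fst snd Cseries].
    + rewrite (PSeries_ext _ _ x (Cps_derive_fst b)). now apply is_derive_PSeries.
    + rewrite (PSeries_ext _ _ x (Cps_derive_snd b)). now apply is_derive_PSeries.
  - now apply Cseries_limit.
  - apply Cseries_limit.
    + rewrite (CV_radius_ext _ _ (Cps_derive_fst b)), CV_radius_derive. exact H1.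
    + rewrite (CV_radius_ext _ _ (Cps_derive_snd b)), CV_radius_derive. exact H2.
Qed.

Lemma Cseries_at_0 b : Cseries b 0 = b 0%nat.
Proof. unfold Cseries. rewrite 2!PSeries_0. symmetry. apply surjective_pairing. Qed.

(* A power series S and a nonvanishing exponential V with S' = - k S and
   V' = k V have constant product. *)
Lemma Cseries_product_const b A r (V : R -> C) (k : R -> C) :
  0 < r < 1 -> (forall n, Cmod (b n) <= A * r ^ n) ->
  (forall t, 0 <= t <= 1 -> is_Cderive V t (k t * V t)%C) ->
  (forall t, 0 <= t <= 1 -> Cseries (Cps_derive b) t = (- k t * Cseries b t)%C) ->
  converges (psum b) (Cseries b 1) /\ (V 1 * Cseries b 1)%C = (V 0 * b 0%nat)%C.
Proof.
  intros Hr Hb HV HS. split.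
  - assert (H := proj1 (proj2 (is_Cderive_Cseries b A r 1 Hr Hb ltac:(rewrite Rabs_R1; lra)))).
    eapply converges_ext; [|exact H]. intros n. apply psum_ext. intros j _.
    rewrite Cpow_1_l. ring.
  - rewrite <- (Cseries_at_0 b). symmetry.
    apply (is_Cderive_0_const (fun t => V t * Cseries b t)%C). intros t Ht.
    replace (RtoC 0) with (k t * V t * Cseries b t + V t * (- k t * Cseries b t))%C by ring.
    apply is_Cderive_mult; [now apply HV|]. rewrite <- HS by auto.
    apply (is_Cderive_Cseries b A r t Hr Hb). apply Rabs_le. lra.
Qed.

(** * The complex exponential and its power series *)

Lemma Cexp_plus a b : Cexp (a + b) = (Cexp a * Cexp b)%C.
Proof.
  destruct a as [a1 a2], b as [b1 b2]. unfold Cexp, Cmult; cbn.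
  rewrite exp_plus, cos_plus, sin_plus. f_equal; ring.
Qed.

Lemma Cexp_0 : Cexp 0 = RtoC 1.
Proof. unfold Cexp, RtoC; cbn. rewrite exp_0, cos_0, sin_0. f_equal; ring. Qed.

Lemma Cmod_Cexp a : Cmod (Cexp a) = exp (Re a).
Proof.
  unfold Cmod, Cexp. cbn [fst snd].
  replace ((exp (Re a) * cos (Im a)) ^ 2 + (exp (Re a) * sin (Im a)) ^ 2)
    with (exp (Re a) ^ 2).
  - apply sqrt_pow2. left. apply exp_pos.
  - assert (H := sin2_cos2 (Im a)). unfold Rsqr in H.
    replace ((exp (Re a) * cos (Im a)) ^ 2 + (exp (Re a) * sin (Im a)) ^ 2)
      with (exp (Re a) ^ 2 * (sin (Im a) * sin (Im a) + cos (Im a) * cos (Im a))) by ring.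
    rewrite H. ring.
Qed.

Lemma Cexp_neq_0 a : Cexp a <> RtoC 0.
Proof. apply Cmod_gt_0. rewrite Cmod_Cexp. apply exp_pos. Qed.

Lemma Cexp_opp a : (Cexp (- a) * Cexp a)%C = RtoC 1.
Proof. rewrite <- Cexp_plus, <- Cexp_0. f_equal. ring. Qed.

Lemma Rexp_partial_sum_le x N : 0 <= x -> Rsum (fun k => x ^ k / INR (fact k)) (seq 0 N) <= exp x.
Proof.
  intros Hx.
  assert (H : is_series (fun k => / INR (fact k) * x ^ k) (exp x)).
  { apply is_pseries_R. apply is_exp_Reals. }
  assert (Hp : forall k, 0 <= / INR (fact k) * x ^ k).
  { intros k. apply Rmult_le_pos; [left; apply Rinv_0_lt_compat, INR_fact_lt_0|now apply pow_le]. }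
  destruct N as [|N]; [left; apply exp_pos|].
  replace (Rsum _ _) with (sum_n (fun k => / INR (fact k) * x ^ k) N).
  - apply (is_lim_seq_incr_compare _ _ H).
    intros n. rewrite sum_Sn. specialize (Hp (S n)). unfold plus; cbn -[fact pow] in *. lra.
  - induction N as [|N IH].
    + rewrite sum_O. cbn. field.
    + rewrite sum_Sn, IH, (seq_S (S N)), Rsum_app, Rsum_cons.
      unfold plus; cbn -[fact pow Rsum seq]. unfold Rdiv. cbn [Rsum fold_right]. ring.
Qed.

Lemma exp_term_le x k : 0 <= x -> x ^ k / INR (fact k) <= exp x.
Proof.
  intros Hx. eapply Rle_trans; [|apply (Rexp_partial_sum_le x (S k) Hx)].
  rewrite seq_S, Rsum_app, Rsum_cons. cbn [Nat.add].
  assert (0 <= Rsum (fun k => x ^ k / INR (fact k)) (seq 0 k)).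
  { apply (Rsum_incl (fun _ => True) (fun k => x ^ k / INR (fact k)) nil).
    - intros i _. apply Rdiv_le_0_compat; [now apply pow_le|apply INR_fact_lt_0].
    - apply NoDup_nil.
    - apply Forall_True.
    - intros i []. }
  cbn [Rsum fold_right] in *. unfold Rsum in *. cbn. lra.
Qed.

Definition Cexp_coef (w : C) (k : nat) : C := (w ^ k / RtoC (INR (fact k)))%C.

Lemma RtoC_INR_fact_neq_0 k : RtoC (INR (fact k)) <> RtoC 0.
Proof. intros H. apply RtoC_inj in H. now apply INR_fact_neq_0 in H. Qed.

Lemma Cmod_Cexp_coef w k : Cmod (Cexp_coef w k) = Cmod w ^ k / INR (fact k).
Proof.
  unfold Cexp_coef. rewrite Cmod_div by apply RtoC_INR_fact_neq_0.
  rewrite Cmod_pow, Cmod_R, Rabs_pos_eq by apply pos_INR. reflexivity.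
Qed.

Lemma Cexp_coef_S w k : (RtoC (INR (S k)) * Cexp_coef w (S k))%C = (w * Cexp_coef w k)%C.
Proof.
  unfold Cexp_coef. rewrite fact_simpl, mult_INR, RtoC_mult. cbn [Cpow].
  field. split; [apply RtoC_INR_fact_neq_0|].
  intros H. apply RtoC_inj in H. revert H. apply not_0_INR. lia.
Qed.

(** [Cexp] is built from cosine and sine, so its series has to be derived: the sum of the series in
    w t satisfies S' = w S, hence its product with exp(-w t) stays 1. The geometric bound with ratio
    1/2 is (2|w|)^n / n! <= exp(2|w|). *)
Lemma converges_Cexp w : converges (psum (Cexp_coef w)) (Cexp w).
Proof.
  assert (Hb : forall n, Cmod (Cexp_coef w n) <= exp (2 * Cmod w) * (/ 2) ^ n).
  { intros n. rewrite Cmod_Cexp_coef.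
    assert (H := exp_term_le (2 * Cmod w) n ltac:(assert (Hm := Cmod_ge_0 w); lra)).
    rewrite Rpow_mult_distr in H. rewrite pow_inv.
    assert (H2 : 0 < 2 ^ n) by (apply pow_lt; lra).
    apply (Rmult_le_reg_l (2 ^ n)); [auto|].
    replace (2 ^ n * (exp (2 * Cmod w) * / 2 ^ n)) with (exp (2 * Cmod w)) by (field; lra).
    eapply Rle_trans; [|exact H]. right. unfold Rdiv. ring. }
  destruct (Cseries_product_const (Cexp_coef w) (exp (2 * Cmod w)) (/ 2)
     (fun t => Cexp (- w * RtoC t)) (fun _ => - w)%C) as [H1 H2]; [lra|auto| | |].
  - intros t _.
    replace (- w * Cexp (- w * t))%C with (- w * RtoC 1 * Cexp (- w * t))%C by ring.
    apply (is_Cderive_Cexp (fun t => RtoC t)). split; cbn.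
    + apply @is_derive_id.
    + apply @is_derive_const.
  - intros t Ht.
    destruct (is_Cderive_Cseries (Cexp_coef w) (exp (2 * Cmod w)) (/ 2) t) as [_ [H1 H2]];
      [lra|auto|apply Rabs_le; lra|].
    eapply converges_unique; [exact H2|].
    replace (- - w)%C with w by ring.
    eapply converges_ext; [|apply converges_scal, H1].
    intros n. cbn beta. rewrite <- psum_scal. apply psum_ext. intros j _.
    unfold Cps_derive. rewrite Cexp_coef_S. ring.
  - replace (Cexp w) with (Cseries (Cexp_coef w) 1); [exact H1|].
    replace (- w * 1)%C with (- w)%C in H2 by ring.
    replace (- w * 0)%C with (RtoC 0) in H2 by ring. rewrite Cexp_0 in H2.
    replace (1 * Cexp_coef w 0)%C with (RtoC 1) in H2 by (unfold Cexp_coef; cbn; field).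
    replace (Cseries (Cexp_coef w) 1)
      with ((Cexp (- w) * Cexp w) * Cseries (Cexp_coef w) 1)%C by (rewrite Cexp_opp; ring).
    replace (Cexp (- w) * Cexp w * Cseries (Cexp_coef w) 1)%C
      with (Cexp w * (Cexp (- w) * Cseries (Cexp_coef w) 1))%C by ring.
    rewrite H2. ring.
Qed.

Lemma bounded_sums_exp x : 0 <= x ->
  bounded_sums (fun _ => True) (fun k => x ^ k / INR (fact k)) (exp x).
Proof.
  intros Hx. apply bounded_sums_nat.
  - intros n. apply Rdiv_le_0_compat; [now apply pow_le|apply INR_fact_lt_0].
  - intros N. now apply Rexp_partial_sum_le.
Qed.

Lemma converges_of_has_sum a S : has_sum (fun _ => True) a S -> converges (psum a) S.
Proof.
  intros HS eps Heps. destruct (HS eps Heps) as [l0 [H1 [H2 H3]]].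
  exists (Datatypes.S (list_max l0)). intros N HN. rewrite psum_Csum.
  apply H3; auto using seq_NoDup, Forall_True.
  intros x Hx. apply in_seq.
  assert (H := proj1 (list_max_le l0 (list_max l0)) (le_n _)).
  rewrite Forall_forall in H. specialize (H x Hx). lia.
Qed.

(** Unordered summability comes from the majorant; the ordered limit serves to identify the
    value. *)
Lemma has_sum_of_converges a b B S :
  (forall n, Cmod (a n) <= b n) -> bounded_sums (fun _ => True) b B ->
  converges (psum a) S -> has_sum (fun _ => True) a S.
Proof.
  intros Hab HB HS.
  destruct (has_sum_exists (fun _ => True) a b B) as [T HT]; auto.
  replace S with T; [exact HT|].
  exact (converges_unique _ _ _ (converges_of_has_sum _ _ HT) HS).
Qed.

Lemma has_sum_Cexp w : has_sum (fun _ => True) (Cexp_coef w) (Cexp w).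
Proof.
  eapply has_sum_of_converges.
  - intros n. rewrite Cmod_Cexp_coef. apply Rle_refl.
  - apply bounded_sums_exp, Cmod_ge_0.
  - apply converges_Cexp.
Qed.

(** * The logarithm on a half-plane and the binomial series *)

Definition Clog (w : C) : C := (ln (Cmod w), Carg w).

Lemma Cmod_sqr w : Cmod w ^ 2 = fst w ^ 2 + snd w ^ 2.
Proof. unfold Cmod. apply pow2_sqrt. nra. Qed.

Lemma Carg_polar w : w <> RtoC 0 ->
  fst w = Cmod w * cos (Carg w) /\ snd w = Cmod w * sin (Carg w).
Proof.
  intros Hw. apply Cmod_gt_0 in Hw. assert (Hs := Cmod_sqr w).
  assert (Hx : -1 <= fst w / Cmod w <= 1).
  { assert (H := re_le_Cmod w). apply Rabs_le_between in H. unfold Re in H. split.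
    - apply (Rmult_le_reg_r (Cmod w)); [auto|]. unfold Rdiv. rewrite Rmult_assoc, Rinv_l; lra.
    - apply (Rmult_le_reg_r (Cmod w)); [auto|]. unfold Rdiv. rewrite Rmult_assoc, Rinv_l; lra. }
  assert (Hsin : Cmod w * sin (acos (fst w / Cmod w)) = Rabs (snd w)).
  { rewrite sin_acos by auto.
    rewrite <- (sqrt_pow2 (Cmod w)) at 1 by lra.
    rewrite <- sqrt_mult by (unfold Rsqr; nra).
    replace (Cmod w ^ 2 * (1 - (fst w / Cmod w)²)) with (Rsqr (snd w)).
    - apply sqrt_Rsqr_abs.
    - unfold Rsqr. replace (snd w * snd w) with (Cmod w ^ 2 - fst w ^ 2) by nra. field. lra. }
  unfold Carg, Re, Im. destruct (Rle_dec 0 (snd w)) as [H|H].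
  - rewrite cos_acos by auto. rewrite Hsin, Rabs_pos_eq by auto. split; [field; lra|auto].
  - rewrite cos_neg, sin_neg, cos_acos by auto.
    rewrite Ropp_mult_distr_r_reverse, Hsin, Rabs_left by lra. split; [field; lra|lra].
Qed.

Lemma Carg_range w : w <> RtoC 0 -> - PI < Carg w <= PI.
Proof.
  intros Hw. assert (Hp := Carg_polar w Hw). apply Cmod_gt_0 in Hw.
  assert (Hb := acos_bound (Re w / Cmod w)). assert (HP := PI_RGT_0).
  unfold Carg in *. destruct (Rle_dec 0 (Im w)) as [H|H]; [lra|]. split; [|lra].
  destruct (Req_dec (acos (Re w / Cmod w)) PI) as [E|E]; [|lra].
  rewrite E, sin_neg, sin_PI in Hp. unfold Im in H. lra.
Qed.

Lemma Carg_unique w th : w <> RtoC 0 -> - PI < th <= PI ->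
  fst w = Cmod w * cos th -> snd w = Cmod w * sin th -> Carg w = th.
Proof.
  intros Hw Hth Hx Hy. apply Cmod_gt_0 in Hw. unfold Carg, Re, Im.
  replace (fst w / Cmod w) with (cos th) by (rewrite Hx; field; lra).
  destruct (Rle_dec 0 (snd w)) as [H|H].
  - apply acos_cos. destruct (Rle_lt_dec 0 th) as [H0|H0]; [lra|].
    assert (sin th < 0) by (apply sin_lt_0_var; lra). nra.
  - rewrite <- (cos_neg th). rewrite acos_cos; [ring|].
    destruct (Rlt_le_dec 0 th) as [H0|H0]; [|lra].
    assert (0 <= sin th) by (apply sin_ge_0; lra). nra.
Qed.

Lemma Cexp_Clog w : w <> RtoC 0 -> Cexp (Clog w) = w.
Proof.
  intros Hw. destruct (Carg_polar w Hw) as [Hx Hy]. apply Cmod_gt_0 in Hw.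
  unfold Cexp, Clog; cbn [Re Im fst snd]. rewrite exp_ln by auto.
  rewrite <- Hx, <- Hy. symmetry. apply surjective_pairing.
Qed.

Lemma Cpow_neg_Clog w s : Cpow_neg w s = Cexp (- (s * Clog w)).
Proof. reflexivity. Qed.

(* The continuous logarithm on the closed lower half-plane minus 0, with
   arguments in [-PI, 0]. *)
Definition lower_arg (x y : R) : R :=
  if Rlt_dec y 0 then - (PI / 2) + atan (x / - y)
  else if Rlt_dec 0 x then 0 else - PI.

Lemma lower_arg_range x y : - PI <= lower_arg x y <= 0.
Proof.
  assert (HP := PI_RGT_0). unfold lower_arg.
  destruct (Rlt_dec y 0); [|destruct (Rlt_dec 0 x); lra].
  assert (H := atan_bound (x / - y)). lra.
Qed.

Lemma lower_arg_polar u : u <> RtoC 0 -> snd u <= 0 ->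
  fst u = Cmod u * cos (lower_arg (fst u) (snd u)) /\
  snd u = Cmod u * sin (lower_arg (fst u) (snd u)).
Proof.
  destruct u as [x y]. cbn [fst snd]. intros Hu Hy. unfold lower_arg.
  destruct (Rlt_dec y 0) as [H|H].
  - replace (cos (- (PI / 2) + atan (x / - y))) with (sin (atan (x / - y))).
    2:{ rewrite cos_plus, cos_neg, sin_neg, cos_PI2, sin_PI2. ring. }
    replace (sin (- (PI / 2) + atan (x / - y))) with (- cos (atan (x / - y))).
    2:{ rewrite sin_plus, cos_neg, sin_neg, cos_PI2, sin_PI2. ring. }
    rewrite sin_atan, cos_atan.
    assert (Hm : Cmod (x, y) = - y * sqrt (1 + (x / - y)²)).
    { unfold Cmod; cbn [fst snd]. rewrite <- (sqrt_pow2 (- y)) at 1 by lra.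
      rewrite <- sqrt_mult by (unfold Rsqr; nra). f_equal. unfold Rsqr. field. lra. }
    rewrite Hm. assert (Hs : 0 < sqrt (1 + (x / - y)²)).
    { apply sqrt_lt_R0. assert (H' := Rle_0_sqr (x / - y)). lra. }
    split; field; lra.
  - assert (y = 0) by lra. subst y.
    assert (Hm : Cmod (x, 0) = Rabs x) by apply (Cmod_R x). rewrite Hm.
    destruct (Rlt_dec 0 x) as [Hx|Hx].
    + rewrite cos_0, sin_0, Rabs_pos_eq; lra.
    + rewrite cos_neg, sin_neg, cos_PI, sin_PI, Rabs_left1; lra.
Qed.

Section HalfPlane.
Variable h : C.
Hypotheses (Hh : h <> RtoC 0) (Hah : 0 < Carg h <= PI).

(** The points with argument in [arg h - pi, arg h]. Both rays of the boundary line are included,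
    because z itself may lie on that line. Translation by h does not change the imaginary part of w
    / h. *)
Definition in_half (w : C) : Prop := w <> RtoC 0 /\ snd (w / h)%C <= 0.

Lemma div_polar w : w <> RtoC 0 ->
  snd (w / h)%C = Cmod w / Cmod h * sin (Carg w - Carg h).
Proof.
  intros Hw. destruct (Carg_polar w Hw) as [Hx Hy]. destruct (Carg_polar h Hh) as [Hu Hv].
  assert (Hm := proj1 (Cmod_gt_0 h) Hh). assert (Hs := Cmod_sqr h).
  rewrite sin_minus. unfold Cdiv, Cmult, Cinv; cbn [fst snd].
  rewrite <- Hs.
  set (A := Cmod w) in *. set (B := Cmod h) in *.
  rewrite Hx, Hy, Hu, Hv. field. lra.
Qed.

Lemma div_pos w : w <> RtoC 0 -> 0 < Cmod w / Cmod h.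
Proof. intros Hw. apply Rdiv_lt_0_compat; now apply Cmod_gt_0. Qed.

Lemma in_half_of_Carg w : w <> RtoC 0 ->
  Carg h - PI <= Carg w <= Carg h -> in_half w.
Proof.
  intros Hw Ha. split; [auto|]. rewrite div_polar by auto.
  assert (H := div_pos w Hw).
  assert (0 <= sin (Carg h - Carg w)) by (apply sin_ge_0; lra).
  replace (Carg w - Carg h) with (- (Carg h - Carg w)) by ring.
  rewrite sin_neg. nra.
Qed.

Lemma div_neg_of_Carg w : w <> RtoC 0 ->
  Carg h - PI < Carg w < Carg h -> snd (w / h)%C < 0.
Proof.
  intros Hw Ha. rewrite div_polar by auto. assert (H := div_pos w Hw).
  assert (0 < sin (Carg h - Carg w)) by (apply sin_gt_0; lra).
  replace (Carg w - Carg h) with (- (Carg h - Carg w)) by ring.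
  rewrite sin_neg. nra.
Qed.

(** No multiple of 2 pi intervenes: an angle in [-pi, 0] added to [Carg h] in (0, pi] stays in (-pi,
    pi]. This is where the range of [Carg h] matters. *)
Lemma Clog_mult u : u <> RtoC 0 -> snd u <= 0 ->
  Clog (h * u)%C = (Clog h + (ln (Cmod u), lower_arg (fst u) (snd u)))%C.
Proof.
  intros Hu Hy. destruct (lower_arg_polar u Hu Hy) as [Hx1 Hy1].
  destruct (Carg_polar h Hh) as [Hx2 Hy2].
  assert (Hr := lower_arg_range (fst u) (snd u)).
  assert (Hmu := proj1 (Cmod_gt_0 u) Hu). assert (Hmh := proj1 (Cmod_gt_0 h) Hh).
  unfold Clog, Cplus; cbn [fst snd]. rewrite Cmod_mult. f_equal.
  - now apply ln_mult.
  - set (th := lower_arg (fst u) (snd u)) in *.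
    apply Carg_unique; [now apply Cmult_neq_0| |rewrite Cmod_mult|rewrite Cmod_mult].
    + lra.
    + rewrite cos_plus. cbn [fst snd Cmult].
      set (A := Cmod u) in *. set (B := Cmod h) in *. set (ph := Carg h) in *.
      rewrite Hx1, Hy1, Hx2, Hy2. ring.
    + rewrite sin_plus. cbn [fst snd Cmult].
      set (A := Cmod u) in *. set (B := Cmod h) in *. set (ph := Carg h) in *.
      rewrite Hx1, Hy1, Hx2, Hy2. ring.
Qed.

(** The derivative of the angle of x + t + iy is the imaginary part of 1 / (x + t + iy). On the real
    axis the angle is locally constant on either side of 0, and the first hypothesis keeps the path
    off 0. *)
Lemma is_derive_lower_arg x y t :
  y < 0 \/ 0 < x + t \/ x + t < 0 -> y <= 0 ->
  is_derive (fun t => lower_arg (x + t) y) t (- y / ((x + t) ^ 2 + y ^ 2)).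
Proof.
  intros H Hy. destruct (Rlt_dec y 0) as [Hy'|Hy'].
  - apply is_derive_ext with (fun t => - (PI / 2) + atan ((x + t) / - y)).
    { intros s. unfold lower_arg. destruct (Rlt_dec y 0); [reflexivity|lra]. }
    auto_derive; [auto|]. field. assert (0 < y ^ 2) by nra. assert (Hq := pow2_ge_0 (x + t)). split; lra.
  - assert (y = 0) by lra. subst y.
    replace (- 0 / ((x + t) ^ 2 + 0 ^ 2)) with 0 by (field; nra).
    destruct H as [H|[H|H]]; [lra| |].
    + apply is_derive_ext_loc with (fun _ => 0); [|apply @is_derive_const].
      exists (mkposreal (x + t) H). intros s Hs.
      change (Rabs (s - t) < x + t) in Hs. apply Rabs_lt_between in Hs.
      unfold lower_arg. destruct (Rlt_dec 0 0); [lra|]. destruct (Rlt_dec 0 (x + s)); lra.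
    + assert (H' : 0 < - (x + t)) by lra.
      apply is_derive_ext_loc with (fun _ => - PI); [|apply @is_derive_const].
      exists (mkposreal _ H'). intros s Hs.
      change (Rabs (s - t) < - (x + t)) in Hs. apply Rabs_lt_between in Hs.
      unfold lower_arg. destruct (Rlt_dec 0 0); [lra|]. destruct (Rlt_dec 0 (x + s)); lra.
Qed.

(** The differentiated function is the logarithm of h (u + t) with a continuous angle; for u = w / h
    and t from 0 to 1 this follows the segment from w to w + h. *)
Lemma is_Cderive_Clog_path u t :
  snd u <= 0 -> (snd u < 0 \/ 0 < fst u + t \/ fst u + t < 0) ->
  is_Cderive (fun t => (Clog h + (ln (Cmod (u + RtoC t)),
      lower_arg (fst u + t) (snd u)))%C) t (/ (u + RtoC t))%C.
Proof.
  destruct u as [x y]. cbn [fst snd]. intros Hy Hnz.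
  assert (Hpos : 0 < (x + t) ^ 2 + y ^ 2).
  { assert (H1 := pow2_ge_0 (x + t)). assert (H2 := pow2_ge_0 y).
    destruct Hnz as [H|[H|H]]; [assert (0 < y ^ 2) by nra|assert (0 < (x + t) ^ 2) by nra
      |assert (0 < (x + t) ^ 2) by nra]; lra. }
  split; unfold Cplus, Clog, Cinv, RtoC; cbn [fst snd].
  - change (is_derive (fun t => ln (Cmod h) + ln (sqrt ((x + t) ^ 2 + (y + 0) ^ 2))) t
      ((x + t) / ((x + t) ^ 2 + (y + 0) ^ 2))).
    rewrite Rplus_0_r.
    assert (HS := sqrt_lt_R0 _ Hpos). assert (HS2 := sqrt_sqrt _ (Rlt_le _ _ Hpos)).
    auto_derive; change ((x + t) * ((x + t) * 1) + y * (y * 1)) with ((x + t) ^ 2 + y ^ 2).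
    + auto.
    + transitivity ((x + t) / (sqrt ((x + t) ^ 2 + y ^ 2) * sqrt ((x + t) ^ 2 + y ^ 2))).
      * field. lra.
      * now rewrite HS2.
  - replace (- (y + 0) / ((x + t) ^ 2 + (y + 0) ^ 2))
      with (0 + - y / ((x + t) ^ 2 + y ^ 2)) by (rewrite Rplus_0_r; ring).
    apply @is_derive_plus; [apply @is_derive_const|].
    now apply is_derive_lower_arg.
Qed.

(* binom(-s, l) *)
Fixpoint binom_neg (l : nat) (s : C) : C :=
  match l with
  | O => RtoC 1
  | S k => (binom_neg k s * ((s + RtoC (INR k)) * RtoC (- / INR (S k))))%C
  end.

Lemma binom_neg_S l s :
  (RtoC (INR (S l)) * binom_neg (S l) s)%C = (- (s + RtoC (INR l)) * binom_neg l s)%C.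
Proof.
  assert (Hn : RtoC (INR (S l)) <> RtoC 0).
  { intros H. apply RtoC_inj in H. revert H. apply not_0_INR. lia. }
  cbn [binom_neg]. rewrite RtoC_opp, RtoC_inv. 2:{ apply not_0_INR. lia. }
  field. exact Hn.
Qed.

(** Each factor |s + k| / (k + 1) is at most (M + k) / (k + 1), hence at most M since 1 <= M. *)
Lemma Cmod_binom_neg_le l s M : 1 <= M -> Cmod s <= M -> Cmod (binom_neg l s) <= M ^ l.
Proof.
  intros HM Hs. induction l as [|l IH]; cbn [binom_neg pow].
  - rewrite Cmod_1. lra.
  - rewrite 2!Cmod_mult, Rmult_comm, Cmod_R, Rabs_Ropp, Rabs_inv.
    apply Rmult_le_compat; auto using Cmod_ge_0.
    { apply Rmult_le_pos; [apply Cmod_ge_0|]. left.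
      apply Rinv_0_lt_compat, Rabs_pos_lt, not_0_INR. lia. }
    assert (Hp := lt_0_INR (S l) ltac:(lia)). assert (Hl := pos_INR l).
    rewrite (Rabs_pos_eq (INR (S l))) by lra.
    apply (Rmult_le_reg_r (INR (S l))); [auto|].
    rewrite Rmult_assoc, Rinv_l, Rmult_1_r by lra.
    eapply Rle_trans; [apply Cmod_triangle|]. rewrite Cmod_R, Rabs_pos_eq by auto.
    rewrite S_INR. nra.
Qed.

(* [V t = (w + t h)^s] and [S t = sum binom(-s,l) (t h / w)^l]; the
   differential equation for S is read off the recurrence of the coefficients. *)
Lemma binomial_series w s M :
  in_half w -> 1 <= M -> Cmod s <= M -> 2 * M * Cmod h <= Cmod w ->
  converges (psum (fun l => binom_neg l s * (h / w) ^ l)%C)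
    (Cpow_neg (w + h) s * Cexp (s * Clog w))%C.
Proof.
  intros [Hw Hhalf] HM Hs HwM.
  set (u := (w / h)%C) in *. set (y := (h / w)%C).
  assert (Hmh := proj1 (Cmod_gt_0 h) Hh). assert (Hmw := proj1 (Cmod_gt_0 w) Hw).
  assert (Hu : u <> RtoC 0).
  { intros E. apply Hw. replace w with (u * h)%C by (unfold u; field; auto).
    rewrite E. ring. }
  assert (Hmu : 2 <= Cmod u).
  { unfold u. rewrite Cmod_div by auto. apply (Rmult_le_reg_r (Cmod h)); [auto|].
    unfold Rdiv. rewrite Rmult_assoc, Rinv_l by lra. nra. }
  assert (Hwu : w = (h * u)%C) by (unfold u; field; auto).
  assert (Hyu : y = (/ u)%C) by (unfold y, u; field; auto).
  (* The segment from u to u + 1 avoids 0: a real u has |u| >= 2, so it cannot cross 0 in a step of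
     length 1. *)
  assert (Hside : forall t, 0 <= t <= 1 ->
            snd u < 0 \/ 0 < fst u + t \/ fst u + t < 0).
  { intros t Ht. destruct (Rlt_dec (snd u) 0) as [H|H]; [now left|right].
    assert (Hsq := Cmod_sqr u). assert (snd u = 0) by lra.
    destruct (Rlt_dec 0 (fst u + t)) as [H'|H']; [now left|right].
    assert (H4 : 4 <= fst u ^ 2) by (rewrite H0 in Hsq; nra).
    assert (H5 : fst u <= 0) by lra.
    assert (H6 : fst u <= -2); [|lra].
    apply Rnot_lt_le. intros H6. clear - H4 H5 H6. nra. }
  assert (Hnz : forall t, 0 <= t <= 1 -> (u + RtoC t)%C <> RtoC 0).
  { intros t Ht E. assert (E1 := f_equal fst E). assert (E2 := f_equal snd E).
    cbn [fst snd Cplus RtoC] in E1, E2.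
    destruct (Hside t Ht) as [H|[H|H]]; lra. }
  set (b := fun l => (binom_neg l s * y ^ l)%C).
  assert (Hb : forall n, Cmod (b n) <= 1 * (/ 2) ^ n).
  { intros n. unfold b. rewrite Cmod_mult, Cmod_pow, Rmult_1_l.
    apply Rle_trans with (M ^ n * Cmod y ^ n).
    - apply Rmult_le_compat_r; [apply pow_le, Cmod_ge_0|]. now apply Cmod_binom_neg_le.
    - rewrite <- Rpow_mult_distr. apply pow_incr. split.
      + apply Rmult_le_pos; [lra|apply Cmod_ge_0].
      + unfold y. rewrite Cmod_div by auto. apply (Rmult_le_reg_r (Cmod w)); [auto|].
        unfold Rdiv. rewrite 2!Rmult_assoc, Rinv_l by lra. lra. }
  assert (Hbrec : forall n, Cps_derive b n = (- (s + RtoC (INR n)) * y * b n)%C).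
  { intros n. unfold Cps_derive, b. cbn [Cpow].
    replace (INR (S n) * (binom_neg (S n) s * (y * y ^ n)))%C
      with (INR (S n) * binom_neg (S n) s * (y * y ^ n))%C by ring.
    rewrite binom_neg_S. ring. }
  (* The angle is the continuous one, so that V can be differentiated; [HV] identifies it with the
     principal branch along the segment. *)
  set (V := fun t => Cexp (s * (Clog h + (ln (Cmod (u + RtoC t)),
      lower_arg (fst u + t) (snd u))))%C).
  assert (HV : forall t, 0 <= t <= 1 -> V t = Cexp (s * Clog (w + RtoC t * h))%C).
  { intros t Ht. unfold V. do 2 f_equal. rewrite Hwu.
    replace (h * u + t * h)%C with (h * (u + RtoC t))%C by ring.
    rewrite Clog_mult; auto; cbn [fst snd Cplus RtoC]; rewrite Rplus_0_r; auto. }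
  destruct (Cseries_product_const b 1 (/ 2) V (fun t => s * / (u + RtoC t))%C)
    as [H1 H2]; [lra|auto| | |].
  - intros t Ht. apply (is_Cderive_Cexp (fun t => (Clog h + (ln (Cmod (u + RtoC t)),
      lower_arg (fst u + t) (snd u)))%C)).
    apply is_Cderive_Clog_path; auto.
  - intros t Ht.
    destruct (is_Cderive_Cseries b 1 (/ 2) t) as [_ [Hc1 Hc2]];
      [lra|auto|apply Rabs_le; lra|].
    set (S1 := Cseries b t) in *. set (S2 := Cseries (Cps_derive b) t) in *.
    set (P := psum (fun j => b j * RtoC t ^ j)%C) in *.
    set (Q := psum (fun j => Cps_derive b j * RtoC t ^ j)%C) in *.
    (* The equation (1 + t y) S' + s y S = 0 for partial sums. Taking n + 1, n and n + 1 terms in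
       the three sums makes every power of t cancel exactly, with no error term. *)
    assert (Hfin : forall n, (Q (S n) + RtoC t * y * Q n + s * y * P (S n))%C = RtoC 0).
    { induction n as [|n IH].
      - unfold P, Q. cbn [psum]. rewrite Hbrec. cbn [INR]. ring.
      - assert (EQ : forall k, Q (S k) = (Q k + Cps_derive b k * RtoC t ^ k)%C) by reflexivity.
        assert (EP : forall k, P (S k) = (P k + b k * RtoC t ^ k)%C) by reflexivity.
        rewrite (EQ (S n)), (EP (S n)), (EQ n) at 1. rewrite (EQ n) in IH |- *.
        assert (Er : (Cps_derive b (S n) + y * RtoC (INR (S n)) * b (S n) + s * y * b (S n))%C
                     = RtoC 0) by (rewrite Hbrec; ring).
        assert (Ed : Cps_derive b n = (RtoC (INR (S n)) * b (S n))%C) by reflexivity.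
        rewrite Ed in IH |- *. cbn [Cpow].
        transitivity ((Q n + INR (S n) * b (S n) * t ^ n + t * y * Q n + s * y * P (S n))
          + (Cps_derive b (S n) + y * INR (S n) * b (S n) + s * y * b (S n)) * (t * t ^ n))%C;
          [ring|]. rewrite IH, Er. ring. }
    assert (Hlim : (S2 + RtoC t * y * S2 + s * y * S1)%C = RtoC 0).
    { apply (converges_unique (fun n => Q (S n) + RtoC t * y * Q n + s * y * P (S n))%C).
      - apply (converges_plus (fun n => Q (S n) + RtoC t * y * Q n)%C
          (fun n => s * y * P (S n))%C).
        + apply (converges_plus (fun n => Q (S n)) (fun n => RtoC t * y * Q n)%C).
          * now apply converges_shift.
          * now apply converges_scal.
        + apply (converges_scal _ (fun n => P (S n))). now apply converges_shift.
      - intros eps Heps. exists 0%nat. intros n _. rewrite Hfin.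
        replace (RtoC 0 - RtoC 0)%C with (RtoC 0) by ring. now rewrite Cmod_0. }
    specialize (Hnz t Ht).
    (* Since y = 1 / u, the factor 1 + t y is (u + t) / u and can be divided out. *)
    replace S2 with ((S2 + t * y * S2 + s * y * S1 - s * y * S1) * (u / (u + t)))%C.
    + rewrite Hlim, Hyu. field. auto.
    + rewrite Hyu. field. auto.
  - replace (Cpow_neg (w + h) s * Cexp (s * Clog w))%C with (Cseries b 1); [exact H1|].
    rewrite 2!HV in H2 by lra. unfold b in H2 at 2. cbn [binom_neg Cpow] in H2.
    replace (w + 1 * h)%C with (w + h)%C in H2 by ring.
    replace (w + 0 * h)%C with w in H2 by ring.
    replace (Cexp (s * Clog w) * (1 * 1))%C with (Cexp (s * Clog w)) in H2 by ring.
    rewrite <- H2, Cpow_neg_Clog.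
    transitivity (Cexp (- (s * Clog (w + h))) * Cexp (s * Clog (w + h)) * Cseries b 1)%C;
      [rewrite Cexp_opp; ring|ring].
Qed.

End HalfPlane.

(** * Entire expansions of w^(-s) and of the difference quotient *)

Lemma RtoC_INR_S_neq_0 n : RtoC (INR (S n)) <> RtoC 0.
Proof. intros H. apply RtoC_inj in H. revert H. apply not_0_INR. lia. Qed.

Lemma Cmult_cancel_l (c x y : C) : c <> RtoC 0 -> (c * x)%C = (c * y)%C -> x = y.
Proof.
  intros Hc H. replace x with (/ c * (c * x))%C by (field; auto). rewrite H. field. auto.
Qed.

Lemma Cpow_neg_add w s l : w <> RtoC 0 ->
  Cpow_neg w (s + RtoC (INR l)) = ((/ w) ^ l * Cpow_neg w s)%C.
Proof.
  intros Hw. induction l as [|l IH].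
  - cbn [INR Cpow]. replace (s + 0)%C with s by ring. ring.
  - rewrite Cpow_S, <- Cmult_assoc, <- IH, S_INR, RtoC_plus, 2!Cpow_neg_Clog.
    replace (- ((s + (INR l + 1)) * Clog w))%C
      with (- Clog w + - ((s + INR l) * Clog w))%C by ring.
    rewrite Cexp_plus. f_equal.
    rewrite <- (Cexp_Clog w Hw) at 2. rewrite <- (Cmult_1_r (/ _)), <- (Cexp_opp (Clog w)).
    field. apply Cexp_neq_0.
Qed.

Lemma Cmod_Clog_le w : w <> RtoC 0 -> Cmod (Clog w) <= Rabs (ln (Cmod w)) + PI.
Proof.
  intros Hw. assert (H := Carg_range w Hw).
  replace (Clog w) with (RtoC (ln (Cmod w)) + Ci * RtoC (Carg w))%C.
  - eapply Rle_trans; [apply Cmod_triangle|].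
    rewrite Cmod_mult, Cmod_Ci, 2!Cmod_R, Rmult_1_l.
    apply Rplus_le_compat_l. apply Rabs_le. lra.
  - apply injective_projections; cbn; ring.
Qed.

Lemma Cmod_Cpow_neg_le w s : w <> RtoC 0 ->
  Cmod (Cpow_neg w s) <= exp (- Re s * ln (Cmod w) + PI * Rabs (Im s)).
Proof.
  intros Hw. assert (H := Carg_range w Hw). rewrite Cpow_neg_Clog, Cmod_Cexp.
  destruct s as [x y]. cbn [Re Im Clog Copp Cmult fst snd].
  assert (Hy : y * Carg w <= PI * Rabs y).
  { rewrite Rmult_comm. eapply Rle_trans; [apply Rle_abs|]. rewrite Rabs_mult.
    apply Rmult_le_compat_r; [apply Rabs_pos|]. apply Rabs_le. lra. }
  assert (Hle : - (x * ln (Cmod w) - y * Carg w) <= - x * ln (Cmod w) + PI * Rabs y) by lra.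
  destruct Hle as [Hle|Hle]; [left; now apply exp_increasing|right; now rewrite Hle].
Qed.

Lemma exp_le x y : x <= y -> exp x <= exp y.
Proof. intros [H| ->]; [left; now apply exp_increasing|apply Rle_refl]. Qed.

Lemma Cexp_coef_mult w t j : Cexp_coef (w * t) j = (Cexp_coef w j * t ^ j)%C.
Proof.
  unfold Cexp_coef. rewrite Cpow_mult_l. field. apply RtoC_INR_fact_neq_0.
Qed.

Lemma bounded_sums_ext {I : Type} (P : I -> Prop) b b' B :
  (forall i, P i -> b i <= b' i) -> bounded_sums P b' B -> bounded_sums P b B.
Proof.
  intros H HB l Hl HP. eapply Rle_trans; [|apply (HB l Hl HP)]. eapply Rsum_le; eauto.
Qed.

(** The expansion is w^(-s0) times the exponential series of -t log w; summing the moduli of its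
    terms at |t| = rho gives the constant. *)
Lemma taylor_bounded_Cpow_neg w s0 rho : 0 < rho -> w <> RtoC 0 ->
  taylor_bounded s0 rho (Cpow_neg w) (Cmod (Cpow_neg w s0) * exp (Cmod (Clog w) * rho)).
Proof.
  intros Hr Hw.
  apply (taylor_bounded_has_sum (fun _ : nat => True) s0 rho
    (fun j s => Cpow_neg w s0 * Cexp_coef (- Clog w) j * ((s + - s0) ^ j * 1))%C _
    (fun j => Cmod (Cpow_neg w s0) * ((Cmod (Clog w) * rho) ^ j / INR (fact j)))); auto.
  - intros j _.
    replace (Cmod (Cpow_neg w s0) * ((Cmod (Clog w) * rho) ^ j / INR (fact j)))
      with (Cmod (Cpow_neg w s0 * Cexp_coef (- Clog w) j)
            * ((Cmod (s0 + - s0) + rho) ^ j * Cmod 1)).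
    + apply taylor_bounded_scal, taylor_bounded_pow; auto.
      now apply (taylor_bounded_const s0 rho (RtoC 1)).
    + rewrite Cmod_mult, Cmod_Cexp_coef, Cmod_opp, Cmod_1.
      replace (s0 + - s0)%C with (RtoC 0) by ring.
      rewrite Cmod_0, Rplus_0_l, Rpow_mult_distr. unfold Rdiv. ring.
  - apply bounded_sums_scal; [apply Cmod_ge_0|]. apply bounded_sums_exp.
    apply Rmult_le_pos; [apply Cmod_ge_0|lra].
  - intros t _. replace (Cpow_neg w (s0 + t)) with (Cpow_neg w s0 * Cexp (- Clog w * t))%C.
    + eapply has_sum_ext; [|apply has_sum_scal, has_sum_Cexp].
      intros j _. cbn beta. rewrite Cexp_coef_mult.
      replace (s0 + t + - s0)%C with t by ring. ring.
    + rewrite 2!Cpow_neg_Clog, <- Cexp_plus. f_equal. ring.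
Qed.

(** For |w| >= delta one has |ln |w|| <= ln |w| + 2 |ln delta|, so the factor exp(rho |log w|) is at
    most a constant times |w|^rho. That is the loss of rho in the exponent; the arguments of w only
    enter the constant. *)
Lemma taylor_bounded_Cpow_neg_uniform s0 rho delta : 0 < rho -> 0 < delta ->
  exists K, 0 <= K /\ forall w, w <> RtoC 0 -> delta <= Cmod w ->
    taylor_bounded s0 rho (Cpow_neg w) (K * exp (- (Re s0 - rho) * ln (Cmod w))).
Proof.
  intros Hr Hd.
  exists (exp (PI * Rabs (Im s0) + rho * (2 * Rabs (ln delta) + PI))).
  split; [left; apply exp_pos|]. intros w Hw Hdw.
  eapply taylor_bounded_le; [auto| |now apply taylor_bounded_Cpow_neg].
  eapply Rle_trans.
  { apply Rmult_le_compat_r; [left; apply exp_pos|]. now apply Cmod_Cpow_neg_le. }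
  rewrite <- 2!exp_plus. apply exp_le.
  assert (H1 := Cmod_Clog_le w Hw).
  assert (H2 : Rabs (ln (Cmod w)) <= ln (Cmod w) + 2 * Rabs (ln delta)).
  { assert (H3 : ln delta <= ln (Cmod w)).
    { destruct Hdw as [Hdw|Hdw]; [left; now apply ln_increasing|right; now rewrite Hdw]. }
    unfold Rabs. destruct (Rcase_abs (ln (Cmod w))), (Rcase_abs (ln delta)); lra. }
  nra.
Qed.

(** On the whole disc |s + k| <= B + k, so the count in [Cmod_binom_neg_le] applies uniformly. *)
Lemma taylor_bounded_binom_neg l s0 rho f M B :
  0 < rho -> 1 <= B -> Cmod s0 + rho <= B -> taylor_bounded s0 rho f M ->
  taylor_bounded s0 rho (fun s => binom_neg l s * f s)%C (B ^ l * M).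
Proof.
  intros Hr HB1 HB Hf. induction l as [|l IH].
  - rewrite Rmult_1_l. eapply taylor_bounded_ext; [|exact Hf]. intros; cbn; ring.
  - assert (HM := taylor_bounded_nonneg _ _ _ _ Hr IH).
    apply taylor_bounded_linear with (c := RtoC (INR l)) in IH; [|auto].
    apply (taylor_bounded_scal _ _ (RtoC (- / INR (S l)))) in IH.
    eapply taylor_bounded_ext; [|eapply taylor_bounded_le; [auto| |exact IH]].
    + intros t _. cbn [binom_neg]. ring.
    + rewrite Cmod_R, Rabs_Ropp, Rabs_inv.
      assert (Hp := lt_0_INR (S l) ltac:(lia)). assert (Hl := pos_INR l).
      rewrite (Rabs_pos_eq (INR (S l))) by lra.
      assert (Ht : Cmod (s0 + INR l) <= Cmod s0 + INR l).
      { eapply Rle_trans; [apply Cmod_triangle|]. rewrite (Cmod_R (INR l)), Rabs_pos_eq; lra. }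
      replace (B ^ S l * M) with (/ INR (S l) * ((B * INR (S l)) * (B ^ l * M)))
        by (cbn [pow]; field; lra).
      apply Rmult_le_compat_l; [left; now apply Rinv_0_lt_compat|].
      apply Rmult_le_compat_r; [auto|]. rewrite S_INR. nra.
Qed.

Section Remainder.
Variable h : C.
Hypotheses (Hh : h <> RtoC 0) (Hah : 0 < Carg h <= PI).

(** The q_l of the overview: binom(1 - s, l + 1) h^l / (1 - s) with the factor 1 - s already
    cancelled, hence polynomial at s = 1 too. *)
Definition step_coef (l : nat) (s : C) : C :=
  (h ^ l * RtoC (/ INR (S l)) * binom_neg l s)%C.

(* [((w + h)^(1-s) - w^(1-s)) / (h (1 - s))], which is entire in s. *)
Definition step_quotient (w s : C) : C :=
  if Ceq_dec s (RtoC 1) then ((Clog (w + h) - Clog w) / h)%C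
  else ((Cpow_neg (w + h) (s - 1) - Cpow_neg w (s - 1)) / (h * (1 - s)))%C.

Definition step_remainder (L : nat) (w s : C) : C :=
  (step_quotient w s - psum (fun l => step_coef l s * Cpow_neg w (s + RtoC (INR l))) L)%C.

Lemma taylor_bounded_step_coef l s0 rho f M B :
  0 < rho -> 1 <= B -> Cmod s0 + rho <= B -> taylor_bounded s0 rho f M ->
  taylor_bounded s0 rho (fun s => step_coef l s * f s)%C ((B * Cmod h) ^ l * M).
Proof.
  intros Hr HB1 HB Hf.
  assert (H := taylor_bounded_binom_neg l s0 rho f M B Hr HB1 HB Hf).
  assert (HM := taylor_bounded_nonneg _ _ _ _ Hr H).
  apply (taylor_bounded_scal _ _ (h ^ l * RtoC (/ INR (S l)))%C) in H.
  eapply taylor_bounded_ext; [|eapply taylor_bounded_le; [auto| |exact H]].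
  - intros t _. unfold step_coef. ring.
  - rewrite Cmod_mult, Cmod_pow, Cmod_R, Rabs_inv, Rpow_mult_distr.
    assert (Hp := pos_INR l). rewrite S_INR, Rabs_pos_eq by lra.
    replace (B ^ l * Cmod h ^ l * M) with (Cmod h ^ l * 1 * (B ^ l * M)) by ring.
    apply Rmult_le_compat_r; [auto|]. apply Rmult_le_compat_l; [apply pow_le, Cmod_ge_0|].
    rewrite <- Rinv_1. apply Rinv_le_contravar; lra.
Qed.

(** Extracting w^(-l) makes the constants geometric in l with ratio B |h| / |w|, which is small
    exactly for large |w|. *)
Lemma taylor_bounded_step_term l w s0 rho M B :
  0 < rho -> 1 <= B -> Cmod s0 + rho <= B -> w <> RtoC 0 ->
  taylor_bounded s0 rho (Cpow_neg w) M ->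
  taylor_bounded s0 rho (fun s => step_coef l s * Cpow_neg w (s + RtoC (INR l)))%C
    ((B * Cmod h / Cmod w) ^ l * M).
Proof.
  intros Hr HB1 HB Hw Hf.
  apply (taylor_bounded_step_coef l _ _ _ _ B Hr HB1 HB) in Hf.
  apply (taylor_bounded_scal _ _ ((/ w) ^ l)%C) in Hf.
  assert (Hmw := proj1 (Cmod_gt_0 w) Hw).
  replace ((B * Cmod h / Cmod w) ^ l * M)
    with (Cmod ((/ w) ^ l) * ((B * Cmod h) ^ l * M)).
  - eapply taylor_bounded_ext; [|exact Hf]. intros t _. cbn beta.
    rewrite Cpow_neg_add by auto. ring.
  - rewrite Cmod_pow, Cmod_inv by auto. unfold Rdiv. rewrite (Rpow_mult_distr _ (/ Cmod w)). ring.
Qed.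

(** The absorption identity (l + 1) binom(1 - s, l + 1) = (1 - s) binom(-s, l), which cancels the
    denominator 1 - s of D. *)
Lemma binom_neg_pred l s :
  (RtoC (INR (S l)) * binom_neg (S l) (s - 1))%C = ((1 - s) * binom_neg l s)%C.
Proof.
  induction l as [|l IH]; rewrite binom_neg_S.
  - cbn. ring.
  - apply (Cmult_cancel_l (RtoC (INR (S l)))); [apply RtoC_INR_S_neq_0|].
    transitivity (- (s - 1 + INR (S l)) * (INR (S l) * binom_neg (S l) (s - 1)))%C; [ring|].
    rewrite IH.
    transitivity ((1 - s) * (INR (S l) * binom_neg (S l) s))%C; [|ring].
    rewrite binom_neg_S, S_INR, RtoC_plus. ring.
Qed.

(* Both the infinite expansion for |w| large and the finite one for
   1 - s a natural number are instances of this identity of partial sums. *)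
Lemma psum_step_terms w s N : w <> RtoC 0 -> s <> RtoC 1 ->
  psum (fun l => step_coef l s * Cpow_neg w (s + RtoC (INR l)))%C N
  = (Cpow_neg w (s - 1) / (h * (1 - s))
     * (psum (fun l => binom_neg l (s - 1) * (h / w) ^ l) (S N) - 1))%C.
Proof.
  intros Hw Hs.
  assert (Hs' : (1 - s)%C <> RtoC 0).
  { intros E. apply Hs. replace s with (1 - (1 - s))%C by ring. rewrite E. ring. }
  rewrite psum_shift.
  replace (binom_neg 0 (s - 1) * (h / w) ^ 0
           + psum (fun n => binom_neg (S n) (s - 1) * (h / w) ^ S n) N - 1)%C
    with (psum (fun n => binom_neg (S n) (s - 1) * (h / w) ^ S n) N)%C
    by (cbn [binom_neg Cpow]; ring).
  rewrite <- psum_scal. apply psum_ext. intros l _.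
  rewrite Cpow_neg_add by auto.
  assert (E : Cpow_neg w s = (/ w * Cpow_neg w (s - 1))%C).
  { replace s with (s - 1 + RtoC (INR 1))%C at 1 by (cbn; ring).
    rewrite Cpow_neg_add by auto. cbn. ring. }
  rewrite E. unfold step_coef. rewrite RtoC_inv by (apply not_0_INR; lia).
  assert (Hn := RtoC_INR_S_neq_0 l).
  unfold Cdiv at 2. rewrite Cpow_mult_l, 2!Cpow_S.
  set (b := binom_neg (S l) (s - 1)).
  replace (binom_neg l s) with (RtoC (INR (S l)) * b / (1 - s))%C
    by (unfold b; rewrite binom_neg_pred; field; auto).
  field. repeat split; auto.
Qed.

Lemma step_quotient_series_ne w s M : in_half h w -> s <> RtoC 1 ->
  1 <= M -> Cmod (s - 1) <= M -> 2 * M * Cmod h <= Cmod w ->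
  converges (psum (fun l => step_coef l s * Cpow_neg w (s + RtoC (INR l)))%C)
    (step_quotient w s).
Proof.
  intros Hw Hs HM Hsm HwM.
  assert (Hw0 := proj1 Hw).
  assert (Hs' : (1 - s)%C <> RtoC 0).
  { intros E. apply Hs. replace s with (1 - (1 - s))%C by ring. rewrite E. ring. }
  assert (H := binomial_series h Hh Hah w (s - 1) M Hw HM Hsm HwM).
  apply converges_shift in H.
  apply (converges_plus _ (fun _ => (- (1))%C) _ (- (1))%C) in H.
  2:{ intros eps Heps. exists 0%nat. intros N _.
      replace (- (1) - - (1))%C with (RtoC 0) by ring. now rewrite Cmod_0. }
  apply (converges_scal (Cpow_neg w (s - 1) / (h * (1 - s)))%C) in H.
  unfold step_quotient. destruct (Ceq_dec s 1) as [E|_]; [contradiction|].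
  replace ((Cpow_neg (w + h) (s - 1) - Cpow_neg w (s - 1)) / (h * (1 - s)))%C
    with (Cpow_neg w (s - 1) / (h * (1 - s)) *
       (Cpow_neg (w + h) (s - 1) * Cexp ((s - 1) * Clog w) + - (1)))%C.
  - eapply converges_ext; [|exact H]. intros n. cbn beta. now rewrite psum_step_terms.
  - assert (E : (Cpow_neg w (s - 1) * Cexp ((s - 1) * Clog w))%C = RtoC 1) by apply Cexp_opp.
    transitivity ((Cpow_neg (w + h) (s - 1) * (Cpow_neg w (s - 1) * Cexp ((s - 1) * Clog w))
       - Cpow_neg w (s - 1)) / (h * (1 - s)))%C; [field; auto|]. rewrite E. field. auto.
Qed.

Lemma has_sum_single (a : nat -> C) :
  (forall n, (0 < n)%nat -> a n = RtoC 0) -> has_sum (fun _ => True) a (a 0%nat).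
Proof.
  intros H.
  apply (has_sum_of_converges a (fun n => match n with O => Cmod (a 0%nat) | _ => 0 end)
           (Cmod (a 0%nat))).
  - intros [|n]; [apply Rle_refl|]. rewrite H by lia. rewrite Cmod_0. lra.
  - apply bounded_sums_nat.
    + intros [|n]; [apply Cmod_ge_0|lra].
    + intros N. destruct N as [|N]; [apply Cmod_ge_0|].
      cbn [seq]. rewrite Rsum_cons. apply Rplus_le_reg_l with (- Cmod (a 0%nat)).
      replace (- Cmod (a 0%nat) + Cmod (a 0%nat)) with 0 by ring.
      rewrite <- Rplus_assoc, Rplus_opp_l, Rplus_0_l. right.
      rewrite <- seq_shift. induction (seq 0 N) as [|k l IH]; [reflexivity|].
      cbn [map]. rewrite Rsum_cons, IH. ring.
  - intros eps Heps. exists 1%nat. intros [|N] HN; [lia|].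
    rewrite psum_shift, psum_0 by (intros; apply H; lia).
    replace (a 0%nat + 0 - a 0%nat)%C with (RtoC 0) by ring. now rewrite Cmod_0.
Qed.

(** Both exponentials are expanded in powers of 1 - s. Their constant terms cancel, so one factor 1
    - s divides out and D becomes an everywhere convergent series in s - 1. The bound has no decay
    in w; it is meant for w in a bounded range. *)
Lemma taylor_bounded_step_quotient w s0 rho A :
  0 < rho -> w <> RtoC 0 -> (w + h)%C <> RtoC 0 ->
  Cmod (Clog w) <= A -> Cmod (Clog (w + h)) <= A ->
  taylor_bounded s0 rho (step_quotient w)
    (2 * A / Cmod h * exp (A * (Cmod (s0 + - (1)) + rho))).
Proof.
  intros Hr Hw Hwh HA1 HA2.
  assert (HA : 0 <= A) by (eapply Rle_trans; [apply Cmod_ge_0|exact HA1]).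
  assert (Hmh := proj1 (Cmod_gt_0 h) Hh).
  set (X := Cmod (s0 + - (1)) + rho).
  assert (HX : 0 <= X) by (unfold X; assert (Hm := Cmod_ge_0 (s0 + - (1))); lra).
  set (d := fun j => (Cexp_coef (Clog (w + h)) (S j) - Cexp_coef (Clog w) (S j))%C).
  assert (Hd : forall j, Cmod (d j) <= 2 * A * (A ^ j / INR (fact j))).
  { assert (H1 : forall x j, Cmod x <= A -> Cmod (Cexp_coef x (S j)) <= A * (A ^ j / INR (fact j))).
    { intros x j Hx. rewrite Cmod_Cexp_coef.
      assert (Hf := INR_fact_lt_0 j). assert (Hj := pos_INR j).
      assert (Hf2 : INR (fact j) <= INR (fact (S j))) by (apply le_INR, fact_le; lia).
      replace (A * (A ^ j / INR (fact j))) with (A ^ S j / INR (fact j)) by (cbn [pow]; field; lra).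
      apply Rmult_le_compat.
      - apply pow_le, Cmod_ge_0.
      - left. apply Rinv_0_lt_compat, INR_fact_lt_0.
      - apply pow_incr. split; [apply Cmod_ge_0|auto].
      - apply Rinv_le_contravar; auto. }
    intros j. unfold d. eapply Rle_trans; [apply Cmod_triangle|]. rewrite Cmod_opp.
    assert (Ha := H1 _ j HA1). assert (Hb := H1 _ j HA2). lra. }
  assert (Hterm : forall j, taylor_bounded s0 rho
     (fun s => / h * ((- (1)) ^ j * d j) * ((s + - (1)) ^ j * 1))%C
     (2 * A / Cmod h * ((A * X) ^ j / INR (fact j)))).
  { intros j. eapply taylor_bounded_le; [auto| |apply taylor_bounded_scal, taylor_bounded_pow; auto;
      now apply (taylor_bounded_const s0 rho (RtoC 1))].
    rewrite 2!Cmod_mult, Cmod_inv, Cmod_pow, Cmod_1 by auto.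
    rewrite Cmod_m1, pow1, Rmult_1_l, Rmult_1_r. fold X.
    replace (2 * A / Cmod h * ((A * X) ^ j / INR (fact j)))
      with (/ Cmod h * (2 * A * (A ^ j / INR (fact j))) * X ^ j)
      by (rewrite Rpow_mult_distr; unfold Rdiv; ring).
    apply Rmult_le_compat_r; [now apply pow_le|].
    apply Rmult_le_compat_l; [left; now apply Rinv_0_lt_compat|auto]. }
  apply (taylor_bounded_has_sum (fun _ : nat => True) s0 rho
    (fun j s => / h * ((- (1)) ^ j * d j) * ((s + - (1)) ^ j * 1))%C _
    (fun j => 2 * A / Cmod h * ((A * X) ^ j / INR (fact j)))); auto.
  - apply bounded_sums_scal.
    + apply Rdiv_le_0_compat; lra.
    + apply bounded_sums_exp. now apply Rmult_le_pos.
  - intros t Ht. set (s := (s0 + t)%C).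
    assert (Hj : forall j, (/ h * ((- (1)) ^ j * d j) * ((s + - (1)) ^ j * 1))%C
       = (/ h * (d j * (1 - s) ^ j))%C).
    { intros j. replace (1 - s)%C with (- (1) * (s + - (1)))%C by ring.
      rewrite Cpow_mult_l. ring. }
    apply (has_sum_ext _ (fun j => / h * (d j * (1 - s) ^ j))%C); [intros; now rewrite Hj|].
    unfold step_quotient. destruct (Ceq_dec s 1) as [E|Hs].
    (* At s = 1 only the term j = 0 survives, and it is the special value in [step_quotient]. *)
    + replace ((Clog (w + h) - Clog w) / h)%C with (/ h * (d 0%nat * (1 - s) ^ 0))%C.
      * apply has_sum_single. intros [|n] Hn; [lia|]. rewrite E. cbn [Cpow]. ring.
      * unfold d, Cexp_coef. cbn. field. auto.
    + assert (Hs' : (1 - s)%C <> RtoC 0).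
      { intros E. apply Hs. replace s with (1 - (1 - s))%C by ring. rewrite E. ring. }
      eapply has_sum_of_converges.
      * intros n. rewrite <- Hj.
        apply (taylor_bounded_value _ _ _ _ _ (Hterm n) Ht).
      * apply bounded_sums_scal.
        -- apply Rdiv_le_0_compat; lra.
        -- apply bounded_sums_exp. now apply Rmult_le_pos.
      * assert (HE : forall x, converges
           (fun N => psum (fun j => Cexp_coef (x * (1 - s)) (S j)) N) (Cexp (x * (1 - s)) + - (1))%C).
        { intros x. assert (H := converges_shift _ _ (converges_Cexp (x * (1 - s)))).
          apply (converges_plus _ (fun _ => (- (1))%C) _ (- (1))%C) in H.
          - eapply converges_ext; [|exact H]. intros n. cbn beta. rewrite psum_shift.
            unfold Cexp_coef at 1. cbn [Cpow fact INR]. field.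
          - intros eps Heps. exists 0%nat. intros N _.
            replace (- (1) - - (1))%C with (RtoC 0) by ring. now rewrite Cmod_0. }
        assert (H := converges_plus _ _ _ _ (HE (Clog (w + h)))
           (converges_scal (- (1))%C _ _ (HE (Clog w)))).
        apply (converges_scal (/ (h * (1 - s)))%C) in H.
        replace ((Cpow_neg (w + h) (s - 1) - Cpow_neg w (s - 1)) / (h * (1 - s)))%C
          with (/ (h * (1 - s)) * (Cexp (Clog (w + h) * (1 - s)) + - (1)
             + - (1) * (Cexp (Clog w * (1 - s)) + - (1))))%C.
        -- eapply converges_ext; [|exact H]. intros N. cbn beta.
           rewrite <- psum_scal, <- psum_plus, <- psum_scal. apply psum_ext. intros j _.
           rewrite 2!Cexp_coef_mult. unfold d. cbn [Cpow]. field. auto.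
        -- rewrite 2!Cpow_neg_Clog.
           replace (- ((s - 1) * Clog (w + h)))%C with (Clog (w + h) * (1 - s))%C by ring.
           replace (- ((s - 1) * Clog w))%C with (Clog w * (1 - s))%C by ring.
           field. auto.
Qed.

End Remainder.

(** * The remainder of the asymptotic expansion *)

Lemma binom_neg_0 l : binom_neg (S l) (RtoC 0) = RtoC 0.
Proof.
  induction l as [|l IH].
  - cbn [binom_neg INR]. ring.
  - change (binom_neg (S (S l)) (RtoC 0)) with
      (binom_neg (S l) (RtoC 0) * ((RtoC 0 + RtoC (INR (S l))) * RtoC (- / INR (S (S l)))))%C.
    rewrite IH. ring.
Qed.

Lemma binom_neg_pascal l s :
  binom_neg (S l) (s - 1) = (binom_neg (S l) s + binom_neg l s)%C.
Proof.
  apply (Cmult_cancel_l (RtoC (INR (S l)))); [apply RtoC_INR_S_neq_0|].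
  rewrite binom_neg_pred, Cmult_plus_distr_l, binom_neg_S, S_INR, RtoC_plus. ring.
Qed.

(** Pascal's rule gives the induction; binom(m, l) = 0 for l > m is why every truncation beyond m is
    already complete. *)
Lemma psum_binom_neg m x N : (m < N)%nat ->
  psum (fun l => binom_neg l (- RtoC (INR m)) * x ^ l)%C N = ((1 + x) ^ m)%C.
Proof.
  revert N. induction m as [|m IH]; intros [|N] HN; try lia.
  - rewrite psum_shift, psum_0.
    + cbn [INR binom_neg Cpow]. ring.
    + intros n _. replace (- RtoC (INR 0))%C with (RtoC 0) by (cbn [INR]; ring).
      rewrite binom_neg_0. ring.
  - replace (- RtoC (INR (S m)))%C with (- RtoC (INR m) - 1)%C
      by (rewrite S_INR, RtoC_plus; ring).
    rewrite psum_shift.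
    rewrite (psum_ext _ (fun l => binom_neg (S l) (- RtoC (INR m)) * x ^ S l
       + x * (binom_neg l (- RtoC (INR m)) * x ^ l))%C).
    2:{ intros n _. rewrite binom_neg_pascal. cbn [Cpow]. ring. }
    rewrite psum_plus, psum_scal, (IH N) by lia.
    transitivity ((binom_neg 0 (- INR m) * x ^ 0
       + psum (fun l => binom_neg (S l) (- INR m) * x ^ S l) N) + x * (1 + x) ^ m)%C.
    { cbn [binom_neg]. ring. }
    rewrite <- (psum_shift (fun l => binom_neg l (- INR m) * x ^ l)%C N), IH by lia.
    cbn [Cpow]. ring.
Qed.

Lemma Cpow_neg_opp_INR w m : w <> RtoC 0 -> Cpow_neg w (- RtoC (INR m)) = (w ^ m)%C.
Proof.
  intros Hw. induction m as [|m IH].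
  - rewrite Cpow_neg_Clog. cbn [INR Cpow].
    replace (- (- 0 * Clog w))%C with (RtoC 0) by ring. apply Cexp_0.
  - cbn [Cpow]. rewrite <- IH.
    transitivity (Cexp (Clog w) * Cpow_neg w (- RtoC (INR m)))%C;
      [|now rewrite Cexp_Clog].
    rewrite 2!Cpow_neg_Clog, <- Cexp_plus, S_INR, RtoC_plus. f_equal. ring.
Qed.

Section Remainder.
Variable h : C.
Hypotheses (Hh : h <> RtoC 0) (Hah : 0 < Carg h <= PI).

(** At s = 1 - m the numerator of D is (w + h)^m - w^m. The K subtracted terms are its binomial
    terms of orders 1 to K, so m <= K exhausts it. *)
Lemma step_remainder_nonpos_int K m w :
  (1 <= m <= K)%nat -> w <> RtoC 0 -> (w + h)%C <> RtoC 0 ->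
  step_remainder h K w (RtoC (1 - INR m)) = RtoC 0.
Proof.
  intros Hm Hw Hwh. set (s := RtoC (1 - INR m)).
  assert (Hs1 : (s - 1)%C = (- RtoC (INR m))%C) by (unfold s; rewrite RtoC_minus; ring).
  assert (Hs : s <> RtoC 1).
  { intros E. unfold s in E. apply RtoC_inj in E.
    assert (H := lt_0_INR m ltac:(lia)). lra. }
  unfold step_remainder, step_quotient. destruct (Ceq_dec s 1) as [E|_]; [contradiction|].
  rewrite psum_step_terms by auto. rewrite Hs1, psum_binom_neg, 2!Cpow_neg_opp_INR by (auto; lia).
  assert (E : ((w + h) ^ m)%C = (w ^ m * (1 + h / w) ^ m)%C).
  { rewrite <- Cpow_mult_l. f_equal. field. auto. }
  rewrite E. field. split; auto.
  intros E'. apply Hs. replace s with (1 - (1 - s))%C by ring. rewrite E'. ring.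
Qed.

Definition step_term (w s : C) (l : nat) : C :=
  (step_coef h l s * Cpow_neg w (s + RtoC (INR l)))%C.

Lemma bounded_sums_geometric q : 0 <= q <= / 2 -> bounded_sums (fun _ => True) (pow q) 2.
Proof.
  intros Hq. apply bounded_sums_nat; [intros; apply pow_le; lra|].
  intros N. assert (H : Rsum (pow q) (seq 0 N) <= 2 - 2 * (/ 2) ^ N).
  { induction N as [|N IH]; [cbn; lra|].
    rewrite seq_S, Rsum_app, Rsum_cons. cbn [Nat.add Rsum fold_right].
    assert (q ^ N <= (/ 2) ^ N) by (apply pow_incr; lra). unfold Rsum in *. cbn [pow]. lra. }
  assert (0 <= (/ 2) ^ N) by (apply pow_le; lra). lra.
Qed.

(** Large |w| makes the ratio of the constants at most 1/2, so the tail from L on costs at most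
    twice its first term. *)
Lemma step_tail w s0 rho M B L :
  0 < rho -> 1 <= B -> Cmod s0 + rho <= B -> w <> RtoC 0 -> 2 * B * Cmod h <= Cmod w ->
  taylor_bounded s0 rho (Cpow_neg w) M ->
  exists F, taylor_bounded s0 rho F (2 * (B * Cmod h / Cmod w) ^ L * M) /\
    forall t, Cmod t <= rho ->
      has_sum (fun _ => True) (fun j => step_term w (s0 + t) (L + j)) (F (s0 + t)%C).
Proof.
  intros Hr HB1 HB Hw HBw HM.
  assert (HM0 := taylor_bounded_nonneg _ _ _ _ Hr HM).
  assert (Hmw := proj1 (Cmod_gt_0 w) Hw).
  set (q := B * Cmod h / Cmod w).
  assert (Hq : 0 <= q <= / 2).
  { split.
    - apply Rdiv_le_0_compat; [|auto]. apply Rmult_le_pos; [lra|apply Cmod_ge_0].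
    - unfold q. apply (Rmult_le_reg_r (Cmod w)); [auto|].
      unfold Rdiv. rewrite Rmult_assoc, Rinv_l by lra. lra. }
  set (b := fun j => q ^ L * M * q ^ j).
  assert (Hb : bounded_sums (fun _ => True) b (2 * q ^ L * M)).
  { replace (2 * q ^ L * M) with (q ^ L * M * 2) by ring.
    apply bounded_sums_scal; [apply Rmult_le_pos; [apply pow_le; lra|auto]|].
    now apply bounded_sums_geometric. }
  assert (Hterm : forall j, taylor_bounded s0 rho (fun s => step_term w s (L + j)) (b j)).
  { intros j. replace (b j) with (q ^ (L + j) * M) by (unfold b; rewrite pow_add; ring).
    now apply taylor_bounded_step_term. }
  set (F := fun s => epsilon (inhabits (RtoC 0))
     (has_sum (fun _ => True) (fun j => step_term w s (L + j)))).
  assert (HF : forall t, Cmod t <= rho ->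
      has_sum (fun _ => True) (fun j => step_term w (s0 + t) (L + j)) (F (s0 + t)%C)).
  { intros t Ht. unfold F. apply epsilon_spec. eapply has_sum_exists; [|exact Hb].
    intros j _. exact (taylor_bounded_value _ _ _ _ _ (Hterm j) Ht). }
  exists F. split; [|exact HF].
  apply (taylor_bounded_has_sum (fun _ : nat => True) s0 rho
    (fun j s => step_term w s (L + j)) F b); auto.
Qed.

Lemma continuous_eq f g s0 :
  locally_analytic f s0 -> locally_analytic g s0 ->
  (forall s, 0 < Cmod (s - s0) <= 1 -> f s = g s) -> f s0 = g s0.
Proof.
  intros Hf Hg H. apply Cmod_small_eq. intros eps Heps.
  destruct (locally_analytic_near f s0 (eps / 2) Hf) as [r1 [Hr1 H1]]; [lra|].
  destruct (locally_analytic_near g s0 (eps / 2) Hg) as [r2 [Hr2 H2]]; [lra|].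
  set (e := Rmin 1 (Rmin (r1 / 2) (r2 / 2))).
  assert (He : 0 < e) by (repeat apply Rmin_glb_lt; lra).
  assert (He0 : e <= 1) by apply Rmin_l.
  assert (He1 : e <= r1 / 2) by (eapply Rle_trans; [apply Rmin_r|apply Rmin_l]).
  assert (He2 : e <= r2 / 2) by (eapply Rle_trans; [apply Rmin_r|apply Rmin_r]).
  assert (Hp := C_near_point s0 e He). set (s := (s0 + RtoC e)%C) in *.
  specialize (H1 s ltac:(lra)). specialize (H2 s ltac:(lra)).
  rewrite (H s) in H1 by lra.
  replace (f s0 - g s0)%C with (- (g s - f s0) + (g s - g s0))%C by ring.
  eapply Rle_trans; [apply Cmod_triangle|]. rewrite Cmod_opp. lra.
Qed.

(** The binomial series yields D after division by 1 - s, so s = 1 is reached by continuity: the sum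
    of the expansion and D are both analytic there and agree nearby. *)
Lemma step_quotient_has_sum w s B :
  in_half h w -> 2 <= B -> Cmod s + 1 <= B -> 2 * B * Cmod h <= Cmod w ->
  has_sum (fun _ => True) (step_term w s) (step_quotient h w s).
Proof.
  intros Hw HB HsB HBw. assert (Hw0 := proj1 Hw).
  assert (Hmh := proj1 (Cmod_gt_0 h) Hh).
  assert (Hne : forall s B, 2 <= B -> Cmod s + 1 <= B + 1 -> Cmod (s - 1) <= B ->
      2 * B * Cmod h <= Cmod w -> s <> RtoC 1 ->
      forall S, has_sum (fun _ => True) (step_term w s) S -> S = step_quotient h w s).
  { clear s B HB HsB HBw. intros s B HB HsB Hs1 HBw Hs S HS.
    apply (converges_unique (psum (step_term w s))).
    - now apply converges_of_has_sum.
    - apply (step_quotient_series_ne h Hh Hah w s B); auto. lra. }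
  assert (H1 : forall s, 0 < Cmod (s - 1) -> s <> RtoC 1).
  { intros s' H E. rewrite E in H. replace (1 - 1)%C with (RtoC 0) in H by ring.
    rewrite Cmod_0 in H. lra. }
  destruct (Ceq_dec s 1) as [->|Hs].
  (* With L = 0 the tail is the whole expansion; B = 2 bounds |s| on the unit disc around 1. *)
  - destruct (step_tail w (RtoC 1) 1 _ 2 0 Rlt_0_1 ltac:(lra) ltac:(rewrite Cmod_1; lra) Hw0
      ltac:(nra) (taylor_bounded_Cpow_neg w (RtoC 1) 1 Rlt_0_1 Hw0)) as [F [HF1 HF2]].
    assert (Hwh : (w + h)%C <> RtoC 0).
    { intros E. assert (E' : w = (- h)%C).
      { replace w with (w + h - h)%C by ring. rewrite E. ring. }
      rewrite E', Cmod_opp in HBw. nra. }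
    replace (step_quotient h w 1) with (F (RtoC 1)).
    + assert (H := HF2 (RtoC 0) ltac:(rewrite Cmod_0; lra)).
      replace (1 + 0)%C with (RtoC 1) in H by ring. exact H.
    + apply continuous_eq.
      * exists 1, (2 * (2 * Cmod h / Cmod w) ^ 0
           * (Cmod (Cpow_neg w 1) * exp (Cmod (Clog w) * 1))). split; [lra|exact HF1].
      * eexists 1, _. split; [lra|].
        apply (taylor_bounded_step_quotient h Hh w (RtoC 1) 1
          (Rmax (Cmod (Clog w)) (Cmod (Clog (w + h))))); auto; try lra.
        -- apply Rmax_l.
        -- apply Rmax_r.
      * intros s Hs. apply (Hne s 2); try lra; try nra.
        -- replace s with ((s - 1) + 1)%C by ring.
           eapply Rle_trans; [apply Rplus_le_compat_r, Cmod_triangle|]. rewrite Cmod_1. lra.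
        -- apply H1; lra.
        -- assert (H := HF2 (s - 1)%C ltac:(lra)).
           replace (1 + (s - 1))%C with s in H by ring. exact H.
  - destruct (step_tail w s 1 _ B 0 Rlt_0_1 ltac:(lra) HsB Hw0 HBw
      (taylor_bounded_Cpow_neg w s 1 Rlt_0_1 Hw0)) as [F [_ HF2]].
    assert (H := HF2 (RtoC 0) ltac:(rewrite Cmod_0; lra)).
    replace (s + 0)%C with s in H by ring. cbn [Nat.add] in H.
    rewrite <- (Hne s B HB ltac:(lra)) with (S := F s); auto.
    eapply Rle_trans; [apply Cmod_triangle|]. rewrite Cmod_opp, Cmod_1. exact HsB.
Qed.

Lemma psum_add a L N : psum a (L + N) = (psum a L + psum (fun j => a (L + j)%nat) N)%C.
Proof.
  induction N as [|N IH]; [rewrite Nat.add_0_r; cbn; ring|].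
  rewrite Nat.add_succ_r. cbn [psum]. rewrite IH. ring.
Qed.

(** For large |w| the remainder is the tail of a convergent expansion, which gains the factor
    |w|^(-L). *)
Lemma taylor_bounded_step_remainder_large w s0 rho M B L :
  0 < rho -> 2 <= B -> Cmod s0 + rho + 1 <= B -> in_half h w -> 2 * B * Cmod h <= Cmod w ->
  taylor_bounded s0 rho (Cpow_neg w) M ->
  taylor_bounded s0 rho (step_remainder h L w) (2 * (B * Cmod h / Cmod w) ^ L * M).
Proof.
  intros Hr HB1 HB Hw HBw HM.
  destruct (step_tail w s0 rho M B L Hr ltac:(lra) ltac:(lra) (proj1 Hw) HBw HM)
    as [F [HF1 HF2]].
  eapply taylor_bounded_ext; [|exact HF1]. intros t Ht.
  assert (H1 := converges_of_has_sum _ _ (HF2 t Ht)).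
  assert (H2 : has_sum (fun _ => True) (step_term w (s0 + t)) (step_quotient h w (s0 + t))).
  { apply (step_quotient_has_sum w _ B); auto.
    assert (H := Cmod_triangle s0 t). lra. }
  apply converges_of_has_sum in H2.
  assert (H3 : converges (fun N => psum (step_term w (s0 + t)) (L + N)) (step_quotient h w (s0 + t))).
  { intros eps Heps. destruct (H2 eps Heps) as [N0 HN0]. exists N0.
    intros N HN. apply HN0. lia. }
  assert (H4 : converges (fun N => psum (step_term w (s0 + t)) (L + N))
     (F (s0 + t)%C + psum (step_term w (s0 + t)) L)%C).
  { eapply converges_ext;
      [|apply (converges_plus (psum (fun j => step_term w (s0 + t) (L + j)))
          (fun _ => psum (step_term w (s0 + t)) L)); [exact H1|]].
    - intros n. cbn beta. rewrite (psum_add (step_term w (s0 + t)) L n). apply Cplus_comm.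
    - intros eps Heps. exists 0%nat. intros N _.
      replace (psum (step_term w (s0 + t)) L - psum (step_term w (s0 + t)) L)%C
        with (RtoC 0) by ring. now rewrite Cmod_0. }
  unfold step_remainder. fold (step_term w (s0 + t)).
  change (fun l => (step_coef h l (s0 + t) * Cpow_neg w (s0 + t + RtoC (INR l)))%C)
    with (step_term w (s0 + t)).
  rewrite (converges_unique _ _ _ H3 H4). ring.
Qed.

Lemma Rabs_ln_le x lo hi : 0 < lo -> lo <= x <= hi ->
  Rabs (ln x) <= Rabs (ln lo) + Rabs (ln hi).
Proof.
  intros Hlo [H1 H2].
  assert (H3 : ln lo <= ln x).
  { destruct H1 as [H1| ->]; [left; apply ln_increasing; lra|lra]. }
  assert (H4 : ln x <= ln hi).
  { destruct H2 as [H2| <-]; [left; apply ln_increasing; lra|lra]. }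
  unfold Rabs. destruct (Rcase_abs (ln x)), (Rcase_abs (ln lo)), (Rcase_abs (ln hi)); lra.
Qed.

(** The uniform estimate that lets remainders be summed: compared with w^(-s), the exponent of |w|
    improves by L, again with the loss of rho. *)
Lemma taylor_bounded_step_remainder s0 rho delta L : 0 < rho -> 0 < delta ->
  exists K, 0 <= K /\ forall w, in_half h w -> in_half h (w + h)%C ->
    delta <= Cmod w -> delta <= Cmod (w + h)%C ->
    taylor_bounded s0 rho (step_remainder h L w)
      (K * exp (- (Re s0 + INR L - rho) * ln (Cmod w))).
Proof.
  intros Hr Hd.
  destruct (taylor_bounded_Cpow_neg_uniform s0 rho delta Hr Hd) as [K0 [HK0 HK]].
  assert (Hmh := proj1 (Cmod_gt_0 h) Hh). assert (Hms := Cmod_ge_0 s0).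
  set (B := Cmod s0 + rho + 2).
  (* For |w| >= R the expansion has ratio at most 1/2. For delta <= |w| < R, the constant [A] bounds
     the logarithms of both w and w + h. *)
  set (R := 2 * B * Cmod h).
  set (A := Rabs (ln delta) + Rabs (ln (R + Cmod h)) + PI).
  set (e := - (Re s0 + INR L - rho)).
  set (e0 := - (Re s0 - rho)).
  assert (HB : 2 <= B) by (unfold B; lra).
  assert (HR : 0 < R) by (unfold R; nra).
  assert (HPI := PI_RGT_0).
  assert (HA0 : 0 <= A).
  { unfold A. assert (H1 := Rabs_pos (ln delta)).
    assert (H2 := Rabs_pos (ln (R + Cmod h))). lra. }
  set (K1 := 2 * K0 * (B * Cmod h) ^ L).
  set (K2 := 2 * A / Cmod h * exp (A * (Cmod (s0 + - (1)) + rho))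
     + Rsum (fun l => (B * Cmod h / delta) ^ l * (K0 * exp (Rabs e0 * A))) (seq 0 L)).
  assert (HK1 : 0 <= K1).
  { unfold K1. apply Rmult_le_pos; [lra|]. apply pow_le. nra. }
  assert (HK2 : 0 <= K2).
  { unfold K2. apply Rplus_le_le_0_compat.
    - apply Rmult_le_pos; [apply Rdiv_le_0_compat; lra|left; apply exp_pos].
    - apply (Rsum_incl (fun _ => True)
        (fun l => (B * Cmod h / delta) ^ l * (K0 * exp (Rabs e0 * A))) nil);
        auto using NoDup_nil, Forall_True.
      + intros i _. apply Rmult_le_pos.
        * apply pow_le, Rdiv_le_0_compat; nra.
        * apply Rmult_le_pos; [auto|left; apply exp_pos].
      + intros i []. }
  exists (K1 + K2 * exp (Rabs e * A)). split.
  { apply Rplus_le_le_0_compat; [auto|]. apply Rmult_le_pos; [auto|left; apply exp_pos]. }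
  intros w Hw Hwh Hdw Hdwh.
  assert (Hmw : 0 < Cmod w) by lra. assert (Hw0 := proj1 Hw).
  specialize (HK w Hw0 Hdw).
  assert (Hexp := exp_pos (e * ln (Cmod w))).
  assert (He2 := exp_pos (Rabs e * A)).
  destruct (Rle_lt_dec R (Cmod w)) as [HRw|HRw].
  - eapply taylor_bounded_le; [auto| |].
    2:{ apply (taylor_bounded_step_remainder_large w s0 rho
          (K0 * exp (- (Re s0 - rho) * ln (Cmod w))) B); auto. unfold B; lra. }
    fold e0. apply Rle_trans with (K1 * exp (e * ln (Cmod w))).
    + right. unfold K1, Rdiv. rewrite Rpow_mult_distr.
      replace (e * ln (Cmod w)) with (- ln (Cmod w ^ L) + e0 * ln (Cmod w)).
      * rewrite exp_plus, exp_Ropp, exp_ln, pow_inv by (now apply pow_lt). ring.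
      * rewrite ln_pow by auto. unfold e, e0. ring.
    + apply Rmult_le_compat_r; [lra|]. nra.
  - assert (HlnA : Rabs (ln (Cmod w)) + PI <= A).
    { unfold A. apply Rplus_le_compat_r. apply Rabs_ln_le; [auto|]. lra. }
    assert (HlnA' : Rabs (ln (Cmod (w + h))) + PI <= A).
    { unfold A. apply Rplus_le_compat_r. apply Rabs_ln_le; [auto|]. split; [auto|].
      eapply Rle_trans; [apply Cmod_triangle|]. lra. }
    assert (Hbound : forall x, Rabs (x * ln (Cmod w)) <= Rabs x * A).
    { intros x. rewrite Rabs_mult. apply Rmult_le_compat_l; [apply Rabs_pos|lra]. }
    eapply taylor_bounded_le; [auto| |].
    2:{ eapply taylor_bounded_ext.
        2:{ apply taylor_bounded_plus.
            - apply (taylor_bounded_step_quotient h Hh w s0 rho A); auto.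
              + exact (proj1 Hwh).
              + eapply Rle_trans; [now apply Cmod_Clog_le|auto].
              + eapply Rle_trans; [apply Cmod_Clog_le; exact (proj1 Hwh)|auto].
            - apply (taylor_bounded_scal _ _ (- (1))%C).
              apply (taylor_bounded_psum s0 rho (fun l s => step_term w s l)
                (fun l => (B * Cmod h / delta) ^ l * (K0 * exp (Rabs e0 * A))) L); auto.
              intros l _. eapply taylor_bounded_le; [auto| |].
              2:{ apply taylor_bounded_step_term with (B := B); eauto; unfold B; lra. }
              fold e0. apply Rmult_le_compat.
              + apply pow_le, Rdiv_le_0_compat; nra.
              + apply Rmult_le_pos; [auto|left; apply exp_pos].
              + apply pow_incr. split; [apply Rdiv_le_0_compat; nra|].
                apply Rmult_le_compat_l; [nra|]. apply Rinv_le_contravar; lra.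
              + apply Rmult_le_compat_l; [auto|]. apply exp_le.
                eapply Rle_trans; [apply Rle_abs|apply Hbound]. }
        intros t _.
        change (step_quotient h w (s0 + t) + - (1) * psum (step_term w (s0 + t)) L
          = step_quotient h w (s0 + t) - psum (step_term w (s0 + t)) L)%C. ring. }
    rewrite Cmod_opp, Cmod_1, Rmult_1_l. fold K2.
    apply Rle_trans with (K2 * exp (Rabs e * A) * exp (e * ln (Cmod w))).
    + rewrite Rmult_assoc. rewrite <- (Rmult_1_r K2) at 1.
      apply Rmult_le_compat_l; [auto|]. rewrite <- exp_plus, <- exp_0. apply exp_le.
      assert (H := Hbound e). assert (H' := Rle_abs (- (e * ln (Cmod w)))).
      rewrite Rabs_Ropp in H'. lra.
    + apply Rmult_le_compat_r; [lra|]. lra.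
Qed.

End Remainder.

(** * Continuation strip by strip *)

Lemma locally_analytic_plus f g s0 :
  locally_analytic f s0 -> locally_analytic g s0 ->
  locally_analytic (fun s => f s + g s)%C s0.
Proof.
  intros [r1 [M1 [Hr1 H1]]] [r2 [M2 [Hr2 H2]]].
  assert (Hr : 0 < Rmin r1 r2) by (apply Rmin_glb_lt; lra).
  exists (Rmin r1 r2), (M1 + M2). split; [auto|]. apply taylor_bounded_plus.
  - eapply taylor_bounded_radius; [|exact H1]. split; [auto|apply Rmin_l].
  - eapply taylor_bounded_radius; [|exact H2]. split; [auto|apply Rmin_r].
Qed.

Lemma locally_analytic_scal c f s0 :
  locally_analytic f s0 -> locally_analytic (fun s => c * f s)%C s0.
Proof.
  intros [r [M [Hr H]]]. exists r, (Cmod c * M). split; [auto|].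
  now apply taylor_bounded_scal.
Qed.

Lemma locally_analytic_psum (f : nat -> C -> C) s0 N :
  (forall n, (n < N)%nat -> locally_analytic (f n) s0) ->
  locally_analytic (fun s => psum (fun n => f n s) N) s0.
Proof.
  induction N as [|N IH]; intros H.
  - exists 1, (Cmod 0). split; [lra|]. apply (taylor_bounded_const s0 1 (RtoC 0)). lra.
  - apply locally_analytic_plus; auto.
Qed.

Lemma locally_analytic_shift c f s0 :
  locally_analytic f (s0 + c)%C -> locally_analytic (fun s => f (s + c)%C) s0.
Proof.
  intros [r [M [Hr H]]]. exists r, M. split; [auto|]. now apply taylor_bounded_shift.
Qed.

Lemma locally_analytic_step_coef h l f s0 :
  locally_analytic f s0 -> locally_analytic (fun s => step_coef h l s * f s)%C s0.
Proof.
  intros [r [M [Hr H]]]. assert (Hm := Cmod_ge_0 s0).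
  eexists r, _. split; [auto|].
  apply (taylor_bounded_step_coef h l s0 r f M (Cmod s0 + r + 1)); auto; lra.
Qed.

Definition family_sum {I : Type} (P : I -> Prop) (a : I -> C) : C :=
  epsilon (inhabits (RtoC 0)) (has_sum P a).

Lemma family_sum_eq {I : Type} (P : I -> Prop) (a : I -> C) S :
  has_sum P a S -> family_sum P a = S.
Proof.
  intros H. apply (has_sum_unique P a); [|exact H].
  unfold family_sum. apply epsilon_spec. now exists S.
Qed.

(** The three inputs of the continuation: both end points of each step lie where the logarithm is
    continuous, they keep a common distance from 0 so that the estimates are uniform in the index,
    and d bounds the abscissa of absolute convergence. *)
Record good_family {I : Type} (h : C) (d : R) (P : I -> Prop) (w : I -> C) : Prop := {
  good_half : forall i, P i -> in_half h (w i) /\ in_half h (w i + h)%C;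
  good_away : exists delta, 0 < delta /\
    forall i, P i -> delta <= Cmod (w i) /\ delta <= Cmod (w i + h)%C;
  good_sums : forall sigma, d < sigma ->
    exists B, bounded_sums P (fun i => exp (- sigma * ln (Cmod (w i)))) B
}.

Section Family.
Context {I : Type}.
Variables (h : C) (d : R) (P : I -> Prop) (w : I -> C).
Hypotheses (Hh : h <> RtoC 0) (Hah : 0 < Carg h <= PI) (Hw : good_family h d P w).

(** Stated once for the zeta sums (e = 0) and the remainder sums (e = L). *)
Lemma family_sum_analytic (F : C -> C -> C) s0 e :
  d < Re s0 + e ->
  (forall rho delta, 0 < rho -> 0 < delta -> exists K, 0 <= K /\
     forall w, in_half h w -> in_half h (w + h)%C ->
       delta <= Cmod w -> delta <= Cmod (w + h)%C ->
       taylor_bounded s0 rho (F w) (K * exp (- (Re s0 + e - rho) * ln (Cmod w)))) ->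
  locally_analytic (fun s => family_sum P (fun i => F (w i) s)) s0 /\
  has_sum P (fun i => F (w i) s0) (family_sum P (fun i => F (w i) s0)).
Proof.
  intros He HF. destruct (good_away _ _ _ _ Hw) as [delta [Hd Hdw]].
  (* Half the distance to the abscissa, so that the exponent Re s0 + e - rho still exceeds d. *)
  set (rho := (Re s0 + e - d) / 2). assert (Hr : 0 < rho) by (unfold rho; lra).
  destruct (HF rho delta Hr Hd) as [K [HK HKw]].
  destruct (good_sums _ _ _ _ Hw (Re s0 + e - rho)) as [B HB]; [unfold rho; lra|].
  assert (Hterm : forall i, P i -> taylor_bounded s0 rho (F (w i))
     (K * exp (- (Re s0 + e - rho) * ln (Cmod (w i))))).
  { intros i Hi. destruct (good_half _ _ _ _ Hw i Hi), (Hdw i Hi). now apply HKw. }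
  assert (HKB := bounded_sums_scal P K _ B HK HB).
  assert (Hsum : forall t, Cmod t <= rho ->
    has_sum P (fun i => F (w i) (s0 + t)%C) (family_sum P (fun i => F (w i) (s0 + t)%C))).
  { intros t Ht. unfold family_sum. apply epsilon_spec.
    eapply has_sum_exists; [|exact HKB].
    intros i Hi. exact (taylor_bounded_value _ _ _ _ _ (Hterm i Hi) Ht). }
  split.
  - exists rho, (K * B). split; [auto|].
    now apply (taylor_bounded_has_sum P s0 rho (fun i => F (w i)) _
      (fun i => K * exp (- (Re s0 + e - rho) * ln (Cmod (w i))))).
  - specialize (Hsum (RtoC 0) ltac:(rewrite Cmod_0; lra)).
    replace (s0 + 0)%C with s0 in Hsum by ring. exact Hsum.
Qed.

Definition zeta_sum (s : C) : C := family_sum P (fun i => Cpow_neg (w i) s).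

Definition remainder_sum (L : nat) (s : C) : C :=
  family_sum P (fun i => step_remainder h L (w i) s).

Lemma zeta_sum_spec s : d < Re s ->
  locally_analytic zeta_sum s /\ has_sum P (fun i => Cpow_neg (w i) s) (zeta_sum s).
Proof.
  intros Hs. apply (family_sum_analytic Cpow_neg s 0); [lra|].
  intros rho delta Hr Hd.
  destruct (taylor_bounded_Cpow_neg_uniform s rho delta Hr Hd) as [K [HK H]].
  exists K. split; [auto|]. intros w' Hw' _ Hdw' _. rewrite Rplus_0_r.
  apply H; auto. exact (proj1 Hw').
Qed.

Lemma remainder_sum_spec L s : d < Re s + INR L ->
  locally_analytic (remainder_sum L) s /\
  has_sum P (fun i => step_remainder h L (w i) s) (remainder_sum L s).
Proof.
  intros Hs. apply (family_sum_analytic (step_remainder h L) s (INR L)); [lra|].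
  intros rho delta Hr Hd. now apply taylor_bounded_step_remainder.
Qed.

Lemma Re_plus_INR s l : Re (s + RtoC (INR l)) = Re s + INR l.
Proof. reflexivity. Qed.

(** Exchanges one term between the remainder and the zeta values; this is what compares consecutive
    strips. *)
Lemma remainder_sum_S L s : d < Re s + INR L ->
  remainder_sum (S L) s
  = (remainder_sum L s - step_coef h L s * zeta_sum (s + RtoC (INR L)))%C.
Proof.
  intros Hs. destruct (remainder_sum_spec L s Hs) as [_ H1].
  destruct (zeta_sum_spec (s + RtoC (INR L))) as [_ H2]; [now rewrite Re_plus_INR|].
  apply family_sum_eq.
  replace (remainder_sum L s - step_coef h L s * zeta_sum (s + RtoC (INR L)))%C
    with (remainder_sum L s + (- step_coef h L s) * zeta_sum (s + RtoC (INR L)))%C by ring.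
  eapply has_sum_ext; [|apply has_sum_plus; [exact H1|apply has_sum_scal, H2]].
  intros i _. cbn beta. unfold step_remainder. cbn [psum]. ring.
Qed.

(** For Re s > d every piece converges separately, so the splitting of D into leading terms and
    remainder may be summed piece by piece. *)
Lemma step_quotient_sum L s : d < Re s ->
  has_sum P (fun i => step_quotient h (w i) s)
    (remainder_sum L s + psum (fun l => step_coef h l s * zeta_sum (s + RtoC (INR l))) L)%C.
Proof.
  intros Hs. destruct (remainder_sum_spec L s) as [_ H1].
  { assert (H := pos_INR L). lra. }
  eapply has_sum_ext; [|apply has_sum_plus; [exact H1|]].
  2:{ apply (has_sum_psum P
        (fun i l => step_coef h l s * Cpow_neg (w i) (s + RtoC (INR l)))%C).
      intros l _. apply has_sum_scal, zeta_sum_spec. rewrite Re_plus_INR.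
      assert (H := pos_INR l). lra. }
  intros i _. cbn beta. unfold step_remainder. ring.
Qed.

Lemma remainder_sum_nonpos_int L m :
  (1 <= m <= L)%nat -> remainder_sum L (RtoC (1 - INR m)) = RtoC 0.
Proof.
  intros Hm. apply family_sum_eq. apply (has_sum_ext _ (fun _ => RtoC 0)).
  - intros i Hi. destruct (good_half _ _ _ _ Hw i Hi) as [[H1 _] [H2 _]].
    symmetry. now apply step_remainder_nonpos_int.
  - apply has_sum_0.
Qed.

End Family.

Section Continuation.
Context {I : Type}.
Variables (h : C) (d : R) (P : I -> Prop) (w1 w2 : I -> C).
Hypotheses (Hh : h <> RtoC 0) (Hah : 0 < Carg h <= PI) (Hd : 1 <= d)
  (Hw1 : good_family h d P w1) (Hw2 : good_family h d P w2)
  (Htel : forall s S1 S2, d < Re s ->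
     has_sum P (fun i => step_quotient h (w1 i) s) S1 ->
     has_sum P (fun i => step_quotient h (w2 i) s) S2 -> (S1 + S2)%C = RtoC 0).

(* [xi_strip K] is the continuation to the half-plane Re s > d - K. *)
Fixpoint xi_strip (K : nat) (s : C) : C :=
  match K with
  | O => (zeta_sum P w1 s + zeta_sum P w2 s)%C
  | S k => (- (remainder_sum h P w1 (S k) s + remainder_sum h P w2 (S k) s)
            - psum (fun l => step_coef h (S l) s * xi_strip k (s + RtoC (INR (S l)))) k)%C
  end.

Lemma xi_strip_analytic K s : d - INR K < Re s -> locally_analytic (xi_strip K) s.
Proof.
  revert s. induction K as [|k IH]; intros s Hs.
  - cbn [INR] in Hs. apply locally_analytic_plus;
      apply (zeta_sum_spec h d P); auto; lra.
  - rewrite S_INR in Hs.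
    assert (H : locally_analytic (fun s =>
      - (1) * (remainder_sum h P w1 (S k) s + remainder_sum h P w2 (S k) s
       + psum (fun l => step_coef h (S l) s * xi_strip k (s + RtoC (INR (S l)))) k))%C s).
    { apply locally_analytic_scal, locally_analytic_plus; [apply locally_analytic_plus|].
      - apply (remainder_sum_spec h d P w1); auto. rewrite S_INR; lra.
      - apply (remainder_sum_spec h d P w2); auto. rewrite S_INR; lra.
      - apply (locally_analytic_psum
          (fun l s => step_coef h (S l) s * xi_strip k (s + RtoC (INR (S l))))%C).
        intros l _. apply locally_analytic_step_coef, locally_analytic_shift, IH.
        rewrite Re_plus_INR, S_INR. assert (H := pos_INR l). lra. }
    destruct H as [r [M [Hr H]]]. exists r, M. split; [auto|].
    eapply taylor_bounded_ext; [|exact H]. intros t _. cbn [xi_strip]. ring.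
Qed.

Lemma step_coef_0 s : step_coef h 0 s = RtoC 1.
Proof. unfold step_coef. cbn [Cpow binom_neg INR]. rewrite Rinv_1. ring. Qed.

(** In the region of convergence the recursion is the telescoped identity solved for its term l = 0,
    whose coefficient is 1. *)
Lemma xi_strip_eq_0 K s : d < Re s -> xi_strip K s = xi_strip 0 s.
Proof.
  revert s. induction K as [|k IH]; intros s Hs; [reflexivity|].
  assert (H := Htel s _ _ Hs (step_quotient_sum h d P w1 Hh Hah Hw1 (S k) s Hs)
    (step_quotient_sum h d P w2 Hh Hah Hw2 (S k) s Hs)).
  rewrite 2!psum_shift, step_coef_0 in H.
  replace (s + RtoC (INR 0))%C with s in H by (cbn [INR]; ring).
  cbn [xi_strip].
  rewrite (psum_ext _ (fun l => step_coef h (S l) s * zeta_sum P w1 (s + RtoC (INR (S l)))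
     + step_coef h (S l) s * zeta_sum P w2 (s + RtoC (INR (S l))))%C).
  - rewrite psum_plus.
    set (A1 := psum (fun l => step_coef h (S l) s * zeta_sum P w1 _)%C k) in *.
    set (A2 := psum (fun l => step_coef h (S l) s * zeta_sum P w2 _)%C k) in *.
    rewrite <- (Cplus_0_r (- _ - _)), <- H. ring.
  - intros l _. rewrite IH; [cbn [xi_strip]; ring|].
    rewrite Re_plus_INR, S_INR. assert (H' := pos_INR l). lra.
Qed.

(** Passing from k + 1 to k + 2 subtracted terms changes the remainder sums by q_(k+1)(s) times the
    zeta values at s + k + 1. The additional last term of the recursion cancels this, because s + k
    + 1 lies in the region of convergence. *)
Lemma xi_strip_S K s : d - INR K < Re s -> xi_strip (S K) s = xi_strip K s.
Proof.
  revert s. induction K as [|k IH]; intros s Hs.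
  - cbn [INR] in Hs. apply xi_strip_eq_0. lra.
  - assert (HsK : d < Re s + INR (S k)) by lra.
    transitivity (- (remainder_sum h P w1 (S (S k)) s + remainder_sum h P w2 (S (S k)) s)
       - (psum (fun l => step_coef h (S l) s * xi_strip (S k) (s + RtoC (INR (S l)))) k
          + step_coef h (S k) s * xi_strip (S k) (s + RtoC (INR (S k)))))%C; [reflexivity|].
    rewrite (remainder_sum_S h d P w1), (remainder_sum_S h d P w2) by auto.
    rewrite (xi_strip_eq_0 (S k) (s + RtoC (INR (S k)))) by now rewrite Re_plus_INR.
    rewrite (psum_ext _ (fun l => step_coef h (S l) s * xi_strip k (s + RtoC (INR (S l))))%C).
    + cbn [xi_strip]. ring.
    + intros l _. rewrite IH; [reflexivity|].
      rewrite Re_plus_INR. rewrite S_INR in Hs |- *. assert (H := pos_INR l). lra.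
Qed.

Lemma xi_strip_le K K' s : d - INR K < Re s -> (K <= K')%nat -> xi_strip K' s = xi_strip K s.
Proof.
  intros Hs H. induction H as [|K' H IH]; [reflexivity|].
  rewrite xi_strip_S; [exact IH|]. apply le_INR in H. lra.
Qed.

(** At s = 1 - m the coefficient contains binom(m - 1, l); its factor s + (m - 1) vanishes. *)
Lemma step_coef_nonpos_int l m : (1 <= m <= l)%nat ->
  step_coef h l (RtoC (1 - INR m)) = RtoC 0.
Proof.
  intros Hm. unfold step_coef. replace (binom_neg l (RtoC (1 - INR m))) with (RtoC 0); [ring|].
  induction l as [|l IH]; [lia|]. cbn [binom_neg].
  destruct (Nat.eq_dec m (S l)) as [->|Hne].
  - replace (RtoC (1 - INR (S l)) + RtoC (INR l))%C with (RtoC 0); [ring|].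
    rewrite <- RtoC_plus, S_INR. f_equal. ring.
  - rewrite <- IH by lia. ring.
Qed.

Lemma xi_strip_nonpos_int K m : (1 <= m)%nat -> d - INR K < 1 - INR m ->
  xi_strip K (RtoC (1 - INR m)) = RtoC 0.
Proof.
  revert m. induction K as [|k IH]; intros m Hm HK.
  - apply le_INR in Hm. cbn [INR] in *. lra.
  (* Because 1 <= d, being inside the strip already guarantees that enough terms were subtracted for
     the remainder to vanish. *)
  - assert (HmK : (m <= S k)%nat) by (apply INR_le; lra).
    cbn [xi_strip].
    rewrite (remainder_sum_nonpos_int h d P w1), (remainder_sum_nonpos_int h d P w2) by auto.
    rewrite psum_0; [ring|]. intros l Hl.
    destruct (Nat.le_gt_cases m (S l)) as [Hml|Hml].
    + rewrite step_coef_nonpos_int by lia. ring.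
    + replace (RtoC (1 - INR m) + RtoC (INR (S l)))%C with (RtoC (1 - INR (m - S l))).
      * rewrite IH; [ring|lia|]. rewrite minus_INR by lia. rewrite !S_INR in *.
        assert (H := pos_INR l). lra.
      * rewrite <- RtoC_plus. f_equal. rewrite minus_INR by lia. ring.
Qed.

Definition xi_cont (s : C) : C := xi_strip (Z.to_nat (up (d - Re s))) s.

Lemma up_nat_gt x : x < INR (Z.to_nat (up x)).
Proof.
  destruct (archimed x) as [H _]. eapply Rlt_le_trans; [exact H|].
  rewrite INR_IZR_INZ. apply IZR_le. lia.
Qed.

Lemma xi_cont_eq K s : d - INR K < Re s -> xi_cont s = xi_strip K s.
Proof.
  intros Hs. unfold xi_cont. assert (H := up_nat_gt (d - Re s)).
  set (K' := Z.to_nat _) in *.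
  destruct (Nat.le_ge_cases K K') as [HK|HK].
  - now apply xi_strip_le.
  - symmetry. apply xi_strip_le; [lra|auto].
Qed.

Lemma xi_cont_analytic s0 : locally_analytic xi_cont s0.
Proof.
  (* One strip more than s0 needs, so that a disc of radius up to 1 around s0 is served by a single
     [xi_strip K]. *)
  set (K := S (Z.to_nat (up (d - Re s0)))).
  assert (HK : d - INR K < Re s0 - 1).
  { unfold K. rewrite S_INR. assert (H := up_nat_gt (d - Re s0)). lra. }
  destruct (xi_strip_analytic K s0 ltac:(lra)) as [r [M [Hr H]]].
  assert (Hr' : 0 < Rmin r 1) by (apply Rmin_glb_lt; lra).
  exists (Rmin r 1), M. split; [auto|].
  eapply taylor_bounded_ext.
  2:{ eapply taylor_bounded_radius; [|exact H]. split; [auto|apply Rmin_l]. }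
  intros t Ht. symmetry. apply xi_cont_eq.
  assert (H1 := re_le_Cmod t). assert (H2 := Rmin_r r 1).
  assert (H3 : Rabs (Re t) <= 1) by lra. apply Rabs_le_between in H3.
  change (Re (s0 + t)) with (Re s0 + Re t). lra.
Qed.

Lemma xi_cont_nonpos_int m : (1 <= m)%nat -> xi_cont (RtoC (1 - INR m)) = RtoC 0.
Proof.
  intros Hm. assert (H := up_nat_gt (d - (1 - INR m))).
  rewrite (xi_cont_eq (Z.to_nat (up (d - (1 - INR m))))) by (cbn [Re RtoC fst]; lra).
  apply xi_strip_nonpos_int; [auto|lra].
Qed.

Lemma xi_cont_series s : d < Re s -> exists S1 S2,
  has_sum P (fun i => Cpow_neg (w1 i) s) S1 /\
  has_sum P (fun i => Cpow_neg (w2 i) s) S2 /\ xi_cont s = (S1 + S2)%C.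
Proof.
  intros Hs. exists (zeta_sum P w1 s), (zeta_sum P w2 s).
  split; [|split].
  - now apply (zeta_sum_spec h d P w1).
  - now apply (zeta_sum_spec h d P w2).
  - apply (xi_cont_eq 0). cbn [INR]. lra.
Qed.

End Continuation.

(** * Summability over the lattice *)

Definition zeta_term (p : R) (k : nat) : R := exp (- p * ln (1 + INR k)).

Lemma ln_succ_gap k : / (INR k + 2) <= ln (INR k + 2) - ln (INR k + 1).
Proof.
  assert (Hk := pos_INR k).
  assert (H : 1 + - / (INR k + 2) <= exp (- / (INR k + 2))) by apply exp_ineq1_le.
  replace (1 + - / (INR k + 2)) with ((INR k + 1) / (INR k + 2)) in H by (field; lra).
  assert (H1 : ln ((INR k + 1) / (INR k + 2)) <= - / (INR k + 2)).
  { rewrite <- (ln_exp (- / (INR k + 2))).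
    assert (Hp : 0 < (INR k + 1) / (INR k + 2)) by (apply Rdiv_lt_0_compat; lra).
    destruct H as [H| ->]; [left; now apply ln_increasing|lra]. }
  rewrite ln_div in H1 by lra. lra.
Qed.

(** The right side is 1 plus the integral of x^(-p) from 1 to N + 1. The integral test is carried
    out by induction, each increment being compared through 1 + x <= exp x. *)
Lemma zeta_partial_sums p N : 1 < p ->
  Rsum (zeta_term p) (seq 0 (S N))
  <= 1 + (1 - exp ((1 - p) * ln (INR N + 1))) / (p - 1).
Proof.
  intros Hp. induction N as [|N IH].
  - cbn [seq]. rewrite Rsum_cons. unfold zeta_term. cbn [INR Rsum fold_right].
    rewrite !Rplus_0_r, !Rplus_0_l, ln_1, !Rmult_0_r, exp_0. right. field. lra.
  - rewrite seq_S, Rsum_app, Rsum_cons. cbn [Nat.add].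
    change (Rsum (zeta_term p) nil) with 0. rewrite Rplus_0_r.
    assert (Hgap := ln_succ_gap N).
    unfold zeta_term at 2. rewrite S_INR.
    replace (1 + (INR N + 1)) with (INR N + 2) by ring.
    replace (INR N + 1 + 1) with (INR N + 2) by ring.
    assert (HN := pos_INR N).
    set (a := ln (INR N + 1)) in *. set (b := ln (INR N + 2)) in *.
    assert (Hb : / (INR N + 2) = exp (- b)).
    { unfold b. rewrite exp_Ropp, exp_ln by lra. reflexivity. }
    assert (H1 : exp ((1 - p) * b) * (1 + (p - 1) * (b - a)) <= exp ((1 - p) * a)).
    { replace ((1 - p) * a) with ((1 - p) * b + (p - 1) * (b - a)) by ring.
      rewrite exp_plus. apply Rmult_le_compat_l; [left; apply exp_pos|apply exp_ineq1_le]. }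
    assert (H2 : exp (- p * b) <= exp ((1 - p) * b) * (b - a)).
    { replace (- p * b) with ((1 - p) * b + - b) by ring. rewrite exp_plus, <- Hb.
      apply Rmult_le_compat_l; [left; apply exp_pos|auto]. }
    assert (H3 : exp (- p * b) <= (exp ((1 - p) * a) - exp ((1 - p) * b)) / (p - 1)).
    { apply (Rmult_le_reg_r (p - 1)); [lra|]. unfold Rdiv.
      rewrite (Rmult_assoc _ (/ (p - 1))), Rinv_l, Rmult_1_r by lra.
      apply Rle_trans with (exp ((1 - p) * b) * (b - a) * (p - 1)).
      - apply Rmult_le_compat_r; lra.
      - lra. }
    replace (1 + (1 - exp ((1 - p) * b)) / (p - 1))
      with (1 + (1 - exp ((1 - p) * a)) / (p - 1)
            + (exp ((1 - p) * a) - exp ((1 - p) * b)) / (p - 1)) by (field; lra).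
    lra.
Qed.

Fixpoint prod_term (g : nat -> R) (m : list nat) : R :=
  match m with nil => 1 | k :: m' => g k * prod_term g m' end.

(** A finite set of lists is contained in a product of finitely many heads and finitely many tails,
    over which the sum factors. *)
Lemma bounded_sums_prod g G d :
  (forall k, 0 <= g k) -> 0 <= G -> (forall N, Rsum g (seq 0 N) <= G) ->
  bounded_sums (fun m : list nat => length m = d) (prod_term g) (G ^ d).
Proof.
  intros Hg HG0 HG.
  assert (Hpos : forall m, 0 <= prod_term g m).
  { induction m as [|k m IH]; cbn; [lra|]. now apply Rmult_le_pos. }
  induction d as [|d IH]; intros l Hl HP.
  - apply Rle_trans with (Rsum (prod_term g) (nil :: nil)).
    + apply (Rsum_incl (fun _ => True)); auto using Forall_True.
      intros m Hm. rewrite Forall_forall in HP. specialize (HP m Hm).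
      destruct m; [now left|discriminate].
    + rewrite Rsum_cons. cbn. lra.
  - set (tails := map (@tl nat) l).
    assert (Ht : List.Forall (fun m => length m = d) tails).
    { rewrite Forall_forall in HP |- *. intros m Hm. apply in_map_iff in Hm.
      destruct Hm as [m0 [<- Hm0]]. specialize (HP m0 Hm0). destruct m0; [discriminate|].
      now injection HP. }
    destruct (nodup_exists _ _ Ht) as [M0 [HM1 [HM2 HM3]]].
    set (N := S (list_max (map (hd 0%nat) l))).
    assert (Hin : incl l (flat_map (fun k => map (cons k) M0) (seq 0 N))).
    { intros m Hm. rewrite Forall_forall in HP. specialize (HP m Hm).
      destruct m as [|k m']; [discriminate|].
      apply in_flat_map. exists k. split.
      - apply in_seq.
        assert (H := proj1 (list_max_le _ _) (le_n (list_max (map (hd 0%nat) l)))).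
        rewrite Forall_forall in H. specialize (H k). unfold N.
        assert (In k (map (hd 0%nat) l)) by (apply in_map_iff; now exists (k :: m')).
        specialize (H H0). lia.
      - apply in_map. apply HM3. apply in_map_iff. now exists (k :: m'). }
    eapply Rle_trans; [apply (Rsum_incl (fun _ => True)); [|exact Hl|apply Forall_True|exact Hin]|].
    { auto. }
    assert (Hrow : forall k, Rsum (prod_term g) (map (cons k) M0) = g k * Rsum (prod_term g) M0).
    { intros k. clear. induction M0 as [|m M0 IH]; [cbn; ring|].
      cbn [map]. rewrite 2!Rsum_cons, IH. cbn [prod_term]. ring. }
    assert (Hall : forall ks, Rsum (prod_term g) (flat_map (fun k => map (cons k) M0) ks)
       = Rsum g ks * Rsum (prod_term g) M0).
    { induction ks as [|k ks IHk]; [cbn; ring|].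
      cbn [flat_map]. rewrite Rsum_app, Rsum_cons, IHk, Hrow. ring. }
    rewrite Hall. cbn [pow]. apply Rmult_le_compat; auto.
    + apply (Rsum_incl (fun _ => True) g nil); auto using NoDup_nil, Forall_True.
      intros i [].
    + apply (Rsum_incl (fun _ => True) (prod_term g) nil); auto using NoDup_nil, Forall_True.
      intros i [].
Qed.

(* [(1 + |m|)^d] dominates the product of the [1 + m_j]. *)
Lemma zeta_term_prod p m : 0 <= p ->
  exp (- (p * INR (length m)) * ln (1 + INR (list_sum m))) <= prod_term (zeta_term p) m.
Proof.
  intros Hp.
  assert (H : forall X m, INR (list_sum m) <= X ->
    exp (- (p * INR (length m)) * ln (1 + X)) <= prod_term (zeta_term p) m).
  { clear m. intros X. induction m as [|k m IH]; intros HX.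
    - cbn. rewrite Rmult_0_r, Ropp_0, Rmult_0_l, exp_0. lra.
    - assert (Hk := pos_INR k). assert (Hm := pos_INR (list_sum m)).
      change (list_sum (k :: m)) with (k + list_sum m)%nat in HX. rewrite plus_INR in HX.
      cbn [length prod_term]. rewrite S_INR.
      replace (- (p * (INR (length m) + 1)) * ln (1 + X))
        with (- p * ln (1 + X) + - (p * INR (length m)) * ln (1 + X)) by ring.
      rewrite exp_plus. apply Rmult_le_compat; try (left; apply exp_pos).
      + unfold zeta_term. apply exp_le.
        assert (ln (1 + INR k) <= ln (1 + X)); [|nra].
        destruct (Rle_lt_or_eq_dec (INR k) X ltac:(lra)) as [Hlt| ->]; [|lra].
        left. apply ln_increasing; lra.
      + apply IH. lra. }
  apply H. apply Rle_refl.
Qed.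

(** Distributing the exponent evenly over the d coordinates gives each the exponent p = sigma / d >
    1, so a product of convergent one-dimensional sums is a majorant. *)
Lemma bounded_sums_norm d sigma c (f : list nat -> R) :
  (1 <= d)%nat -> INR d < sigma -> 0 < c ->
  (forall m, length m = d -> c * (1 + INR (list_sum m)) <= f m) ->
  exists B, bounded_sums (fun m => length m = d) (fun m => exp (- sigma * ln (f m))) B.
Proof.
  intros Hd Hs Hc Hf. set (p := sigma / INR d).
  assert (Hd0 : 0 < INR d) by (apply lt_0_INR; lia).
  assert (Hp : 1 < p).
  { unfold p. apply (Rmult_lt_reg_r (INR d)); [auto|]. unfold Rdiv.
    rewrite Rmult_assoc, Rinv_l; lra. }
  set (G := 1 + 1 / (p - 1)).
  assert (HG0 : 0 <= G).
  { unfold G. assert (0 < 1 / (p - 1)) by (apply Rdiv_lt_0_compat; lra). lra. }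
  assert (HG : forall N, Rsum (zeta_term p) (seq 0 N) <= G).
  { intros [|N]; [exact HG0|]. eapply Rle_trans; [now apply zeta_partial_sums|].
    unfold G. apply Rplus_le_compat_l. apply Rmult_le_compat_r.
    - left. apply Rinv_0_lt_compat. lra.
    - assert (He := exp_pos ((1 - p) * ln (INR N + 1))). lra. }
  exists (exp (- sigma * ln c) * G ^ d).
  apply (bounded_sums_ext _ _ (fun m => exp (- sigma * ln c) * prod_term (zeta_term p) m)).
  - intros m Hm. specialize (Hf m Hm).
    assert (Hl := pos_INR (list_sum m)).
    apply Rle_trans with (exp (- sigma * ln c) * exp (- sigma * ln (1 + INR (list_sum m)))).
    + rewrite <- exp_plus. apply exp_le.
      assert (Hs0 : 0 < sigma) by lra.
      assert (Hln : ln c + ln (1 + INR (list_sum m)) <= ln (f m));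
        [|clear - Hs0 Hln; nra].
      rewrite <- ln_mult by lra.
      destruct Hf as [Hf|Hf]; [left; apply ln_increasing; [nra|auto]|rewrite Hf; lra].
    + apply Rmult_le_compat_l; [left; apply exp_pos|].
      replace (- sigma) with (- (p * INR (length m))) by (rewrite Hm; unfold p; field; lra).
      apply zeta_term_prod. lra.
  - apply bounded_sums_scal; [left; apply exp_pos|].
    apply bounded_sums_prod; auto. intros k. left. apply exp_pos.
Qed.

Lemma bounded_lists_finite d N :
  exists L : list (list nat), forall m, length m = d -> (list_sum m <= N)%nat -> In m L.
Proof.
  induction d as [|d [L HL]].
  - exists (nil :: nil). intros [|k m] Hm _; [now left|discriminate].
  - exists (flat_map (fun k => map (cons k) L) (seq 0 (S N))).
    intros [|k m] Hm HN; [discriminate|].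
    change (list_sum (k :: m)) with (k + list_sum m)%nat in HN.
    apply in_flat_map. exists k. split; [apply in_seq; lia|].
    apply in_map, HL; [now injection Hm|lia].
Qed.

Lemma positive_min {I : Type} (f : I -> R) (L : list I) :
  exists delta, 0 < delta /\ forall i, In i L -> 0 < f i -> delta <= f i.
Proof.
  induction L as [|i L [delta [Hd H]]].
  - exists 1. split; [lra|]. intros i [].
  - destruct (Rlt_dec 0 (f i)) as [Hi|Hi].
    + exists (Rmin delta (f i)). split; [now apply Rmin_glb_lt|].
      intros j [<-|Hj] Hfj; [apply Rmin_r|].
      eapply Rle_trans; [apply Rmin_l|auto].
    + exists delta. split; [auto|]. intros j [<-|Hj] Hfj; [contradiction|auto].
Qed.

(** Beyond finitely many indices the linear term absorbs the offset K at the cost of half the slope;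
    on the remaining ones positivity gives a positive minimum. *)
Lemma linear_growth d (f : list nat -> R) c K : 0 < c ->
  (forall m, length m = d -> 0 < f m) ->
  (forall m, length m = d -> c * INR (list_sum m) - K <= f m) ->
  exists c', 0 < c' /\ forall m, length m = d -> c' * (1 + INR (list_sum m)) <= f m.
Proof.
  intros Hc Hpos Hf.
  (* The threshold (2 K + c) / c is where c X - K reaches (c / 2) (1 + X). *)
  destruct (nfloor_ex (Rmax 0 ((2 * K + c) / c)) (Rmax_l _ _)) as [N [_ HN]].
  destruct (bounded_lists_finite d (S N)) as [L HL].
  destruct (positive_min f L) as [delta [Hdl Hdelta]].
  assert (HN0 := pos_INR N).
  exists (Rmin (c / 2) (delta / (2 + INR N))). split.
  { apply Rmin_glb_lt; [lra|]. apply Rdiv_lt_0_compat; lra. }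
  intros m Hm. assert (Hl := pos_INR (list_sum m)).
  destruct (Nat.le_gt_cases (list_sum m) (S N)) as [Hle|Hgt].
  - eapply Rle_trans; [|apply Hdelta; auto].
    apply le_INR in Hle. rewrite S_INR in Hle.
    apply Rle_trans with (delta / (2 + INR N) * (2 + INR N)).
    + apply Rmult_le_compat; try lra.
      * apply Rmin_glb; [lra|]. apply Rdiv_le_0_compat; lra.
      * apply Rmin_r.
    + right. field. lra.
  - eapply Rle_trans; [|apply Hf; auto].
    apply lt_INR in Hgt. rewrite S_INR in Hgt.
    assert (H1 : (2 * K + c) / c <= INR (list_sum m)).
    { eapply Rle_trans; [apply (Rmax_r 0)|]. lra. }
    assert (H2 : 2 * K + c <= c * INR (list_sum m)).
    { replace (2 * K + c) with (c * ((2 * K + c) / c)) by (field; lra).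
      apply Rmult_le_compat_l; lra. }
    apply Rle_trans with (c / 2 * (1 + INR (list_sum m))).
    + apply Rmult_le_compat_r; [lra|apply Rmin_l].
    + lra.
Qed.

Lemma lin_comb_cons k m c W :
  lin_comb (k :: m) (c :: W) = (RtoC (INR k) * c + lin_comb m W)%C.
Proof. reflexivity. Qed.

(** * Position and growth of the lattice points *)

Section Lattice.
Variables (h z : C) (om : list C).
Hypotheses (Hh : h <> RtoC 0)
  (Hz : snd (z / h)%C <= 0)
  (Hom : forall w, In w om -> snd (w / h)%C < 0)
  (HzZ : forall n : Z, z <> (RtoC (IZR n) * h)%C).

(** A real linear functional bounded by a multiple of |w|. Untilted (e = 0) it vanishes on h; a
    small positive tilt makes it positive on h and a small negative one makes it positive on -h,
    which yields linear growth of |w| in the indices. *)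
Definition slope (e : R) (w : C) : R := e * fst (w / h)%C - snd (w / h)%C.

Lemma snd_div_plus a b : snd ((a + b) / h)%C = snd (a / h)%C + snd (b / h)%C.
Proof.
  replace ((a + b) / h)%C with (a / h + b / h)%C by (field; auto). reflexivity.
Qed.

Lemma snd_div_scal (x : R) a : snd (x * a / h)%C = x * snd (a / h)%C.
Proof.
  replace (x * a / h)%C with (x * (a / h))%C by (field; auto). cbn [snd fst Cmult RtoC]. ring.
Qed.

Lemma snd_div_self : snd (h / h)%C = 0.
Proof. replace (h / h)%C with (RtoC 1) by (field; auto). reflexivity. Qed.

Lemma slope_plus e a b : slope e (a + b) = slope e a + slope e b.
Proof.
  unfold slope. rewrite snd_div_plus.
  replace ((a + b) / h)%C with (a / h + b / h)%C by (field; auto). cbn [fst Cplus]. ring.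
Qed.

Lemma slope_scal e (x : R) a : slope e (x * a)%C = x * slope e a.
Proof.
  unfold slope. rewrite snd_div_scal.
  replace (x * a / h)%C with (x * (a / h))%C by (field; auto). cbn [snd fst Cmult RtoC]. ring.
Qed.

Lemma slope_lin_comb e c W : (forall w, In w W -> c <= slope e w) ->
  forall m, length m = length W -> c * INR (list_sum m) <= slope e (lin_comb m W).
Proof.
  induction W as [|w W IH]; intros Hc [|k m] Hm; try discriminate.
  - unfold slope, lin_comb. cbn. lra.
  - rewrite lin_comb_cons, slope_plus, slope_scal.
    change (list_sum (k :: m)) with (k + list_sum m)%nat. rewrite plus_INR.
    assert (H1 := IH (fun w Hw => Hc w (or_intror Hw)) m ltac:(now injection Hm)).
    assert (H2 := Hc w (or_introl eq_refl)). assert (Hk := pos_INR k). nra.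
Qed.

Lemma slope_Cmod e w : Rabs e <= 1 -> slope e w <= 2 / Cmod h * Cmod w.
Proof.
  intros He. unfold slope.
  assert (H1 := re_le_Cmod (w / h)). unfold Re in H1.
  assert (H2 := Rle_trans _ _ _ (Rmax_r _ _) (Rmax_Cmod (w / h)%C)).
  rewrite Cmod_div in H1, H2 by auto.
  assert (H3 : e * fst (w / h)%C <= Cmod w / Cmod h).
  { eapply Rle_trans; [apply Rle_abs|]. rewrite Rabs_mult.
    replace (Cmod w / Cmod h) with (1 * (Cmod w / Cmod h)) by ring.
    apply Rmult_le_compat; auto using Rabs_pos. }
  apply Rabs_le_between in H2. unfold Rdiv in *. lra.
Qed.

Lemma slope_uniform W : (forall w, In w W -> snd (w / h)%C < 0) ->
  exists e c, 0 < e <= 1 /\ 0 < c /\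
    forall x w, Rabs x <= e -> In w W -> c <= slope x w.
Proof.
  induction W as [|w W IH]; intros HW.
  - exists 1, 1. repeat split; try lra. intros x w _ [].
  - destruct IH as [e [c [He [Hc H]]]]; [intros; apply HW; now right|].
    assert (Hw := HW w (or_introl eq_refl)).
    set (y := - snd (w / h)%C). assert (Hy : 0 < y) by (unfold y; lra).
    set (a := Rabs (fst (w / h)%C)). assert (Ha : 0 <= a) by apply Rabs_pos.
    (* A tilt of this size changes the slope of w by at most y / 2, for either sign, leaving at
       least y / 2. *)
    exists (Rmin e (y / (2 * (a + 1)))), (Rmin c (y / 2)).
    assert (Hq : 0 < y / (2 * (a + 1))) by (apply Rdiv_lt_0_compat; lra).
    repeat split.
    + apply Rmin_glb_lt; lra.
    + eapply Rle_trans; [apply Rmin_l|lra].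
    + apply Rmin_glb_lt; lra.
    + intros x w' Hx [<-|Hw'].
      * eapply Rle_trans; [apply Rmin_r|]. unfold slope. fold y.
        assert (Hx' : Rabs x <= y / (2 * (a + 1))) by (eapply Rle_trans; [exact Hx|apply Rmin_r]).
        assert (H1 : - (x * fst (w / h)%C) <= y / 2); [|unfold y in *; lra].
        eapply Rle_trans; [apply Rle_abs|]. rewrite Rabs_Ropp, Rabs_mult. fold a.
        apply Rle_trans with (y / (2 * (a + 1)) * (a + 1)).
        -- apply Rmult_le_compat; auto using Rabs_pos; lra.
        -- right. field. lra.
      * eapply Rle_trans; [apply Rmin_l|]. apply H; auto.
        eapply Rle_trans; [exact Hx|apply Rmin_l].
Qed.

(** The generators lie strictly below the line through h, so a nonnegative combination reaches that
    line only by being 0. With z outside Z h, this keeps every lattice point nonzero. *)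
Lemma lin_comb_half m : length m = length om ->
  snd (lin_comb m om / h)%C <= 0 /\
  (snd (lin_comb m om / h)%C = 0 -> lin_comb m om = RtoC 0).
Proof.
  clear Hz HzZ z. revert m.
  induction om as [|w W IH]; intros [|k m] Hm; try discriminate.
  - change (lin_comb nil nil) with (RtoC 0).
    replace (0 / h)%C with (RtoC 0) by (field; auto). cbn. split; [lra|auto].
  - rewrite lin_comb_cons, snd_div_plus, snd_div_scal.
    destruct (IH (fun w Hw => Hom w (or_intror Hw)) m ltac:(now injection Hm)) as [H1 H2].
    assert (H3 := Hom w (or_introl eq_refl)). assert (Hk := pos_INR k).
    assert (H4 : INR k * snd (w / h)%C <= 0) by nra.
    split; [lra|]. intros H.
    assert (Hk0 : INR k = 0) by nra.
    rewrite H2 by lra. rewrite Hk0. ring.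
Qed.

Definition lattice_point (n : Z) (m : list nat) : C :=
  (z + RtoC (IZR n) * h + lin_comb m om)%C.

Lemma lattice_point_half n m : length m = length om -> in_half h (lattice_point n m).
Proof.
  intros Hm. destruct (lin_comb_half m Hm) as [H1 H2].
  assert (E : snd (lattice_point n m / h)%C = snd (z / h)%C + snd (lin_comb m om / h)%C).
  { unfold lattice_point. rewrite 2!snd_div_plus, snd_div_scal, snd_div_self. ring. }
  split; [|lra]. intros H0. rewrite H0 in E.
  replace (0 / h)%C with (RtoC 0) in E by (field; auto). cbn [snd RtoC] in E.
  unfold lattice_point in H0. rewrite H2 in H0 by lra.
  apply (HzZ (- n)%Z). rewrite opp_IZR, RtoC_opp.
  replace z with (z + IZR n * h + 0 - IZR n * h)%C by ring. rewrite H0. ring.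
Qed.

Lemma lattice_point_succ n m : (lattice_point n m + h)%C = lattice_point (n + 1) m.
Proof. unfold lattice_point. rewrite plus_IZR, RtoC_plus. ring. Qed.

(** Both families are written as the summands of the two Barnes series, so they match the definition
    by conversion. The head of the list counts steps along the direction of h. *)
Definition upper_point (m : list nat) : C := (z + h + lin_comb m (h :: om))%C.
Definition lower_point (m : list nat) : C := (z + lin_comb m ((- h)%C :: om))%C.

Lemma upper_point_cons k m : upper_point (k :: m) = lattice_point (1 + Z.of_nat k) m.
Proof.
  unfold upper_point, lattice_point.
  rewrite lin_comb_cons, plus_IZR, <- INR_IZR_INZ, RtoC_plus. ring.
Qed.

Lemma lower_point_cons k m : lower_point (k :: m) = lattice_point (- Z.of_nat k) m.
Proof.
  unfold lower_point, lattice_point.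
  rewrite lin_comb_cons, opp_IZR, <- INR_IZR_INZ, RtoC_opp. ring.
Qed.

Lemma point_growth x c0 W e c :
  Rabs e <= 1 -> 0 < c -> (forall w, In w (c0 :: W) -> c <= slope e w) ->
  (forall m, length m = S (length W) -> (x + lin_comb m (c0 :: W))%C <> RtoC 0) ->
  exists c', 0 < c' /\ forall m, length m = S (length W) ->
    c' * (1 + INR (list_sum m)) <= Cmod (x + lin_comb m (c0 :: W))%C.
Proof.
  intros He Hc HW Hnz. assert (Hmh := proj1 (Cmod_gt_0 h) Hh).
  apply (linear_growth _ _ (Cmod h / 2 * c) (Cmod h / 2 * - slope e x)).
  - apply Rmult_lt_0_compat; lra.
  - intros m Hm. now apply Cmod_gt_0, Hnz.
  - intros m Hm.
    assert (H1 := slope_lin_comb e c (c0 :: W) HW m Hm).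
    assert (H2 := slope_Cmod e (x + lin_comb m (c0 :: W)) He).
    rewrite slope_plus in H2.
    apply Rle_trans with (Cmod h / 2 * (slope e x + slope e (lin_comb m (c0 :: W)))); [nra|].
    replace (Cmod (x + lin_comb m (c0 :: W)))
      with (Cmod h / 2 * (2 / Cmod h * Cmod (x + lin_comb m (c0 :: W)))) by (field; lra).
    apply Rmult_le_compat_l; lra.
Qed.

(** The upper family uses the tilt e and the lower one -e, since -h has slope e for the tilt -e. *)
Lemma points_growth : exists c, 0 < c /\ forall m, length m = S (length om) ->
  c * (1 + INR (list_sum m)) <= Cmod (upper_point m) /\
  c * (1 + INR (list_sum m)) <= Cmod (lower_point m).
Proof.
  destruct (slope_uniform om Hom) as [e [c [He [Hc H]]]].
  assert (Hself : forall x, slope x h = x).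
  { intros x. unfold slope. rewrite snd_div_self.
    replace (h / h)%C with (RtoC 1) by (field; auto). cbn. ring. }
  assert (Hm : 0 < Rmin c e) by (apply Rmin_glb_lt; lra).
  destruct (point_growth (z + h) h om e (Rmin c e)) as [c1 [Hc1 H1]]; auto.
  { rewrite Rabs_pos_eq; lra. }
  { intros w [<-|Hw].
    - rewrite Hself. apply Rmin_r.
    - eapply Rle_trans; [apply Rmin_l|]. apply H; auto. rewrite Rabs_pos_eq; lra. }
  { intros [|k m] Hl; [discriminate|]. fold (upper_point (k :: m)).
    rewrite upper_point_cons. apply lattice_point_half. now injection Hl. }
  destruct (point_growth z (- h)%C om (- e) (Rmin c e)) as [c2 [Hc2 H2]]; auto.
  { rewrite Rabs_Ropp, Rabs_pos_eq; lra. }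
  { intros w [<-|Hw].
    - replace (- h)%C with (RtoC (-1) * h)%C by (apply injective_projections; cbn; ring).
      rewrite slope_scal, Hself. replace (-1 * - e) with e by ring. apply Rmin_r.
    - eapply Rle_trans; [apply Rmin_l|]. apply H; auto. rewrite Rabs_Ropp, Rabs_pos_eq; lra. }
  { intros [|k m] Hl; [discriminate|]. fold (lower_point (k :: m)).
    rewrite lower_point_cons. apply lattice_point_half. now injection Hl. }
  exists (Rmin c1 c2). split; [now apply Rmin_glb_lt|].
  intros m Hl. assert (Hs := pos_INR (list_sum m)). split.
  - eapply Rle_trans; [|apply H1, Hl]. apply Rmult_le_compat_r; [lra|apply Rmin_l].
  - eapply Rle_trans; [|apply H2, Hl]. apply Rmult_le_compat_r; [lra|apply Rmin_r].
Qed.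

Definition is_index (m : list nat) : Prop := length m = S (length om).

Lemma good_points :
  good_family h (INR (length om) + 1) is_index upper_point /\
  good_family h (INR (length om) + 1) is_index lower_point.
Proof.
  destruct points_growth as [c [Hc H]].
  assert (Hc1 : forall m, is_index m -> c <= Cmod (upper_point m) /\ c <= Cmod (lower_point m)).
  { intros m Hm. destruct (H m Hm) as [H1 H2]. assert (Hs := pos_INR (list_sum m)).
    split; [eapply Rle_trans; [|exact H1]|eapply Rle_trans; [|exact H2]]; nra. }
  split; constructor.
  - intros [|k m] Hm; [discriminate|]. injection Hm as Hm.
    rewrite upper_point_cons, lattice_point_succ. split; now apply lattice_point_half.
  - exists c. split; [auto|]. intros [|k m] Hm; [discriminate|].
    split; [now apply Hc1|].
    rewrite upper_point_cons, lattice_point_succ.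
    replace (1 + Z.of_nat k + 1)%Z with (1 + Z.of_nat (S k))%Z by lia.
    rewrite <- upper_point_cons. now apply Hc1.
  - intros sigma Hs. rewrite <- S_INR in Hs.
    apply (bounded_sums_norm _ sigma c); auto; [lia|]. intros m Hm. now apply H.
  - intros [|k m] Hm; [discriminate|]. injection Hm as Hm.
    rewrite lower_point_cons, lattice_point_succ. split; now apply lattice_point_half.
  - exists c. split; [auto|]. intros [|k m] Hm; [discriminate|].
    split; [now apply Hc1|].
    (* A step by h from the lower point with k = 0 lands on the first upper point; the other lower
       points step within their family. *)
    rewrite lower_point_cons, lattice_point_succ. destruct k as [|k].
    + change (- Z.of_nat 0 + 1)%Z with (1 + Z.of_nat 0)%Z.
      rewrite <- upper_point_cons. now apply (Hc1 (0%nat :: m)).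
    + replace (- Z.of_nat (S k) + 1)%Z with (- Z.of_nat k)%Z by lia.
      rewrite <- lower_point_cons. now apply (Hc1 (k :: m)).
  - intros sigma Hs. rewrite <- S_INR in Hs.
    apply (bounded_sums_norm _ sigma c); auto; [lia|]. intros m Hm. now apply H.
Qed.

End Lattice.

(** * Telescoping *)

Lemma power_decay a c eps : 0 < a -> 0 < c -> 0 < eps ->
  exists N0, forall N, (N0 <= N)%nat -> exp (- a * ln (c * (1 + INR N))) < eps.
Proof.
  intros Ha Hc Heps. set (X := - ln eps / a).
  assert (Hx : 0 <= exp X / c) by (left; apply Rdiv_lt_0_compat; [apply exp_pos|auto]).
  destruct (nfloor_ex _ Hx) as [N0 [_ HN0]]. exists N0. intros N HN.
  apply le_INR in HN. assert (HN1 := pos_INR N0).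
  rewrite <- (exp_ln eps) by auto. apply exp_increasing.
  assert (H : X < ln (c * (1 + INR N))).
  { rewrite <- (ln_exp X). apply ln_increasing; [apply exp_pos|].
    replace (exp X) with (c * (exp X / c)) by (field; lra).
    apply Rmult_lt_compat_l; lra. }
  replace (ln eps) with (- a * X) by (unfold X; field; lra). nra.
Qed.

(** Finitely many lines in direction h, with the same initial segment on each, so that the sum over
    every line telescopes. *)
Definition box (M0 : list (list nat)) (N : nat) : list (list nat) :=
  flat_map (fun m => map (fun k => k :: m) (seq 0 N)) M0.

Lemma Csum_map {I J : Type} (f : I -> J) (a : J -> C) l :
  Csum a (map f l) = Csum (fun i => a (f i)) l.
Proof. induction l as [|i l IH]; [reflexivity|]. cbn [map]. now rewrite 2!Csum_cons, IH. Qed.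

Lemma Csum_box a M0 N :
  Csum a (box M0 N) = Csum (fun m => psum (fun k => a (k :: m)) N) M0.
Proof.
  induction M0 as [|m M0 IH]; [reflexivity|].
  unfold box. cbn [flat_map]. rewrite Csum_app, Csum_map, <- psum_Csum, Csum_cons.
  f_equal. exact IH.
Qed.

Lemma box_NoDup M0 N : NoDup M0 -> NoDup (box M0 N).
Proof.
  induction 1 as [|m M0 Hm HM IH]; [apply NoDup_nil|].
  unfold box. cbn [flat_map]. apply NoDup_app.
  - apply Injective_map_NoDup; [|apply seq_NoDup]. intros k k' E. now injection E.
  - exact IH.
  - intros x Hx Hx'. apply in_map_iff in Hx. destruct Hx as [k [<- _]].
    apply in_flat_map in Hx'. destruct Hx' as [m' [Hm' Hx']].
    apply in_map_iff in Hx'. destruct Hx' as [k' [E _]]. injection E as _ ->. contradiction.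
Qed.

(** Boxes are cofinal among the finite index sets, so unordered sums can be read off on them. *)
Lemma box_cover d (l : list (list nat)) : List.Forall (fun m => length m = S d) l ->
  exists M0 N0, NoDup M0 /\ List.Forall (fun m => length m = d) M0 /\
    forall N, (N0 <= N)%nat -> incl l (box M0 N).
Proof.
  intros HP. rewrite Forall_forall in HP.
  assert (Ht : List.Forall (fun m => length m = d) (map (@tl nat) l)).
  { rewrite Forall_forall. intros m Hm. apply in_map_iff in Hm.
    destruct Hm as [m0 [<- Hm0]]. specialize (HP m0 Hm0). destruct m0; [discriminate|].
    now injection HP. }
  destruct (nodup_exists _ _ Ht) as [M0 [HM1 [HM2 HM3]]].
  exists M0, (S (list_max (map (hd 0%nat) l))). repeat split; auto.
  intros N HN m Hm. specialize (HP m Hm). destruct m as [|k m']; [discriminate|].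
  apply in_flat_map. exists m'. split.
  - apply HM3. apply in_map_iff. now exists (k :: m').
  - apply in_map_iff. exists k. split; [reflexivity|]. apply in_seq.
    assert (H := proj1 (list_max_le _ _) (le_n (list_max (map (hd 0%nat) l)))).
    rewrite Forall_forall in H. specialize (H k). cbv beta in H.
    assert (In k (map (hd 0%nat) l)) by (apply in_map_iff; now exists (k :: m')).
    specialize (H H0). lia.
Qed.

Lemma box_length M0 N d : List.Forall (fun m => length m = d) M0 ->
  List.Forall (fun m => length m = S d) (box M0 N).
Proof.
  rewrite 2!Forall_forall. intros H x Hx. apply in_flat_map in Hx.
  destruct Hx as [m [Hm Hx]]. apply in_map_iff in Hx. destruct Hx as [k [<- _]].
  cbn. now rewrite (H m Hm).
Qed.

Lemma psum_telescope (u : nat -> C) N : psum (fun k => u (S k) - u k)%C N = (u N - u 0%nat)%C.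
Proof. induction N as [|N IH]; cbn [psum]; [|rewrite IH]; ring. Qed.

Section Lattice.
Variables (h z : C) (om : list C).
Hypotheses (Hh : h <> RtoC 0)
  (Hz : snd (z / h)%C <= 0)
  (Hom : forall w, In w om -> snd (w / h)%C < 0)
  (HzZ : forall n : Z, z <> (RtoC (IZR n) * h)%C).

(* On a box of indices the sums over the two families telescope to the values of
   w^(1-s) / (h (1 - s)) at the far ends of the lines in direction h. *)
Lemma step_quotient_telescope s S1 S2 : INR (length om) + 1 < Re s ->
  has_sum (is_index om) (fun m => step_quotient h (upper_point h z om m) s) S1 ->
  has_sum (is_index om) (fun m => step_quotient h (lower_point h z om m) s) S2 ->
  (S1 + S2)%C = RtoC 0.
Proof.
  intros Hs HS1 HS2. assert (Hr := pos_INR (length om)).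
  assert (Hs1 : s <> RtoC 1) by (intros E; rewrite E in Hs; cbn in Hs; lra).
  assert (Hs1' : (1 - s)%C <> RtoC 0).
  { intros E. apply Hs1. replace s with (1 - (1 - s))%C by ring. rewrite E. ring. }
  destruct (points_growth h z om Hh Hz Hom HzZ) as [c [Hc Hgrow]].
  set (a := Re s - 1). assert (Ha : 0 < a) by (unfold a; lra).
  set (g := fun w => (Cpow_neg w (s - 1) / (h * (1 - s)))%C).
  assert (Hq : forall w, step_quotient h w s = (g (w + h)%C - g w)%C).
  { intros w. unfold step_quotient, g. destruct (Ceq_dec s 1); [contradiction|]. field. auto. }
  assert (Hden : 0 < Cmod (h * (1 - s))) by now apply Cmod_gt_0, Cmult_neq_0.
  set (K := exp (PI * Rabs (Im (s - 1))) / Cmod (h * (1 - s))).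
  assert (HK : 0 < K) by (apply Rdiv_lt_0_compat; [apply exp_pos|auto]).
  assert (Hg : forall w N, c * (1 + INR N) <= Cmod w ->
    Cmod (g w) <= K * exp (- a * ln (c * (1 + INR N)))).
  { intros w N Hw. assert (HN := pos_INR N).
    assert (Hpos : 0 < c * (1 + INR N)) by (apply Rmult_lt_0_compat; lra).
    assert (Hw0 : w <> RtoC 0) by (apply Cmod_gt_0; lra).
    unfold g. rewrite Cmod_div by now apply Cmult_neq_0.
    apply Rle_trans with (exp (- Re (s - 1) * ln (Cmod w) + PI * Rabs (Im (s - 1)))
      / Cmod (h * (1 - s))).
    - apply Rmult_le_compat_r; [left; now apply Rinv_0_lt_compat|]. now apply Cmod_Cpow_neg_le.
    - replace (K * exp (- a * ln (c * (1 + INR N))))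
        with (exp (- a * ln (c * (1 + INR N))) * exp (PI * Rabs (Im (s - 1)))
              / Cmod (h * (1 - s))) by (unfold K; field; lra).
      rewrite exp_plus. apply Rmult_le_compat_r; [left; now apply Rinv_0_lt_compat|].
      apply Rmult_le_compat_r; [left; apply exp_pos|].
      apply exp_le. replace (Re (s - 1)) with a by reflexivity.
      assert (Hln : ln (c * (1 + INR N)) <= ln (Cmod w)); [|clear - Ha Hln; nra].
      destruct Hw as [Hw|Hw]; [left; now apply ln_increasing|rewrite Hw; lra]. }
  apply Cmod_small_eq. intros eps Heps.
  destruct (HS1 (eps / 4)) as [l1 [_ [Hl1 HS1']]]; [lra|].
  destruct (HS2 (eps / 4)) as [l2 [_ [Hl2 HS2']]]; [lra|].
  destruct (box_cover (length om) (l1 ++ l2)) as [M0 [N0 [HM1 [HM2 HM3]]]].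
  { now apply Forall_app. }
  (* Each line contributes two far ends, each at most K times the decaying power. The number of
     lines is fixed before N is chosen. *)
  set (cnt := Rsum (fun _ : list nat => 2 * K) M0).
  assert (Hcnt : 0 <= cnt).
  { apply (Rsum_incl (fun _ => True) (fun _ : list nat => 2 * K) nil);
      auto using NoDup_nil, Forall_True.
    - intros; lra.
    - intros i []. }
  destruct (power_decay a c (eps / 2 / (cnt + 1)) Ha Hc) as [N1 HN1].
  { apply Rdiv_lt_0_compat; lra. }
  (* A successor, so that the term k = 0 of the lower family can be split off; the lower line then
     ends at N0 + N1 and the upper one at N. *)
  set (N := S (N0 + N1)).
  assert (Hinc := HM3 N ltac:(unfold N; lia)).
  assert (HB1 := box_NoDup M0 N HM1). assert (HB2 := box_length M0 N _ HM2).
  specialize (HS1' (box M0 N) HB1 HB2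
    ltac:(intros x Hx; apply Hinc, in_or_app; now left)).
  specialize (HS2' (box M0 N) HB1 HB2
    ltac:(intros x Hx; apply Hinc, in_or_app; now right)).
  set (A1 := Csum _ (box M0 N)) in HS1'.
  set (A2 := Csum _ (box M0 N)) in HS2'.
  assert (HA : Cmod (A1 + A2) <= eps / 2).
  { assert (E : (A1 + A2)%C = Csum (fun m => g (upper_point h z om (N :: m))
        - g (lower_point h z om ((N0 + N1)%nat :: m)))%C M0).
    { unfold A1, A2. rewrite 2!Csum_box, <- Csum_plus. apply Csum_ext. intros m _.
      rewrite (psum_ext _ (fun k => g (upper_point h z om (S k :: m))
                                    - g (upper_point h z om (k :: m)))%C).
      2:{ intros k _. rewrite Hq, 2!upper_point_cons, lattice_point_succ.
          do 3 f_equal. lia. }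
      rewrite (psum_telescope (fun k => g (upper_point h z om (k :: m)))).
      unfold N. rewrite psum_shift.
      rewrite (psum_ext _ (fun k => - (1) * (g (lower_point h z om (S k :: m))
                                    - g (lower_point h z om (k :: m))))%C).
      2:{ intros k _. rewrite Hq, 2!lower_point_cons, lattice_point_succ.
          replace (- Z.of_nat (S k) + 1)%Z with (- Z.of_nat k)%Z by lia. ring. }
      rewrite psum_scal, (psum_telescope (fun k => g (lower_point h z om (k :: m)))).
      (* The split-off term joins the two halves: it ends at the first upper point, where it cancels
         the near end of the upper sum. *)
      rewrite Hq. rewrite (lower_point_cons h z om 0), lattice_point_succ.
      change (- Z.of_nat 0 + 1)%Z with (1 + Z.of_nat 0)%Z. rewrite <- upper_point_cons. ring. }
    rewrite E. set (u := exp (- a * ln (c * (1 + INR (N0 + N1))))).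
    specialize (HN1 (N0 + N1)%nat ltac:(lia)). fold u in HN1.
    assert (Hu : 0 < u) by apply exp_pos.
    eapply Rle_trans.
    { apply (Cmod_Csum_le (fun m => length m = length om) _ (fun _ => u * (2 * K)));
        [exact HM2|].
      intros m Hm.
      destruct (Hgrow (N :: m) ltac:(cbn; now rewrite Hm)) as [H1 _].
      destruct (Hgrow ((N0 + N1)%nat :: m) ltac:(cbn; now rewrite Hm)) as [_ H2].
      assert (Hls : forall k, INR k <= INR (list_sum (k :: m))).
      { intros k. apply le_INR. cbn. lia. }
      assert (Hl3 := Hls N). assert (Hl4 := Hls (N0 + N1)%nat).
      assert (HNS : INR (N0 + N1) <= INR N) by (apply le_INR; unfold N; lia).
      assert (G1 := Hg (upper_point h z om (N :: m)) (N0 + N1)%nat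
        ltac:(eapply Rle_trans; [|exact H1]; apply Rmult_le_compat_l; lra)).
      assert (G2 := Hg (lower_point h z om ((N0 + N1)%nat :: m)) (N0 + N1)%nat
        ltac:(eapply Rle_trans; [|exact H2]; apply Rmult_le_compat_l; lra)).
      fold u in G1, G2. eapply Rle_trans; [apply Cmod_triangle|]. rewrite Cmod_opp. lra. }
    rewrite Rsum_scal. fold cnt.
    apply Rle_trans with (eps / 2 / (cnt + 1) * (cnt + 1)).
    - apply Rmult_le_compat; lra.
    - right. field. lra. }
  replace (S1 + S2 - 0)%C with (- (A1 - S1) + - (A2 - S2) + (A1 + A2))%C by ring.
  eapply Rle_trans; [apply Cmod_triangle|].
  assert (H := Cmod_triangle (- (A1 - S1)) (- (A2 - S2))). rewrite 2!Cmod_opp in H. lra.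
Qed.

End Lattice.

Theorem corollary4p8 (r : nat) (omega0 z : C) (omega : list C)
  (hr : length omega = r)
  (homega0_nz : omega0 <> RtoC 0)
  (homega0 : 0 < Carg omega0 <= PI)
  (hz : Carg omega0 - PI <= Carg z <= Carg omega0)
  (homega : forall w : C, In w omega ->
     w <> RtoC 0 /\ Carg omega0 - PI < Carg w < Carg omega0)
  (hzZ : forall n : Z, z <> Cmult (RtoC (IZR n)) omega0) :
  (exists xi : C -> C, is_bilateral_zeta z omega0 omega xi) /\
  (forall xi : C -> C, is_bilateral_zeta z omega0 omega xi ->
     entire xi /\
     (forall m : nat, (1 <= m)%nat -> xi (RtoC (1 - INR m)) = RtoC 0)).
Proof.
  assert (Hz0 : z <> RtoC 0) by (intros E; apply (hzZ 0%Z); rewrite E; ring).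
  assert (Hz : snd (z / omega0)%C <= 0).
  { exact (proj2 (in_half_of_Carg omega0 homega0_nz z Hz0 hz)). }
  assert (Hom : forall w, In w omega -> snd (w / omega0)%C < 0).
  { intros w Hw. destruct (homega w Hw). now apply div_neg_of_Carg. }
  destruct (good_points omega0 z omega homega0_nz Hz Hom hzZ) as [Hg1 Hg2].
  set (d := INR (length omega) + 1) in *.
  assert (Hd : 1 <= d) by (unfold d; assert (H := pos_INR (length omega)); lra).
  assert (Htel := step_quotient_telescope omega0 z omega homega0_nz Hz Hom hzZ).
  set (E := xi_cont omega0 d (is_index omega)
    (upper_point omega0 z omega) (lower_point omega0 z omega)).
  assert (HEan : forall s, locally_analytic E s) by (intros s; now apply xi_cont_analytic).
  assert (HEser : forall s, Re s > d -> is_bilateral_series s z omega0 omega (E s)).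
  { intros s Hs.
    exact (xi_cont_series omega0 d _ _ _ homega0_nz homega0 Hg1 Hg2 Htel s Hs). }
  split.
  - exists E. split; [now apply meromorphic_of_analytic|exact HEser].
  - intros xi [Hmer Hser].
    (* Uniqueness of the sums gives equality for Re s > d; the identity theorem extends it to every
       s, possible poles of [xi] included. *)
    assert (Heq : forall s, xi s = E s).
    { apply (meromorphic_unique xi E d); auto. intros s Hs.
      destruct (Hser s Hs) as [S1 [S2 [H1 [H2 ->]]]].
      destruct (HEser s Hs) as [T1 [T2 [H3 [H4 ->]]]].
      now rewrite (has_sum_unique _ _ _ _ H1 H3), (has_sum_unique _ _ _ _ H2 H4). }
    split.
    + intros s. destruct (HEan s) as [rho [M [Hr HM]]].
      apply (ex_derive_of_taylor s rho xi M); [auto|].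
      eapply taylor_bounded_ext; [|exact HM]. intros; now rewrite Heq.
    + intros m Hm. rewrite Heq. now apply xi_cont_nonpos_int.
Qed.
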